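(* Let $B \subseteq \mathbb{Z}_{\geq 0}$ be a subset and $F$ be a regularly varying function satisfying conditions (i)--(iii) below. Let $h\geq \max\{2H_{\textnormal{(ii)}}+1, H_{\textnormal{(iii)}}\}$ be an integer and suppose $F(n)\leq (1+o(1))r_{B,h}(n)$. If $F(n)/\log n \to \infty$ as $n\to\infty$, then there exists $A\subseteq B$ such that \[ r_{A,h}(n) \sim \mathfrak{S}_{B,h}(n) F(n) \quad\text{for}\quad n\in\mathscr{S}. \] If $F(n) \gg \log n$, then there exists $A\subseteq B$ such that \[ r_{A,h}(n)\asymp F(n) \quad\text{for}\quad n\in\mathscr{S}. \]
   Context: For $A\subseteq \mathbb{Z}_{\geq 0}$ and an integer $h\geq 2$, $r_{A,h}(n)$ denotes the number of $(x_1,\ldots,x_h)\in A^h$ with $x_1+\cdots+x_h=n$. A measurable $F:\mathbb{R}_{>0}\to\mathbb{R}_{>0}$ is regularly varying if $\lim_{x\to\infty}F(\lambda x)/F(x)$ exists (and is finite positive) for every $\lambda>0$; such $F$ have the form $F(x)=x^{\kappa}\psi(x)$ with $\psi$ slowly varying ($\psi(\lambda x)/\psi(x)\to 1$). Write $B(x):=|B\cap[1,x]|$. The conditions are: (i) (Regular variation) There is $\beta=\beta(B)>0$ such that for every fixed $\lambda\geq 1$, $B(\lambda x)\sim \lambda^{\beta}B(x)$. (ii) (Low additive energy) There exists $H_{\textnormal{(ii)}}\in\mathbb{Z}_{\geq 1}$ such that for every $h\geq H_{\textnormal{(ii)}}$, $\sum_{n\leq x} r_{B,h}(n)^2 \ll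 \frac{B(x)^{2h}}{x}x^{o(1)}$. (iii) (Counting solutions with weights) There exists $H_{\textnormal{(iii)}}\in\mathbb{Z}_{\geq 1}$ such that: if $h\geq H_{\textnormal{(iii)}}$ and $F(n)\leq(1+o(1))r_{B,h}(n)$ is such that $f(x):=(xF(x))^{1/h}=x^{\omega}\phi(x)$ (with $\phi$ slowly varying) satisfies $1/h\leq\omega\leq\beta$, then \[ \sum_{\substack{x_1,\ldots,x_h\in B\\ x_1+\cdots+x_h=n}} \frac{f(x_1)}{B(x_1)}\cdots\frac{f(x_h)}{B(x_h)} \sim \mathfrak{S}_{B,h}(n)\,C_{B,h,f}\,\frac{f(n)^h}{n}, \] where $C_{B,h,f}>0$ is a constant and $\mathfrak{S}_{B,h}(n)$ is some function of $n$ with $\mathfrak{S}_{B,h}(n)\asymp 1$ for $n\in\mathscr{S}$, for some subset $\mathscr{S}\subseteq\mathbb{Z}_{\geq 0}$.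
   Formalization: The first claim additionally assumes 𝔖_{B,h}(n)F(n) ≤ (1+o(1)) r_{B,h}(n) for n∈𝒮, a necessary condition, since (iii) fixes 𝔖 only up to a constant factor (B=ℤ≥0, h=3, F=x²/2, 𝔖=100 is a counterexample otherwise). *)

(* Defs.v *)
From mathcomp Require Import all_boot all_order all_algebra.
From mathcomp Require Import all_classical all_reals all_analysis.

Set Implicit Arguments.
Unset Strict Implicit.
Unset Printing Implicit Defensive.

Import Order.TTheory GRing.Theory Num.Theory.
Import numFieldNormedType.Exports.

Local Open Scope classical_set_scope.
Local Open Scope ring_scope.

(* The Landau notations need the filter at +oo as a canonical filter_on. *)
Canonical pinfty_filter_on (R : realType) : filter_on R :=
  FilterType (pinfty_nbhs R) _.

(* Coordinates can be taken in 'I_n.+1, since natural numbers with sum n are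
   all at most n. *)
Definition representations (A : set nat) (h n : nat) :
    {set {ffun 'I_h -> 'I_n.+1}} :=
  [set x : {ffun 'I_h -> 'I_n.+1} |
     [forall i, (x i : nat) \in A] && (\sum_i (x i : nat) == n)%N]%SET.

Definition rep_count (A : set nat) (h n : nat) : nat :=
  #|representations A h n|.

(* |B `&` [1, x]|; the element 0 is not counted. *)
Definition counting_fun (R : realType) (B : set nat) (x : R) : nat :=
  #|[set k : 'I_(Num.truncn x).+1 | (0 < k)%N && ((k : nat) \in B)]%SET|.

(* Functions on the positive reals are represented by functions R -> R whose
   values outside `]0, +oo[ are irrelevant. *)
Definition positive_measurable (R : realType) (F : R -> R) : Prop :=
  (forall x, 0 < x -> 0 < F x) /\ measurable_fun (`]0, +oo[ : set R) F.

Definition regularly_varying (R : realType) (F : R -> R) : Prop :=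
  positive_measurable F /\
  forall lambda : R, 0 < lambda ->
    exists2 l : R, 0 < l & F (lambda * x) / F x @[x --> +oo] --> l.

Definition slowly_varying (R : realType) (phi : R -> R) : Prop :=
  positive_measurable phi /\
  forall lambda : R, 0 < lambda ->
    phi (lambda * x) / phi x @[x --> +oo] --> (1 : R).

(* f n <= (1 + o(1)) * g n along the filter G *)
Definition asymp_le (R : realType) (G : set_system nat) (f g : nat -> R) :
    Prop :=
  exists2 e : nat -> R, e n @[n --> G] --> (0 : R) &
    \forall n \near G, f n <= (1 + e n) * g n.

Definition regular_set (R : realType) (B : set nat) (beta : R) : Prop :=
  0 < beta /\
  forall lambda : R, 1 <= lambda ->
    (fun x : R => (counting_fun B (lambda * x))%:R : R) ~_ +oo
    (fun x : R => lambda `^ beta * (counting_fun B x)%:R).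

Definition low_additive_energy (R : realType) (B : set nat) (H : nat) : Prop :=
  forall h : nat, (H <= h)%N ->
    exists2 e : R -> R, e x @[x --> +oo] --> (0 : R) &
      (fun x : R => \sum_(0 <= n < (Num.truncn x).+1)
                      (rep_count B h n)%:R ^+ 2 : R) =O_ +oo
      (fun x : R => (counting_fun B x)%:R ^+ (2 * h)%N / x * x `^ e x).

Definition root_weight (R : realType) (h : nat) (F : R -> R) (x : R) : R :=
  (x * F x) `^ (h%:R^-1).

(* If 0 belongs to B, the tuples having a zero coordinate contribute 0, because
   counting_fun B 0 = 0 and 0^-1 = 0. *)
Definition weighted_rep (R : realType) (B : set nat) (h : nat) (f : R -> R)
    (n : nat) : R :=
  \sum_(x in representations B h n)
     \prod_i (f (x i)%:R / (counting_fun B ((x i)%:R : R))%:R).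

(* The pair (frakS h, scrS h) may depend on h, but not on F.  As C is an
   arbitrary positive constant, this condition determines frakS h on scrS h
   only up to a positive constant factor.  A relation r_A ~ frakS h * F with
   A `<=` B is not invariant under such a rescaling: it is possible only when
   frakS h * F is asymptotically at most r_B on scrS h. *)
Definition weighted_counting (R : realType) (B : set nat) (beta : R) (H : nat)
    (frakS : nat -> nat -> R) (scrS : nat -> set nat) : Prop :=
  forall h : nat, (H <= h)%N ->
    frakS h =Theta_(within (scrS h) \oo) (fun=> 1 : R) /\
    forall F : R -> R, regularly_varying F ->
      asymp_le \oo (fun n => F n%:R) (fun n => (rep_count B h n)%:R) ->
      forall (omega : R) (phi : R -> R), slowly_varying phi ->
        (forall x, 0 < x -> root_weight h F x = x `^ omega * phi x) ->
        h%:R^-1 <= omega <= beta ->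
        exists2 C : R, 0 < C &
          weighted_rep B h (root_weight h F) ~_(within (scrS h) \oo)
          (fun n => frakS h n * C * (root_weight h F n%:R ^+ h / n%:R)).

(* Main.v *)
(* Let [g b = f b / B(b)] with [f x = (x F(x))^(1/h)], so that (iii) evaluates
   the sum [W n] of the products [g x_1 ... g x_h] over the representations of
   [n] in [B].  Select each [b] in [B] independently with probability
   [min(1, M g b)]: the expected number of representations of [n] is close to
   [M^h W n], which has order [F n].  By (ii), which bounds the L2 norms of the
   powers of the generating polynomial, the sums with fewer than [h] summands
   have expectation smaller than [F] by a power of [n], so representations are
   nearly disjoint, and the number of representations is concentrated: Janson's
   lower tail and, for the upper tail, counting sequences of disjoint
   representations give failure probabilities [O(n^-2)].  König's lemma turns
   the finite selections into an infinite set.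

   The probabilities [M g b] tend to 0 unless [F] has the largest index that the
   growth of [B] allows.  In that case [g] varies slowly, and truncation at 1 is
   controlled by comparing with the number of representations in [B] itself. *)

Require Import Defs.
From HB Require Import structures.
From mathcomp Require Import all_classical all_reals all_analysis.
From mathcomp Require Import measurable_realfun ring lra.
From mathcomp Require Import all_boot all_order all_algebra.

Set Implicit Arguments.
Unset Strict Implicit.
Unset Printing Implicit Defensive.

Import Order.TTheory GRing.Theory Num.Theory.
Import numFieldNormedType.Exports.

Local Open Scope ring_scope.

(** * Inner products of nonnegative polynomials *)

(** Condition (ii) only concerns powers with at least [Hii] factors. As h >= 2 Hii + 1, a product of
    h - 1 factors splits into two halves to which it applies, and Cauchy-Schwarz bounds a
    coefficient of the product by two energies. At omega = 1/h this alone gives m ^ o(1), no better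
    than the index h omega - 1 = 0 of F. The missing saving comes from multiplying one half by b ^
    theta: the coordinates of a tuple of sum m are not all small, so a factor m ^ theta is gained,
    and theta is just so large that the energy of this half does not yet grow.

    The probability that a tuple is selected is a product over its distinct values. Where
    coordinates coincide, the sum becomes c_1 x_1 + ... + c_k x_k with fewer terms and c_1 + ... +
    c_k <= h. Since P(X^c) has the same energy as P, the estimates are made for the sum of the
    P(X^c) with c <= h, which covers these degenerate tuples as well.

    The saving is a fixed power of n, so F and B enter the error terms only through Potter bounds.
    These require uniformity in lambda, whereas the hypotheses on F and B are pointwise in
    lambda. *)

Section InnerProduct.
Variable R : realFieldType.
Implicit Types (P Q U V W : {poly R}).

Definition poly_dot P Q : R := \sum_(i < size P) P`_i * Q`_i.

Lemma poly_dotE N P Q : (size P <= N)%N ->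
  poly_dot P Q = \sum_(i < N) P`_i * Q`_i.
Proof.
move=> sPN; rewrite /poly_dot.
rewrite -(big_mkord xpredT (fun i => P`_i * Q`_i)).
rewrite -(big_mkord xpredT (fun i => P`_i * Q`_i)).
rewrite [RHS](@big_cat_nat _ _ _ (size P))//=.
rewrite [X in _ + X]big_nat_cond [X in _ + X]big1 ?addr0// => i.
by rewrite andbT => /andP[Pi _]; rewrite nth_default// mul0r.
Qed.

Lemma poly_dotC P Q : poly_dot P Q = poly_dot Q P.
Proof.
rewrite (@poly_dotE (maxn (size P) (size Q)) P) ?leq_maxl//.
rewrite (@poly_dotE (maxn (size P) (size Q)) Q) ?leq_maxr//.
by apply: eq_bigr => i _; rewrite mulrC.
Qed.

Lemma poly_dot_linear a P Q W :
  poly_dot W (a *: P + Q) = a * poly_dot W P + poly_dot W Q.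
Proof.
rewrite /poly_dot mulr_sumr -big_split/=; apply: eq_bigr => i _.
by rewrite coefD coefZ; ring.
Qed.

Lemma poly_dot0r W : poly_dot W 0 = 0.
Proof. by rewrite /poly_dot big1// => i _; rewrite coef0 mulr0. Qed.

Lemma poly_dotZr a P W : poly_dot W (a *: P) = a * poly_dot W P.
Proof. by rewrite -[a *: P]addr0 poly_dot_linear poly_dot0r addr0. Qed.

Lemma poly_dotDr P Q W : poly_dot W (P + Q) = poly_dot W P + poly_dot W Q.
Proof. by rewrite -[P]scale1r poly_dot_linear mul1r scale1r. Qed.

Lemma poly_dotZl a P W : poly_dot (a *: P) W = a * poly_dot P W.
Proof. by rewrite poly_dotC poly_dotZr poly_dotC. Qed.

Lemma poly_dot_sumr I (r : seq I) (F : I -> {poly R}) W :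
  poly_dot W (\sum_(i <- r) F i) = \sum_(i <- r) poly_dot W (F i).
Proof.
by elim/big_ind2: _ => [|? ? ? ? <- <-|//]; rewrite ?poly_dot0r ?poly_dotDr.
Qed.

Lemma poly_dot_suml I (r : seq I) (F : I -> {poly R}) W :
  poly_dot (\sum_(i <- r) F i) W = \sum_(i <- r) poly_dot (F i) W.
Proof.
by rewrite poly_dotC poly_dot_sumr; apply: eq_bigr => i _; rewrite poly_dotC.
Qed.

Lemma poly_dot_shift n P Q : poly_dot (P * 'X^n) (Q * 'X^n) = poly_dot P Q.
Proof.
rewrite (@poly_dotE (n + size P)); last first.
  by rewrite (leq_trans (size_polyMleq _ _))// size_polyXn addnS/= addnC.
rewrite big_split_ord/= big1 ?add0r => [|i _]; last first.
  by rewrite !coefMXn ltn_ord mul0r.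
rewrite /poly_dot; apply: eq_bigr => i _.
by rewrite !coefMXn ltnNge leq_addr/= addKn.
Qed.

Lemma poly_dot_ge0 P : 0 <= poly_dot P P.
Proof. by apply: sumr_ge0 => i _; rewrite -expr2 sqr_ge0. Qed.

Lemma poly_dot_eq0 P W : poly_dot P P = 0 -> poly_dot P W = 0.
Proof.
move=> /eqP; rewrite psumr_eq0 => [/allP P0|i _]; last first.
  by rewrite -expr2 sqr_ge0.
rewrite /poly_dot big1// => i _.
have /(_ (mem_index_enum i)) := P0 i.
by rewrite -expr2 sqrf_eq0 => /eqP ->; rewrite mul0r.
Qed.

Lemma poly_dot_CauchySchwarz P Q :
  poly_dot P Q ^+ 2 <= poly_dot P P * poly_dot Q Q.
Proof.
set a := poly_dot P P; set b := poly_dot P Q; set c := poly_dot Q Q.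
have [a0|a0] := eqVneq a 0; first by rewrite /b (poly_dot_eq0 _ a0) a0 expr2 !mul0r.
have a_gt0 : 0 < a by rewrite lt_def a0 poly_dot_ge0.
have := poly_dot_ge0 (a *: Q + (- b) *: P).
rewrite poly_dotDr !poly_dotZr ![poly_dot (_ + _) _]poly_dotC.
rewrite !poly_dotDr !poly_dotZr -/a -/c [poly_dot Q P]poly_dotC -/b.
have -> : a * (a * c + - b * b) + - b * (a * b + - b * a) =
  a * (a * c - b ^+ 2) by ring.
by rewrite pmulr_rge0// subr_ge0.
Qed.

Definition rev_poly n U := \sum_(i < n.+1) U`_i *: 'X^(n - i).

Lemma poly_dot_adjoint n P Q U : (size U <= n.+1)%N ->
  poly_dot (P * U) Q = poly_dot (P * 'X^n) (Q * rev_poly n U).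
Proof.
move=> sU; have {1}-> : U = \sum_(i < n.+1) U`_i *: 'X^i.
  rewrite -[LHS]coefK poly_def.
  rewrite -(big_mkord xpredT (fun i => U`_i *: 'X^i)).
  rewrite -(big_mkord xpredT (fun i => U`_i *: 'X^i)).
  rewrite [RHS](@big_cat_nat _ _ _ (size U))//=.
  rewrite [X in _ + X]big_nat_cond [X in _ + X]big1 ?addr0// => i.
  by rewrite andbT => /andP[Ui _]; rewrite nth_default// scale0r.
rewrite /rev_poly !mulr_sumr poly_dot_suml poly_dot_sumr.
apply: eq_bigr => i _; rewrite -!scalerAr poly_dotZl poly_dotZr; congr (_ * _).
have -> : P * 'X^n = (P * 'X^i) * 'X^(n - i).
  by rewrite -mulrA -exprD subnKC// -ltnS.
by rewrite poly_dot_shift.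
Qed.

(* With [~U] the reversal of [U] (complex conjugation on the unit circle),
   [UVT . UVT = U~UT . V~VT] up to a shift. *)
Lemma poly_dot_mul_convex U V W :
  poly_dot (U * V * W) (U * V * W) ^+ 2 <=
  poly_dot (U ^+ 2 * W) (U ^+ 2 * W) * poly_dot (V ^+ 2 * W) (V ^+ 2 * W).
Proof.
pose n := maxn (size U) (size V).
have sU : (size U <= n.+1)%N by rewrite ltnW// ltnS leq_maxl.
have sV : (size V <= n.+1)%N by rewrite ltnW// ltnS leq_maxr.
have adj (Z : {poly R}) : (size Z <= n.+1)%N ->
    poly_dot (Z * rev_poly n Z * W) (Z * rev_poly n Z * W) =
    poly_dot (Z ^+ 2 * W) (Z ^+ 2 * W).
  move=> sZ; set Z' := rev_poly n Z.
  have {1}-> : Z ^+ 2 * W = (Z * W) * Z by ring.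
  rewrite (poly_dot_adjoint _ _ sZ) -/Z'.
  have -> : Z ^+ 2 * W * Z' = (Z * Z' * W) * Z by ring.
  rewrite poly_dotC (poly_dot_adjoint _ _ sZ) -/Z'.
  have -> : Z * W * 'X^n * Z' = Z * Z' * W * 'X^n by ring.
  by rewrite poly_dot_shift.
rewrite -(adj U sU) -(adj V sV).
suff -> : poly_dot (U * V * W) (U * V * W) =
   poly_dot (U * rev_poly n U * W) (V * rev_poly n V * W).
  exact: poly_dot_CauchySchwarz.
set U' := rev_poly n U; set V' := rev_poly n V.
have {1}-> : U * V * W = U * W * V by ring.
rewrite (poly_dot_adjoint _ _ sV) -/V'.
have -> : U * V * W * V' = V * W * V' * U by ring.
rewrite poly_dotC (poly_dot_adjoint _ _ sU) -/U'.
have -> : U * W * 'X^n * U' = U * U' * W * 'X^n by ring.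
rewrite poly_dot_shift poly_dotC.
by have -> : V * W * V' = V * V' * W by ring.
Qed.

(** Once the sequence exceeds [M], log-convexity forbids it to decrease, so it would still exceed
    [M] at [k]. *)
Lemma log_convex_le_max (a : nat -> R) (M : R) k :
  (forall i, (i <= k)%N -> 0 <= a i) ->
  (forall i, (i.+2 <= k)%N -> a i.+1 ^+ 2 <= a i * a i.+2) ->
  a 0%N <= M -> a k <= M -> forall i, (i <= k)%N -> a i <= M.
Proof.
move=> a0 conv a0M akM i ik; rewrite leNgt; apply/negP => Mai.
have step j : (j < k)%N -> M < a j -> a j <= a j.+1.
  elim: j => [|j IH] jk Maj; first by have := lt_le_trans Maj a0M; rewrite ltxx.
  have ajj1 : a j <= a j.+1.
    by case: (leP (a j) M) => [/le_trans->//|/IH->//]; [exact: ltW|exact: ltnW].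
  have M0 : 0 <= M := le_trans (a0 0%N isT) a0M.
  have aj1 : 0 < a j.+1 := le_lt_trans M0 Maj.
  rewrite -(ler_pM2l aj1) -expr2 (le_trans (conv _ jk))//.
  by rewrite ler_wpM2r// a0.
have up d : (i + d <= k)%N -> M < a (i + d)%N.
  elim: d => [|d IH] idk; first by rewrite addn0.
  rewrite addnS in idk *; apply: lt_le_trans (step _ idk _); exact/IH/ltnW.
by have := up (k - i)%N; rewrite subnKC// => /(_ (leqnn k))/lt_le_trans/(_ akM); rewrite ltxx.
Qed.

(** Interpolation between the pure powers: by [poly_dot_mul_convex] the mixed norms form a
    log-convex sequence in [i], whose two ends are the hypotheses. *)
Lemma poly_dot_mixed_le U V M k i : (i <= k)%N ->
  poly_dot (U ^+ k) (U ^+ k) <= M -> poly_dot (V ^+ k) (V ^+ k) <= M ->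
  poly_dot (U ^+ i * V ^+ (k - i)) (U ^+ i * V ^+ (k - i)) <= M.
Proof.
move=> ik UM VM.
pose a j := poly_dot (U ^+ j * V ^+ (k - j)) (U ^+ j * V ^+ (k - j)).
apply: (@log_convex_le_max a _ k) => // [j _|j jk||]; rewrite /a.
- exact: poly_dot_ge0.
- have := poly_dot_mul_convex V U (U ^+ j * V ^+ (k - j.+2)).
  have e : (k - j = (k - j.+2).+2)%N by rewrite -subSn// -subSn ?subSS// ltnW.
  have e1 : (k - j.+1 = (k - j.+2).+1)%N by rewrite -subSn ?subSS.
  rewrite e e1 !exprS.
  set X := U ^+ j; set Y := V ^+ (k - j.+2).
  have -> : V * U * (X * Y) = U * X * (V * Y) by ring.
  have -> : V * (V * V ^+ 0) * (X * Y) = X * (V * (V * Y)) by ring.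
  by have -> : U * (U * U ^+ 0) * (X * Y) = U * (U * X) * Y by ring.
- by rewrite expr0 mul1r subn0.
- by rewrite subnn expr0 mulr1.
Qed.

Lemma poly_dot_le_max P Q M :
  poly_dot P P <= M -> poly_dot Q Q <= M -> poly_dot P Q <= M.
Proof.
move=> PM QM; have M0 := le_trans (poly_dot_ge0 P) PM.
rewrite (le_trans (ler_norm _))// -(@ler_pXn2r _ 2)// ?nnegrE//.
rewrite real_normK ?num_real// (le_trans (poly_dot_CauchySchwarz _ _))//.
by rewrite expr2 ler_pM// poly_dot_ge0.
Qed.

(** Substitute for Minkowski's inequality in L^(2k): expanding both powers gives 4^k inner products
    of mixed powers, counted with multiplicity, each at most [M]. *)
Lemma poly_dot_expD_le U V M k :
  poly_dot (U ^+ k) (U ^+ k) <= M -> poly_dot (V ^+ k) (V ^+ k) <= M ->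
  poly_dot ((U + V) ^+ k) ((U + V) ^+ k) <= 4 ^+ k * M.
Proof.
move=> UM VM; have M0 := le_trans (poly_dot_ge0 _) UM.
pose Z (i : nat) := U ^+ (k - i) * V ^+ i.
have ZM i : (i <= k)%N -> poly_dot (Z i) (Z i) <= M.
  move=> ik; have := @poly_dot_mixed_le U V M k (k - i) (leq_subr _ _) UM VM.
  by rewrite subKn.
have E : \sum_(i < k.+1) ('C(k, i))%:R = 2 ^+ k :> R.
  by rewrite (exprDn 1 1); apply: eq_bigr => i _; rewrite !expr1n mul1r.
rewrite exprDn poly_dot_suml.
have -> : 4 ^+ k * M = \sum_(i < k.+1) \sum_(j < k.+1) (('C(k, i))%:R * ('C(k, j))%:R * M) :> R.
  under eq_bigr do rewrite -mulr_suml -mulr_sumr E.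
  by rewrite -!mulr_suml E -exprMn -natrM.
apply: ler_sum => i _; rewrite poly_dot_sumr; apply: ler_sum => j _.
rewrite -[X in poly_dot X _]scaler_nat -[X in poly_dot _ X]scaler_nat poly_dotZl poly_dotZr mulrA.
rewrite ler_wpM2l ?mulr_ge0// poly_dot_le_max// ZM// -ltnS//.
Qed.
End InnerProduct.

(** * Energies, monotonicity in the coefficients, and dilations *)

Section NonnegativePolynomials.
Variable R : realFieldType.
Implicit Types (P Q U V W : {poly R}).

(** The 2k-th power of the L^(2k) norm of [P] on the unit circle. For the 0-1 polynomial of a finite
    set it is the additive energy: the number of pairs of [k]-tuples with equal sums. *)
Definition energy k P : R := poly_dot (P ^+ k) (P ^+ k).

(** The loss is exponential in the number of summands. This is harmless for the [h] dilations, and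
    for a decomposition into scales if their ratio is large. *)
Lemma energy_sum_le k (U : nat -> {poly R}) M n : (0 < k)%N -> 0 <= M ->
  (forall i, (i < n)%N -> energy k (U i) <= M) ->
  energy k (\sum_(i < n) U i) <= 4 ^+ (k * n) * M.
Proof.
move=> k0 M0; elim: n => [|n IH] UM.
  by rewrite big_ord0 /energy expr0n gtn_eqF//= poly_dot0r mulr_ge0// exprn_ge0.
rewrite big_ord_recr/= mulnS exprD -mulrA; apply: poly_dot_expD_le.
  by apply: IH => i /ltnW; apply: UM.
rewrite (le_trans (UM n _))// ler_peMl// exprn_ege1// ler1n//.
Qed.

Definition nonneg_poly P := forall i, 0 <= P`_i.

Lemma nonneg_polyM P Q : nonneg_poly P -> nonneg_poly Q -> nonneg_poly (P * Q).
Proof. by move=> P0 Q0 i; rewrite coefM sumr_ge0// => j _; rewrite mulr_ge0. Qed.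

Lemma nonneg_polyXn P k : nonneg_poly P -> nonneg_poly (P ^+ k).
Proof.
move=> P0; elim: k => [|k IH]; last by rewrite exprS; exact: nonneg_polyM.
by move=> i; rewrite expr0 coef1 ler0n.
Qed.

Lemma nonneg_poly_sum I (r : seq I) (p : pred I) (F : I -> {poly R}) :
  (forall i, p i -> nonneg_poly (F i)) -> nonneg_poly (\sum_(i <- r | p i) F i).
Proof. by move=> F0 i; rewrite coef_sum sumr_ge0// => j /F0. Qed.

Lemma coefM_le m P Q U V : nonneg_poly P -> nonneg_poly U ->
  (forall i, (i <= m)%N -> P`_i <= Q`_i) -> (forall i, (i <= m)%N -> U`_i <= V`_i) ->
  forall i, (i <= m)%N -> (P * U)`_i <= (Q * V)`_i.
Proof.
move=> P0 U0 PQ UV i im; rewrite !coefM; apply: ler_sum => j _.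
rewrite ler_pM ?PQ ?UV//; first by rewrite (leq_trans _ im)// -ltnS.
exact: leq_trans (leq_subr _ _) im.
Qed.

Lemma coefXn_le m k P Q : nonneg_poly P ->
  (forall i, (i <= m)%N -> P`_i <= Q`_i) ->
  forall i, (i <= m)%N -> (P ^+ k)`_i <= (Q ^+ k)`_i.
Proof.
move=> P0 PQ; elim: k => [|k IH] i im; first by rewrite !expr0.
by rewrite !exprS; apply: (coefM_le (m := m)) => //; exact: nonneg_polyXn.
Qed.

Lemma poly_dot_mono P Q : nonneg_poly P -> (forall i, P`_i <= Q`_i) ->
  poly_dot P P <= poly_dot Q Q.
Proof.
move=> P0 PQ; rewrite (@poly_dotE _ (maxn (size P) (size Q)) P) ?leq_maxl//.
rewrite (@poly_dotE _ (maxn (size P) (size Q)) Q) ?leq_maxr//.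
by apply: ler_sum => i _; rewrite ler_pM.
Qed.

Lemma energy_mono k P Q : nonneg_poly P -> (forall i, P`_i <= Q`_i) ->
  energy k P <= energy k Q.
Proof.
move=> P0 PQ; apply: poly_dot_mono; first exact: nonneg_polyXn.
by move=> i; apply: (@coefXn_le i) => // j _.
Qed.

Lemma energy_ge0 k P : 0 <= energy k P. Proof. exact: poly_dot_ge0. Qed.

Lemma energyZ k a P : energy k (a *: P) = (a ^+ k) ^+ 2 * energy k P.
Proof. by rewrite /energy exprZn poly_dotZl poly_dotZr expr2 mulrA. Qed.

(** Substituting ['X^c] only spreads the coefficients out, so a dilated weight has the energy of the
    original one. *)
Lemma poly_dot_comp_Xn c P : (0 < c)%N ->
  poly_dot (P \Po 'X^c) (P \Po 'X^c) = poly_dot P P.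
Proof.
move=> c0; rewrite comp_polyE.
under [in LHS]eq_bigr do rewrite -exprM.
rewrite poly_dot_sumr; apply: eq_bigr => i _.
rewrite poly_dotZr poly_dot_suml (bigD1 i)//= big1 ?addr0.
  rewrite poly_dotZl; congr (_ * _); rewrite -[RHS]mulr1; congr (_ * _).
  rewrite /poly_dot size_polyXn (bigD1 ord_max)//= big1 ?addr0.
    by rewrite coefXn eqxx mulr1.
  by move=> j jn; rewrite coefXn -val_eqE/= in jn *; rewrite (negbTE jn) mul0r.
move=> j ji; rewrite poly_dotZl /poly_dot size_polyXn big1 ?mulr0// => l _.
rewrite !coefXn; have [lj|] := eqVneq (l : nat) _; last by rewrite mul0r.
rewrite lj eqn_pmul2l// ; case: eqP => [e|]; last by rewrite mulr0.
by rewrite -val_eqE/= e eqxx in ji.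
Qed.

Lemma energy_comp_Xn k c P : (0 < c)%N -> energy k (P \Po 'X^c) = energy k P.
Proof. by move=> c0; rewrite /energy -!rmorphXn poly_dot_comp_Xn. Qed.

Lemma coefM_sqr_le m P Q :
  (P * Q)`_m ^+ 2 <= poly_dot P P * poly_dot Q Q.
Proof.
pose P' := \poly_(i < m.+1) P`_i; pose Q' := \poly_(i < m.+1) Q`_(m - i).
have -> : (P * Q)`_m = poly_dot P' Q'.
  rewrite coefM (@poly_dotE _ m.+1) ?size_poly//; apply: eq_bigr => i _.
  by rewrite !coef_poly ltn_ord.
rewrite (le_trans (poly_dot_CauchySchwarz _ _))// ler_pM ?poly_dot_ge0//.
  rewrite (@poly_dotE _ (maxn m.+1 (size P)) P) ?leq_maxr//.
  rewrite (@poly_dotE _ (maxn m.+1 (size P)) P') ?(leq_trans (size_poly _ _))// ?leq_maxl//.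
  apply: ler_sum => i _; rewrite !coef_poly; case: ifP => // _.
  by rewrite mul0r -expr2 sqr_ge0.
rewrite (@poly_dotE _ (maxn m.+1 (size Q)) Q) ?leq_maxr//.
rewrite (@poly_dotE _ m.+1 Q') ?size_poly//.
under eq_bigr do rewrite coef_poly ltn_ord.
rewrite (reindex_inj rev_ord_inj)/=.
under eq_bigr do rewrite subSS subKn ?leq_ord//.
rewrite -(big_mkord xpredT (fun i => Q`_i * Q`_i)).
rewrite -(big_mkord xpredT (fun i => Q`_i * Q`_i)).
rewrite [leRHS](@big_cat_nat _ _ _ m.+1) ?leq_maxl//= lerDl sumr_ge0// => i _.
by rewrite -expr2 sqr_ge0.
Qed.

Definition weight_poly (w : nat -> R) P := \poly_(i < size P) (w i * P`_i).

Lemma coef_weight_poly w P i : (weight_poly w P)`_i = w i * P`_i.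
Proof.
by rewrite coef_poly; case: ltnP => // Pi; rewrite nth_default// mulr0.
Qed.

(* For [w m = m ^ theta] this plays the role of the Leibniz rule. *)
Lemma weight_coefXn (w : nat -> R) K k : (forall i, 0 <= w i) -> 0 <= K ->
  (forall i j, w (i + j)%N <= K * (w i + w j)) ->
  exists2 C, 0 <= C & forall P m, nonneg_poly P ->
    w m * (P ^+ k.+1)`_m <= C * (weight_poly w P * P ^+ k)`_m.
Proof.
move=> w0 K0 wK; elim: k => [|k [C C0 IH]].
  by exists 1 => // P m P0; rewrite expr1 expr0 mulr1 coef_weight_poly mul1r.
exists (K * (1 + C)); first by rewrite mulr_ge0// addr_ge0.
move=> P m P0; rewrite exprS coefM mulr_sumr.
have nn j : 0 <= (P ^+ k.+1)`_j by exact: nonneg_polyXn.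
apply: (@le_trans _ _ (\sum_(j < m.+1)
  (K * (w j * P`_j * (P ^+ k.+1)`_(m - j)) + K * (P`_j * (C * (weight_poly w P * P ^+ k)`_(m - j)))))).
  apply: ler_sum => j _.
  have := wK j (m - j)%N; rewrite subnKC -1?ltnS ?ltn_ord// => wm.
  apply: (@le_trans _ _ (K * (w j + w (m - j)%N) * (P`_j * (P ^+ k.+1)`_(m - j)))).
    by rewrite ler_wpM2r// mulr_ge0.
  have -> : K * (w j + w (m - j)%N) * (P`_j * (P ^+ k.+1)`_(m - j)) =
    K * (w j * P`_j * (P ^+ k.+1)`_(m - j)) +
    K * (P`_j * (w (m - j)%N * (P ^+ k.+1)`_(m - j))) by ring.
  by rewrite lerD2l !ler_wpM2l// IH.
rewrite big_split/= -!mulr_sumr mulrDr mulrDl mulr1 lerD//.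
  by rewrite coefM; apply: ler_wpM2l => //; apply: ler_sum => j _; rewrite coef_weight_poly.
rewrite -mulrA ler_wpM2l//.
have -> : weight_poly w P * P ^+ k.+1 = P * (weight_poly w P * P ^+ k).
  by rewrite exprS; ring.
rewrite [in leRHS]coefM mulr_sumr; apply: ler_sum => j _.
by rewrite mulrCA.
Qed.

End NonnegativePolynomials.

(** * Tuples of selected elements *)

Lemma ler_sum_inj (R : numDomainType) (I J : finType) (D : pred I) (E : pred J)
    (phi : I -> J) (a : I -> R) (b : J -> R) :
  {in D &, injective phi} -> (forall i, D i -> E (phi i)) ->
  (forall i, D i -> a i <= b (phi i)) -> (forall j, E j -> 0 <= b j) ->
  \sum_(i | D i) a i <= \sum_(j | E j) b j.
Proof.
move=> phi_inj DE ab b0; apply: (le_trans (ler_sum _ ab)).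
rewrite -(big_imset b)/=; last by move=> i j /= Di Dj; apply: phi_inj.
rewrite [leRHS](bigID (mem (phi @: D)))/=.
have -> : \sum_(i in phi @: D) b i = \sum_(i | E i && (i \in phi @: D)) b i.
  apply: eq_bigl => j; case: imsetP => [[i Di ->]|]; rewrite ?andbF// andbT.
  by rewrite DE.
by rewrite lerDl sumr_ge0// => j /andP[/b0].
Qed.

Section Tuples.
Variables (R : realFieldType) (N : nat).
Local Notation T := 'I_N.+1.
Implicit Types (p : nat -> R) (S A : {set T}).

(** A tuple is selected when this set is, so that repeated coordinates count only once in its
    probability. *)
Definition values k (y : {ffun 'I_k -> T}) : {set T} := y @: setT.

Definition set_weight p S : R := \prod_(b in S) p b.

(* When [p b] is the probability that [b] is selected, independently for all
   [b], this is the expected number of selected tuples of sum [m]. *)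
Definition tuple_sum p k (m : nat) : R :=
  \sum_(y : {ffun 'I_k -> T} | (\sum_i (y i : nat) == m)%N) set_weight p (values y).

Definition ffun_rest k (j : 'I_k.+1) (y : {ffun 'I_k.+1 -> T}) :
  {ffun 'I_k -> T} := [ffun l => y (lift j l)].

Lemma ffun_rest_inj k (j : 'I_k.+1) (y z : {ffun 'I_k.+1 -> T}) :
  y j = z j -> ffun_rest j y = ffun_rest j z -> y = z.
Proof.
move=> yz /ffunP rest; apply/ffunP => i.
by case: (unliftP j i) => [l|] -> //; have := rest l; rewrite !ffunE.
Qed.

Lemma sum_ffun_rest k (j : 'I_k.+1) (y : {ffun 'I_k.+1 -> T}) (c : 'I_k.+1 -> nat) :
  (\sum_i c i * y i = c j * y j + \sum_l c (lift j l) * ffun_rest j y l)%N.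
Proof.
by rewrite (bigD1_ord j)//=; congr addn; apply: eq_bigr => l _; rewrite ffunE.
Qed.

Lemma values_rest k (j : 'I_k.+1) (y : {ffun 'I_k.+1 -> T}) :
  values y = y j |: values (ffun_rest j y).
Proof.
apply/setP => b; rewrite !inE; apply/imsetP/orP => [[i _ ->]|].
  case: (unliftP j i) => [l|] ->; last by left.
  by right; apply/imsetP; exists l; rewrite ?ffunE.
by case=> [/eqP->|/imsetP[l _ ->]]; [exists j|exists (lift j l); rewrite ?ffunE].
Qed.

Lemma set_weight_ge0 p S : (forall b, 0 <= p b) -> 0 <= set_weight p S.
Proof. by move=> p0; exact: prodr_ge0. Qed.

Lemma set_weight_le p S A : (forall b, 0 <= p b <= 1) -> S \subset A ->
  set_weight p A <= set_weight p S.
Proof.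
move=> p01 SA; rewrite /set_weight (big_setID S)/= (setIidPr SA).
rewrite ler_piMr ?prodr_ge0// => [b _|]; first by case/andP: (p01 b).
by apply: prodr_ile1 => b _.
Qed.

Lemma tuple_sum_meet_at p k (j : 'I_k.+1) m S : (forall b, 0 <= p b <= 1) ->
  \sum_(y : {ffun 'I_k.+1 -> T} | (\sum_i (y i : nat) == m)%N && (y j \in S))
    set_weight p (values y) <=
  \sum_(b in S) if (b <= m)%N then tuple_sum p k (m - b)%N else 0.
Proof.
move=> p01; have p0 b : 0 <= p b by case/andP: (p01 b).
rewrite -big_mkcondr/= /tuple_sum (exchange_big_dep predT)//=.
rewrite pair_big_dep/=.
pose phi (y : {ffun 'I_k.+1 -> T}) := (ffun_rest j y, y j).
apply: (@ler_sum_inj _ _ _ _ _ phi _ (fun z => set_weight p (values z.1))) => /=.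
- by move=> y z _ _ [? ?]; exact: (@ffun_rest_inj _ j).
- move=> y /andP[/eqP ym yS]; have := sum_ffun_rest j y (fun=> 1%N).
  rewrite /= mul1n; under eq_bigr do rewrite mul1n.
  under [X in (_ + X)%N]eq_bigr do rewrite mul1n.
  by rewrite ym => ->; rewrite yS leq_addr addKn/= eqxx.
- by move=> y _; rewrite (values_rest j) set_weight_le// subsetUr.
- by move=> z _; exact: set_weight_ge0.
Qed.

(** Deleting a coordinate that lies in [S] leaves a shorter tuple with smaller sum. With 0-1
    probabilities this bounds the number of selected tuples that meet a given one; with forced
    probabilities it bounds the correlations in the lower tail. *)
Lemma tuple_sum_meet p k m S D : (forall b, 0 <= p b <= 1) ->
  (forall m', (m' <= m)%N -> tuple_sum p k m' <= D) -> 0 <= D ->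
  \sum_(y : {ffun 'I_k.+1 -> T} | (\sum_i (y i : nat) == m)%N && ~~ [disjoint values y & S])
    set_weight p (values y) <= k.+1%:R * #|S|%:R * D.
Proof.
move=> p01 GD D0; have p0 b : 0 <= p b by case/andP: (p01 b).
apply: (@le_trans _ _ (\sum_(y : {ffun 'I_k.+1 -> T} | (\sum_i (y i : nat) == m)%N)
   \sum_(j < k.+1) if y j \in S then set_weight p (values y) else 0)).
  rewrite big_mkcondr/=; apply: ler_sum => y _; case: ifPn => [|_]; last first.
    by rewrite sumr_ge0// => j _; case: ifP => // _; exact: set_weight_ge0.
  rewrite -setI_eq0 => /set0Pn[b /setIP[/imsetP[j _ ->] yjS]].
  rewrite (bigD1 j)//= yjS lerDl sumr_ge0// => i _.
  by case: ifP => // _; exact: set_weight_ge0.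
rewrite exchange_big/=.
rewrite -mulrA -[k.+1 in leRHS]card_ord -sumr_const -sum1_card natr_sum.
rewrite mulr_suml; apply: ler_sum => j _; rewrite mul1r mulr_suml.
under [leRHS]eq_bigr do rewrite mul1r.
rewrite -big_mkcondr/=; apply: (le_trans (tuple_sum_meet_at _ _ _ p01)).
by apply: ler_sum => b _; case: ifP => // _; apply: GD; exact: leq_subr.
Qed.

Lemma set_weight1 A S :
  set_weight (fun b => (inord b \in A)%:R) S = (S \subset A)%:R.
Proof.
rewrite /set_weight; case: (boolP (S \subset A)) => [/subsetP SA|/subsetPn[b bS bA]].
  by rewrite big1// => b /SA; rewrite inord_val => ->.
by rewrite (bigD1 b)//= inord_val (negbTE bA) mul0r.
Qed.

Fixpoint forced_bound (s k : nat) : nat :=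
  if k is k'.+1 then (1 + k * s * forced_bound s k')%N else 1%N.

Definition force S p b : R := if inord b \in S then 1 else p b.

Lemma tuple_sum0_le p m : tuple_sum p 0 m <= 1.
Proof.
rewrite /tuple_sum big_mkcond/= (eq_bigr (fun=> if (0 == m)%N then 1 else 0)) => [|y _].
  rewrite sumr_const card_ffun !card_ord expn0 mulr1n.
  by case: ifP => // _; rewrite ler01.
rewrite big_ord0 /set_weight; case: ifP => // _; rewrite big1// => b.
by move=> /imsetP[[]].
Qed.

(** [force S p] gives the probabilities conditional on the selection of [S]. Tuples avoiding [S]
    keep their weight, which yields the term 1 of [forced_bound]. Any other tuple loses a coordinate
    in [S], chosen in at most [k * s] ways, and the rest is again a forced sum. *)
Lemma tuple_sum_force p S n D s K k m : (forall b, 0 <= p b <= 1) -> 1 <= D ->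
  (#|S| <= s)%N ->
  (forall k' m', (0 < k' <= K)%N -> (m' <= n)%N -> tuple_sum p k' m' <= D) ->
  (k <= K)%N -> (m <= n)%N ->
  tuple_sum (force S p) k m <= (forced_bound s k)%:R * D.
Proof.
move=> p01 D1 Ss GD; have D0 : 0 <= D := le_trans ler01 D1.
have fp01 b : 0 <= force S p b <= 1.
  by rewrite /force; case: ifP; rewrite ?ler01 ?lexx// p01.
elim: k m => [|k IH] m kK mn; first by rewrite mul1r (le_trans (tuple_sum0_le _ _)).
rewrite /tuple_sum (bigID (fun y => [disjoint values y & S]))/=.
rewrite natrD mulrDl mul1r lerD//.
  apply: (le_trans _ (GD k.+1 m _ mn)); last by rewrite kK.
  rewrite [leRHS](bigID (fun y => [disjoint values y & S]))/=.
  rewrite -[leLHS]addr0 lerD//; last first.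
    by apply: sumr_ge0 => y _; apply: set_weight_ge0 => b; case/andP: (p01 b).
  apply: ler_sum => y /andP[_ /disjointFr yS].
  rewrite /set_weight (eq_bigr (fun b : T => p b))// => b by_.
  by rewrite /force inord_val yS.
apply: (le_trans (tuple_sum_meet (D := (forced_bound s k)%:R * D) S fp01 _ _)).
- by move=> m' m'm; apply: IH; [exact: ltnW|exact: leq_trans mn].
- by rewrite mulr_ge0.
- by rewrite mulrA ler_wpM2r// -!natrM ler_nat leq_mul// leq_mul.
Qed.

Definition wtuple_sum p k (c : 'I_k -> nat) (m : nat) : R :=
  \sum_(y : {ffun 'I_k -> T} | (\sum_i c i * y i == m)%N) set_weight p (values y).

Definition dilated_poly p c : {poly R} := \sum_(b : T) p b *: 'X^(c * b).
(** A common majorant of all dilations with coefficients from 1 to [h]: its powers bound every sum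
    that arises from merging equal coordinates. *)
Definition dilations_poly p h : {poly R} := \sum_(c < h) dilated_poly p c.+1.

Lemma coef_prod_dilated p k (c : 'I_k -> nat) m :
  (\prod_i dilated_poly p (c i))`_m =
  \sum_(y : {ffun 'I_k -> T} | (\sum_i c i * y i == m)%N) \prod_i p (y i).
Proof.
rewrite bigA_distr_bigA/= coef_sum [RHS]big_mkcond; apply: eq_bigr => y _.
have -> : \prod_i (p (y i) *: 'X^(c i * y i)) =
    (\prod_i p (y i)) *: 'X^(\sum_i c i * y i)%N :> {poly R}.
  elim/big_ind3: _ => [|? ? ? ? ? ? -> ->|//]; first by rewrite expr0 scale1r.
  by rewrite -scalerAl -scalerAr scalerA exprD.
by rewrite coefZ coefXn eq_sym; case: eqP => _; rewrite ?mulr1 ?mulr0.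
Qed.

Lemma nonneg_dilated p c : (forall b, 0 <= p b) -> nonneg_poly (dilated_poly p c).
Proof.
by move=> p0; apply: nonneg_poly_sum => b _ i; rewrite coefZ coefXn mulr_ge0.
Qed.

Lemma nonneg_dilations p h : (forall b, 0 <= p b) -> nonneg_poly (dilations_poly p h).
Proof. by move=> p0; apply: nonneg_poly_sum => c _; exact: nonneg_dilated. Qed.

Lemma dilated_le p h c i : (forall b, 0 <= p b) -> (0 < c <= h)%N ->
  (dilated_poly p c)`_i <= (dilations_poly p h)`_i.
Proof.
case: c => // c p0 /= ch; rewrite [in leRHS]/dilations_poly [leRHS]coef_sum (bigD1 (Ordinal ch))//=.
by rewrite lerDl sumr_ge0// => d _; exact: nonneg_dilated.
Qed.

Lemma prod_dilated_le p h k (c : 'I_k -> nat) m : (forall b, 0 <= p b) ->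
  (forall i, 0 < c i <= h)%N ->
  (\prod_i dilated_poly p (c i))`_m <= (dilations_poly p h ^+ k)`_m.
Proof.
move=> p0; elim: k m c => [|k IH] m c ch; first by rewrite big_ord0 expr0.
rewrite big_ord_recl exprS; apply: (coefM_le (m := m)) => //.
- exact: nonneg_dilated.
- elim: (index_enum _) => [i|? ? ?]; first by rewrite big_nil coef1 ler0n.
  by rewrite big_cons; apply: nonneg_polyM => //; exact: nonneg_dilated.
- by move=> i _; exact: dilated_le.
- by move=> i _; exact: (IH _ (fun l => c (lift ord0 l))).
Qed.

Lemma set_weight_values_ge p k (y : {ffun 'I_k -> T}) : (forall b, 0 <= p b <= 1) ->
  \prod_i p (y i) <= set_weight p (values y).
Proof.
move=> p01; have p0 b : 0 <= p b by case/andP: (p01 b).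
elim: k y => [y|k IH y].
  by rewrite big_ord0 /set_weight big1// => b /imsetP[[]].
rewrite (values_rest ord0) (bigD1_ord ord0)//=.
have := IH (ffun_rest ord0 y).
under eq_bigr do rewrite ffunE; move=> {}IH.
have [yin|ynin] := boolP (y ord0 \in values (ffun_rest ord0 y)).
  rewrite (setUidPr _) ?sub1set//; apply: le_trans IH.
  by rewrite ler_piMl ?prodr_ge0//; case/andP: (p01 (y ord0)).
by rewrite /set_weight big_setU1//= ler_wpM2l.
Qed.

Lemma set_weight_values_inj p k (y : {ffun 'I_k -> T}) : injective y ->
  set_weight p (values y) = \prod_i p (y i).
Proof.
move=> yinj; rewrite /set_weight /values big_imset/=; last by move=> i j _ _ /yinj.
by apply: eq_bigl => i; rewrite inE.
Qed.

Lemma wtuple_sum_ge p k (c : 'I_k -> nat) m : (forall b, 0 <= p b <= 1) ->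
  (\prod_i dilated_poly p (c i))`_m <= wtuple_sum p c m.
Proof.
move=> p01; rewrite coef_prod_dilated; apply: ler_sum => y _.
exact: set_weight_values_ge.
Qed.

Definition merge_coef k (c : 'I_k.+1 -> nat) (i j : 'I_k.+1) (l : 'I_k) : nat :=
  c (lift j l) + (lift j l == i) * c j.

Lemma wtuple_sum_merge p k (c : 'I_k.+1 -> nat) (i j : 'I_k.+1) m :
  (forall b, 0 <= p b) -> i != j ->
  \sum_(y : {ffun 'I_k.+1 -> T} | (\sum_i c i * y i == m)%N && (y i == y j))
    set_weight p (values y) <= wtuple_sum p (merge_coef c i j) m.
Proof.
move=> p0 ij; have [l0 il0|e] := unliftP j i; last by rewrite e eqxx in ij.
apply: (@ler_sum_inj _ _ _ _ _ (ffun_rest j)).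
- move=> y z /andP[_ /eqP yij] /andP[_ /eqP zij] rest.
  apply: (@ffun_rest_inj _ j) => //.
  have := congr1 (fun f : {ffun 'I_k -> T} => f l0) rest.
  by rewrite !ffunE -il0 yij zij.
- move=> y /andP[/eqP <- /eqP yij]; apply/eqP.
  rewrite (sum_ffun_rest j) /merge_coef.
  under eq_bigr do rewrite mulnDl.
  rewrite big_split/= addnC; congr addn.
  rewrite (bigD1 l0)//= -il0 eqxx mul1n ffunE -il0 yij big1 ?addn0// => l ll0.
  rewrite il0 (inj_eq (@lift_inj _ j)) (negbTE ll0)//.
- move=> y /andP[_ /eqP yij]; rewrite (values_rest j) (setUidPr _)// sub1set.
  by apply/imsetP; exists l0; rewrite ?ffunE// -il0 yij.
- by move=> z _; exact: set_weight_ge0.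
Qed.

Fixpoint merge_bound k : nat :=
  if k is k'.+1 then ((k * k) * (merge_bound k').+1)%N else 0%N.

(** For injective tuples the weight is the product over the coordinates. In any other tuple two
    equal coordinates are merged and their coefficients added, which leaves a sum with one term less
    to the induction hypothesis. Merging preserves the total of the coefficients, so no coefficient
    ever exceeds [h]. *)
Lemma wtuple_sum_le p h k : (forall b, 0 <= p b <= 1) ->
  forall (c : 'I_k -> nat) m, (forall i, 0 < c i)%N -> (\sum_i c i <= h)%N ->
  wtuple_sum p c m <= (\prod_i dilated_poly p (c i))`_m +
    (merge_bound k)%:R * \sum_(l < k) (dilations_poly p h ^+ l)`_m.
Proof.
move=> p01; have p0 b : 0 <= p b by case/andP: (p01 b).
elim: k => [|k IH] c m c0 ch.
  rewrite mul0r addr0 coef_prod_dilated.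
  apply: ler_sum => y _; rewrite big_ord0 /set_weight big1// => b.
  by move=> /imsetP[[]].
pose C := merge_bound k.
rewrite coef_prod_dilated /wtuple_sum [merge_bound _]/= -/C.
rewrite (bigID (fun y : {ffun 'I_k.+1 -> T} => injectiveb y))/= lerD//.
  rewrite [leRHS](bigID (fun y : {ffun 'I_k.+1 -> T} => injectiveb y))/=.
  rewrite -[leLHS]addr0 lerD ?sumr_ge0// => [|y _]; last exact: prodr_ge0.
  by apply: ler_sum => y /andP[_ /injectiveP yinj]; rewrite set_weight_values_inj.
set V := dilations_poly p h.
apply: (@le_trans _ _ (\sum_(i < k.+1) \sum_(j < k.+1) if i != j then
    \sum_(y : {ffun 'I_k.+1 -> T} | (\sum_i c i * y i == m)%N && (y i == y j))
    set_weight p (values y) else 0)).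
  apply: (@le_trans _ _ (\sum_(y : {ffun 'I_k.+1 -> T} | (\sum_i c i * y i == m)%N)
     \sum_(i < k.+1) \sum_(j < k.+1) if (i != j) && (y i == y j) then set_weight p (values y) else 0)).
    rewrite big_mkcondr/=; apply: ler_sum => y _.
    have w0 : 0 <= set_weight p (values y) by exact: set_weight_ge0.
    have nn (i j : 'I_k.+1) : 0 <= (if (i != j) && (y i == y j) then set_weight p (values y) else 0).
      by case: ifP.
    case: ifPn => [/injectivePn[i [j ij yij]]|_]; last first.
      by rewrite sumr_ge0// => i _; rewrite sumr_ge0.
    rewrite (bigD1 i)//= (bigD1 j)//= ij yij eqxx/= -addrA lerDl.
    by apply: addr_ge0; apply: sumr_ge0 => l _; [by case: ifP|exact: sumr_ge0].
  rewrite exchange_big/=; apply: ler_sum => i _.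
  rewrite exchange_big/=; apply: ler_sum => j _.
  case: ifPn => ij; last by rewrite big1.
  by rewrite [leRHS]big_mkcondr; apply: ler_sum => y _; case: ifP.
have V0 l : 0 <= (V ^+ l)`_m by apply: nonneg_polyXn; exact: nonneg_dilations.
pose s := \sum_(l < k.+1) (V ^+ l)`_m.
apply: (@le_trans _ _ (\sum_(i < k.+1) \sum_(j < k.+1) C.+1%:R * s)); last first.
  by rewrite !sumr_const card_ord -mulrnA -[leLHS]mulr_natl mulrA -natrM.
apply: ler_sum => i _; apply: ler_sum => j _; case: ifPn => [ij|_]; last first.
  by rewrite mulr_ge0// sumr_ge0.
apply: (le_trans (wtuple_sum_merge _ _ p0 ij)).
have mc0 l : (0 < merge_coef c i j l)%N by rewrite addn_gt0 c0.
have msum : (\sum_l merge_coef c i j l <= h)%N.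
  apply: leq_trans ch; rewrite big_split/= [leqRHS](bigD1_ord j)//= addnC leq_add2r.
  rewrite -big_distrl/= -[leqRHS]mul1n leq_mul2r; apply/orP; right.
  have [l0 il0|e] := unliftP j i; last by rewrite e eqxx in ij.
  rewrite (bigD1 l0)//= -il0 eqxx big1// => l ll0.
  by rewrite il0 (inj_eq (@lift_inj _ j)) (negbTE ll0).
apply: (le_trans (IH _ m mc0 msum)).
have mle l : (0 < merge_coef c i j l <= h)%N.
  rewrite mc0/=; apply: leq_trans msum.
  by rewrite (bigD1 l)//= leq_addr.
rewrite /s big_ord_recr/= -natr1 mulrDl mul1r [leLHS]addrC lerD//.
  by rewrite ler_wpM2l// lerDl.
by rewrite (le_trans (prod_dilated_le _ p0 mle))// lerDr sumr_ge0.
Qed.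

Lemma tuple_sumE p k m : tuple_sum p k m = wtuple_sum p (fun _ : 'I_k => 1%N) m.
Proof. by apply: eq_bigl => y; under [in RHS]eq_bigr do rewrite mul1n. Qed.

Lemma dilated_poly1E p k m :
  (\prod_(i < k) dilated_poly p 1)`_m =
  \sum_(y : {ffun 'I_k -> T} | (\sum_i (y i : nat) == m)%N) \prod_i p (y i).
Proof.
rewrite coef_prod_dilated; apply: eq_bigl => y.
by under eq_bigr do rewrite mul1n.
Qed.
End Tuples.

(** * Tails of the number of selected events *)

Section RandomSubset.
Variables (R : realType) (T : finType) (p : T -> R).
Hypothesis p01 : forall b, 0 <= p b <= 1.
Implicit Types (f g : {set T} -> R) (S A U : {set T}) (l : seq T).

(* The expectation of [f A], where [A] selects each [x] of [l] independently
   with probability [p x]. *)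
Fixpoint expect_on l f : R :=
  if l is x :: l' then p x * expect_on l' (fun A => f (x |: A)) + (1 - p x) * expect_on l' f
  else f set0.

Let p0 b : 0 <= p b. Proof. by case/andP: (p01 b). Qed.
Let q0 b : 0 <= 1 - p b. Proof. by rewrite subr_ge0; case/andP: (p01 b). Qed.

Lemma eq_expect_on l f g : (forall A, A \subset l -> f A = g A) ->
  expect_on l f = expect_on l g.
Proof.
elim: l f g => [|x l IH] f g fg /=; first by apply: fg; apply/subsetP => b; rewrite inE.
congr (_ * _ + _ * _); apply: IH => A Al; apply: fg.
  by apply/subsetP => b; rewrite !inE => /orP[->//|/(subsetP Al) ->]; rewrite orbT.
by apply/subsetP => b /(subsetP Al); rewrite inE => ->; rewrite orbT.
Qed.

Lemma expect_on_linear l a f g :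
  expect_on l (fun A => a * f A + g A) = a * expect_on l f + expect_on l g.
Proof. by elim: l f g => [//|x l IH] f g /=; rewrite !IH; ring. Qed.

Lemma expect_on_cst l c : expect_on l (fun=> c) = c.
Proof. by elim: l => [//|x l IH] /=; rewrite IH; ring. Qed.

Lemma expect_on_mono l f g : (forall A, f A <= g A) ->
  expect_on l f <= expect_on l g.
Proof.
elim: l f g => [|x l IH] f g fg /=; first exact: fg.
by rewrite lerD// ler_wpM2l// IH.
Qed.

(** The first-moment method. An element of probability 0 contributes only its unselected branch, so
    it can be left out; this later puts the selection inside [B]. *)
Lemma expect_on_exists l f c : expect_on l f < c ->
  exists2 A : {set T}, forall x, x \in A -> p x != 0 & f A < c.
Proof.
elim: l f c => [|x l IH] f c /= fc; first by exists set0 => // x; rewrite inE.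
have [px0|px0] := eqVneq (p x) 0.
  by apply: IH; move: fc; rewrite px0 mul0r add0r subr0 mul1r.
have [/IH[A pA fA]|] := ltP (expect_on l (fun A => f (x |: A))) c.
  by exists (x |: A) => // b; rewrite !inE => /predU1P[->//|/pA].
have [/IH[A pA fA _]|fc1 fc2] := ltP (expect_on l f) c; first by exists A.
have := lerD (ler_wpM2l (p0 x) fc2) (ler_wpM2l (q0 x) fc1).
rewrite -mulrDl addrC subrK mul1r => /le_lt_trans/(_ fc).
by rewrite ltxx.
Qed.

Lemma expect_on_mem l x f : uniq l -> x \in l ->
  expect_on l (fun A => (x \in A)%:R * f A) = p x * expect_on l (fun A => f (x |: A)).
Proof.
elim: l f => [//|y l IH] f /= /andP[yl ul]; rewrite inE => /predU1P[->|xl].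
  rewrite [X in _ + (1 - p y) * X](_ : _ = 0) ?mulr0 ?addr0; last first.
    rewrite -[RHS](expect_on_cst l); apply: eq_expect_on => A Al.
    have [/(subsetP Al)|] := boolP (y \in A); last by rewrite mul0r.
    by rewrite (negbTE yl).
  under eq_expect_on do rewrite setU11 mul1r.
  have -> : expect_on l (fun A => f (y |: (y |: A))) = expect_on l (fun A => f (y |: A)).
    by apply: eq_expect_on => A _; rewrite setUA setUid.
  by rewrite -mulrDl addrC subrK mul1r.
rewrite IH// (_ : expect_on l (fun A => (x \in y |: A)%:R * f (y |: A)) =
    p x * expect_on l (fun A => f (y |: (x |: A)))); last first.
  rewrite -(IH (fun A => f (y |: A)))//; apply: eq_expect_on => A _.
  by rewrite !inE; case: eqP => [xy|//]; rewrite -xy xl in yl.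
rewrite [RHS]mulrDr [p x * (p y * _)]mulrCA [p x * ((1 - p y) * _)]mulrCA.
congr (_ * (_ * _) + _ * (_ * _)).
by apply: eq_expect_on => A _; rewrite setUCA.
Qed.

Definition expect f := expect_on (enum T) f.

Definition prob_sub S := \prod_(b in S) p b.

(** Conditioning on the selection of [S] leaves the other choices independent. For a decreasing [f]
    this bounds the left side by [prob_sub S * expect f], which makes a separate correlation
    inequality unnecessary in the lower tail. *)
Lemma expect_sub S f :
  expect (fun A => (S \subset A)%:R * f A) = prob_sub S * expect (fun A => f (S :|: A)).
Proof.
have [n] := ubnP #|S|; elim: n S f => // n IH S f; rewrite ltnS => Sn.
have [->|[x xS]] := set_0Vmem S.
  rewrite /prob_sub big_set0 mul1r; apply: eq_expect_on => A _.
  by rewrite sub0set mul1r set0U.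
rewrite /prob_sub (big_setD1 x)//= -mulrA -/(prob_sub _).
have S'n : (#|S :\ x| < n)%N by rewrite (leq_trans _ Sn)// [leqRHS](cardsD1 x) xS.
have -> : expect (fun A => f (S :|: A)) = expect (fun A => f (x |: ((S :\ x) :|: A))).
  by apply: eq_expect_on => A _; rewrite setUA setD1K.
rewrite -(IH (S :\ x) (fun A => f (x |: A)))//.
have <- : expect (fun A => (x \in A)%:R * ((S :\ x \subset A)%:R * f A)) =
    p x * expect (fun A => (S :\ x \subset A)%:R * f (x |: A)).
  rewrite /expect expect_on_mem ?enum_uniq ?mem_enum//; congr (_ * _).
  apply: eq_expect_on => A _; congr (_%:R * _).
  by rewrite -subDset setDDl setUid.
apply: eq_expect_on => A _; rewrite mulrA -natrM mulnb; congr (_%:R * _).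
by rewrite -{1}(setD1K xS) subUset sub1set.
Qed.

Lemma expect_linear a f g :
  expect (fun A => a * f A + g A) = a * expect f + expect g.
Proof. exact: expect_on_linear. Qed.

Lemma expect_cst c : expect (fun=> c) = c.
Proof. exact: expect_on_cst. Qed.

Lemma expect_mono f g : (forall A, f A <= g A) -> expect f <= expect g.
Proof. exact: expect_on_mono. Qed.

Lemma expect_ge0 f : (forall A, 0 <= f A) -> 0 <= expect f.
Proof. by move=> f0; rewrite -(expect_cst 0); exact: expect_mono. Qed.

Lemma expectZ a f : expect (fun A => a * f A) = a * expect f.
Proof.
rewrite -[RHS]addr0 -[X in _ + X](expect_cst 0) -expect_linear.
by apply: eq_expect_on => A _; rewrite addr0.
Qed.

Lemma expectD f g : expect (fun A => f A + g A) = expect f + expect g.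
Proof.
rewrite -[expect f in RHS]mul1r -expect_linear.
by apply: eq_expect_on => A _; rewrite mul1r.
Qed.

Lemma expect_sum I (r : seq I) (P : pred I) (F : I -> {set T} -> R) :
  expect (fun A => \sum_(i <- r | P i) F i A) = \sum_(i <- r | P i) expect (F i).
Proof.
elim: r => [|i r IH].
  by rewrite big_nil -[RHS](expect_cst 0); apply: eq_expect_on => A _; rewrite big_nil.
rewrite big_cons; case: ifP => Pi; rewrite -IH -?expectD; apply: eq_expect_on => A _;
  by rewrite big_cons Pi.
Qed.

Lemma prob_sub_ge0 S : 0 <= prob_sub S.
Proof. exact: prodr_ge0. Qed.

Lemma prob_subU S A : [disjoint S & A] -> prob_sub (S :|: A) = prob_sub S * prob_sub A.
Proof. by move=> SA; rewrite /prob_sub -bigU//; apply: eq_bigl => b; rewrite inE. Qed.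

Lemma expect_sub1 S : expect (fun A => (S \subset A)%:R) = prob_sub S.
Proof.
have := expect_sub S (fun=> 1); rewrite expect_cst mulr1 => <-.
by apply: eq_expect_on => A _; rewrite mulr1.
Qed.

Section Tails.
Variables (I : finType) (D : {set I}) (E : I -> {set T}).

Definition occurrences A : {set I} := [set i in D | E i \subset A].

Section UpperTail.
Variables (mu t C : R).
Hypotheses (mu_ge : \sum_(i in D) prob_sub (E i) <= mu) (mu_gt0 : 0 < mu) (C0 : 0 <= C).

Definition low_degree A :=
  [forall i in occurrences A,
    #|[set j in occurrences A | ~~ [disjoint E j & E i]]|%:R <= C].

(* The number of sequences of [s] pairwise disjoint events occurring in [A]
   and disjoint from [U]. *)
Fixpoint disjoint_seqs s (U A : {set T}) : R :=
  if s is s'.+1 then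
    \sum_(i in occurrences A | [disjoint E i & U]) disjoint_seqs s' (U :|: E i) A
  else 1.

Lemma disjoint_seqs_ge0 s U A : 0 <= disjoint_seqs s U A.
Proof. by elim: s U => [|s IH] U //=; rewrite sumr_ge0. Qed.

(** Disjoint events are independent, so each further term of the sequence contributes at most a
    factor [mu]. The set [U] of elements already used is carried along through its indicator. *)
Lemma disjoint_seqs_expect s U :
  expect (fun A => (U \subset A)%:R * disjoint_seqs s U A) <= prob_sub U * mu ^+ s.
Proof.
elim: s U => [|s IH] U /=.
  by rewrite expr0 mulr1 -expect_sub1 expect_mono// => A; rewrite mulr1.
have -> : expect (fun A => (U \subset A)%:R *
    \sum_(i in occurrences A | [disjoint E i & U]) disjoint_seqs s (U :|: E i) A) =
  \sum_(i in D | [disjoint E i & U])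
     expect (fun A => (U :|: E i \subset A)%:R * disjoint_seqs s (U :|: E i) A).
  rewrite -expect_sum; apply: eq_expect_on => A _.
  rewrite mulr_sumr [LHS]big_mkcond [RHS]big_mkcond/=.
  apply: eq_bigr => i _; rewrite !inE subUset.
  case: (i \in D) => //=; case: (E i \subset A) => /=; rewrite ?andbT ?andbF ?mul0r//.
  by case: ifP.
rewrite exprS mulrA -[_ * mu]mulrC.
apply: (@le_trans _ _ (\sum_(i in D | [disjoint E i & U]) prob_sub (E i) * prob_sub U * mu ^+ s)).
  apply: ler_sum => i /andP[_ iU]; apply: (le_trans (IH _)).
  by rewrite prob_subU 1?disjoint_sym// [prob_sub U * _]mulrC.
have mu0 : 0 <= prob_sub U * mu ^+ s by rewrite mulr_ge0 ?prob_sub_ge0// exprn_ge0// ltW.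
under eq_bigr do rewrite -mulrA.
rewrite -mulr_suml -mulrA ler_wpM2r//; apply: le_trans mu_ge.
rewrite [leRHS](bigID (fun i => [disjoint E i & U]))/= lerDl.
by rewrite sumr_ge0// => i _; exact: prob_sub_ge0.
Qed.

(** The number [u] stands for the events already chosen. They exclude at most [u * C <= t / 2]
    occurring events, so at least [mu + t / 2] choices remain at every step. *)
Lemma disjoint_seqs_ge s u U A : low_degree A -> mu + t <= #|occurrences A|%:R ->
  #|[set j in occurrences A | ~~ [disjoint E j & U]]|%:R <= u%:R * C ->
  (u + s)%:R * C <= t / 2 -> 0 <= t -> (mu + t / 2) ^+ s <= disjoint_seqs s U A.
Proof.
move=> lowA XA; elim: s u U => [|s IH] u U uC usC t0 //=.
pose J := [set i in occurrences A | [disjoint E i & U]].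
have cardJ : mu + t / 2 <= #|J|%:R.
  have := cardsID J (occurrences A).
  have -> : occurrences A :&: J = J.
    by apply/setP => i; rewrite !inE; case: (i \in D) => //=; case: (_ \subset _).
  have -> : occurrences A :\: J = [set j in occurrences A | ~~ [disjoint E j & U]].
    apply/setP => i; rewrite !inE.
    by case: (i \in D); rewrite ?andbF//=; case: (_ \subset _); rewrite ?andbF//= andbT.
  move=> /(congr1 (fun n => n%:R : R)); rewrite natrD => cJ.
  have : u%:R * C <= t / 2.
    by apply: le_trans usC; rewrite ler_wpM2r// ler_nat leq_addr.
  by move: uC XA; rewrite -cJ; lra.
have pos : 0 <= mu + t / 2 by rewrite addr_ge0 ?divr_ge0// ltW.
rewrite exprS; apply: (@le_trans _ _ (\sum_(i in J) (mu + t / 2) ^+ s)).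
  by rewrite sumr_const -[leRHS]mulr_natl ler_wpM2r// exprn_ge0.
rewrite [leRHS](eq_bigl (mem J)); last by move=> i; rewrite !inE.
apply: ler_sum => i iJ; apply: (IH u.+1) => //; last by rewrite addSnnS.
rewrite -natr1 mulrDl mul1r.
have iA : i \in occurrences A by move: iJ; rewrite inE => /andP[].
have /implyP/(_ iA) degi := forallP lowA i.
apply: le_trans (lerD uC degi); rewrite -natrD ler_nat.
apply: leq_trans (leq_card_setU _ _); apply: subset_leq_card; apply/subsetP => j.
rewrite !inE => /andP[jA]; rewrite jA/= -!setI_eq0 setIUr setU_eq0 negb_and.
by case/orP => ->; rewrite ?orbT.
Qed.

(** Markov's inequality for the number of disjoint sequences of length [s]: it is at least
    [(mu + t / 2) ^+ s] on the event, and at most [mu ^+ s] in expectation. *)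
Lemma upper_tail s : s%:R * C <= t / 2 -> 0 <= t ->
  expect (fun A => (low_degree A && (mu + t <= #|occurrences A|%:R))%:R) <=
  (mu / (mu + t / 2)) ^+ s.
Proof.
move=> sC t0.
have pos : 0 < mu + t / 2 by rewrite ltr_pwDl// divr_ge0.
rewrite expr_div_n ler_pdivlMr ?exprn_gt0// mulrC -expectZ.
have := disjoint_seqs_expect s set0.
rewrite [prob_sub _]big_set0 mul1r; apply: le_trans.
apply: expect_mono => A; rewrite sub0set mul1r.
case: (boolP (low_degree A)) => [lowA|_]; last by rewrite /= mulr0 disjoint_seqs_ge0.
rewrite andTb.
case: (leP (mu + t) _) => XA; last by rewrite /= mulr0 disjoint_seqs_ge0.
rewrite /= mulr1; apply: (disjoint_seqs_ge (u := 0)) => //.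
rewrite mul0r (_ : [set _ in _ | _] = set0) ?cards0//.
by apply/setP => j; rewrite !inE -setI_eq0 setI0 eqxx andbF.
Qed.
End UpperTail.

Section LowerTail.
Variables (d : R).
Hypothesis d0 : 0 <= d.

(** The left side is the probability that no occurring event is marked, when each is marked
    independently with probability [q]. The events are added one at a time as in the proof of
    Janson's inequality; thinning by [q] makes the correlation term quadratic in [q]. *)
Lemma expect_prod_le (q : R) (r : seq I) : 0 <= q <= 1 -> q * d <= 1 ->
  (forall i, i \in r -> \sum_(j <- r | ~~ [disjoint E j & E i]) prob_sub (E j :\: E i) <= d) ->
  expect (fun A => \prod_(i <- r) (1 - q * (E i \subset A)%:R)) <=
  expR (- (q - q ^+ 2 * d) * \sum_(i <- r) prob_sub (E i)).
Proof.
move=> /andP[q_ge0 q1] qd1.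
have f01 i A : 0 <= 1 - q * (E i \subset A)%:R <= 1.
  by case: (_ \subset _); rewrite ?mulr1 ?mulr0 ?subr0 ?lexx ?ler01// subr_ge0 q1/= gerBl.
elim: r => [|i r IH] rd.
  rewrite big_nil mulr0 expR0 -[leRHS]expect_cst; apply: expect_mono => A.
  by rewrite big_nil.
pose P := prob_sub (E i).
pose Y A := \prod_(j <- r) (1 - q * (E j \subset A)%:R).
pose U A := \prod_(j <- r | [disjoint E j & E i]) (1 - q * (E j \subset A)%:R).
pose W A := \prod_(j <- r | ~~ [disjoint E j & E i]) (1 - q * (E j \subset A)%:R).
have U0 A : 0 <= U A by apply: prodr_ge0 => j _; case/andP: (f01 j A).
have W1 A : W A <= 1 by apply: prodr_ile1 => j _.
have YUW A : Y A = U A * W A by rewrite /Y (bigID (fun j => [disjoint E j & E i])).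
have YU A : Y A <= U A by rewrite YUW ler_piMr.
have Y0 A : 0 <= Y A by apply: prodr_ge0 => j _; case/andP: (f01 j A).
have Umono S A : U (S :|: A) <= U A.
  apply: ler_prod => j _; case/andP: (f01 j (S :|: A)) => -> _ /=.
  rewrite lerD2l lerN2 ler_wpM2l// ler_nat.
  by case: (boolP (E j \subset A)) => // /subset_trans -> //; exact: subsetUr.
have UEi A : U (E i :|: A) = U A.
  apply: eq_bigr => j ji; congr (1 - q * (nat_of_bool _)%:R).
  by rewrite -subDset (setDidPl _).
have Wlow A : 1 - q * \sum_(j <- r | ~~ [disjoint E j & E i]) (E j \subset A)%:R <= W A.
  rewrite /W; elim: (r) => [|j r' IHr]; first by rewrite !big_nil mulr0 subr0.
  rewrite !big_cons; case: ifP => // _.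
  set w := \prod_(_ <- _ | _) _ in IHr *; set s := \sum_(_ <- _ | _) _ in IHr *.
  have s0 : 0 <= s by apply: sumr_ge0.
  have w1 : w <= 1 by apply: prodr_ile1 => j' _.
  case: (E j \subset A); last by rewrite mulr0 subr0 mul1r add0r.
  have := mulr_ge0 (mulr_ge0 q_ge0 q_ge0) s0.
  have : 0 <= (1 - q) * (w - (1 - q * s)) by rewrite mulr_ge0// subr_ge0.
  rewrite /=; nra.
have EY : expect (fun A => \prod_(j <- i :: r) (1 - q * (E j \subset A)%:R)) =
    expect Y - q * expect (fun A => (E i \subset A)%:R * Y A).
  rewrite -mulNr addrC -expect_linear; apply: eq_expect_on => A _.
  by rewrite big_cons /Y; ring.
(* Conditioning on [E i] does not affect [U], whose events are disjoint from [E i]. The factor [W]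
   of the others is bounded below by [Wlow], and each term lost is at most
   [prob_sub (E j :\: E i) * expect U], because [U] is decreasing. *)
have key : P * (1 - q * d) * expect Y <= expect (fun A => (E i \subset A)%:R * Y A).
  apply: (@le_trans _ _ (P * (1 - q * d) * expect U)).
    rewrite ler_wpM2l ?mulr_ge0 ?prob_sub_ge0 ?subr_ge0//.
    exact: expect_mono.
  apply: (@le_trans _ _ (expect (fun A => (E i \subset A)%:R * (U A -
     q * \sum_(j <- r | ~~ [disjoint E j & E i]) (E j \subset A)%:R * U A)))).
    rewrite expect_sub -/P -mulrA ler_wpM2l ?prob_sub_ge0//.
    have -> : expect (fun A => U (E i :|: A) -
        q * \sum_(j <- r | ~~ [disjoint E j & E i]) (E j \subset E i :|: A)%:R * U (E i :|: A)) =
      expect U - q * \sum_(j <- r | ~~ [disjoint E j & E i])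
         expect (fun A => (E j :\: E i \subset A)%:R * U A).
      rewrite -[- (q * _)]mulNr [RHS]addrC -expect_sum -expect_linear.
      apply: eq_expect_on => A _; rewrite UEi -mulNr [LHS]addrC; congr (- q * _ + _).
      by apply: eq_bigr => j _; rewrite subDset.
    rewrite mulrBl mul1r lerD2l lerN2 -mulrA ler_wpM2l//.
    apply: (@le_trans _ _ (\sum_(j <- r | ~~ [disjoint E j & E i]) prob_sub (E j :\: E i) * expect U)).
      apply: ler_sum => j _; rewrite expect_sub ler_wpM2l ?prob_sub_ge0//.
      exact: expect_mono.
    rewrite -mulr_suml ler_wpM2r//; first exact: expect_ge0.
    apply: le_trans (rd i (mem_head _ _)).
    by rewrite big_cons; case: ifP => _; rewrite ?lerDr ?prob_sub_ge0.
  apply: expect_mono => A; case: (E i \subset A); rewrite ?mul0r// !mul1r.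
  by rewrite YUW -mulr_suml mulrA -{1}[U A]mul1r -mulrBl mulrC ler_wpM2l// Wlow.
have {}IH : expect Y <= expR (- (q - q ^+ 2 * d) * \sum_(i0 <- r) prob_sub (E i0)).
  apply: IH => j jr; apply: le_trans (rd j _); last by rewrite inE jr orbT.
  by rewrite [leRHS]big_cons; case: ifP => _; rewrite ?lerDr ?prob_sub_ge0.
rewrite EY big_cons mulrDr expRD.
apply: (@le_trans _ _ ((1 - q * (P * (1 - q * d))) * expect Y)).
  by rewrite mulrBl mul1r lerD2l lerN2 -mulrA ler_wpM2l.
apply: (@le_trans _ _ (expR (- (q - q ^+ 2 * d) * P) * expect Y)).
  rewrite ler_wpM2r ?expect_ge0//; apply: le_trans (expR_ge1Dx _).
  by rewrite le_eqVlt; apply/orP; left; apply/eqP; ring.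
by rewrite ler_wpM2l// expR_ge0.
Qed.

Lemma lower_tail (eps mu : R) : 0 < eps <= 1 ->
  mu = \sum_(i in D) prob_sub (E i) ->
  (forall i, i \in D -> \sum_(j in D | ~~ [disjoint E j & E i]) prob_sub (E j :\: E i) <= d) ->
  expect (fun A => ((#|occurrences A|%:R <= (1 - eps) * mu)%R : bool)%:R) <=
  expR (- (eps ^+ 2 * mu / (4 * (2 + d)))).
Proof.
move=> /andP[eps0 eps1] mue Dd; have mu0 : 0 <= mu by rewrite mue;  apply: sumr_ge0 => i _; exact: prob_sub_ge0.
(* This minimizes [- q * eps + q ^+ 2 * (2 + d)], the main part of the exponent left by Markov's
   inequality for [(1 - q) ^+ #|occurrences A|]. The 2 beside [d] comes from the bound [low]. *)
pose q := eps / (2 * (2 + d)).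
have d2 : 0 < 2 * (2 + d) by rewrite mulr_gt0// ltr_pwDl.
have q_gt0 : 0 < q by rewrite divr_gt0.
have qe : q * (2 * (2 + d)) = eps by rewrite /q mulfVK// gt_eqF.
have qd0 : 0 <= q * d by rewrite mulr_ge0// ltW.
have q4 : q <= 1 / 4 by lra.
have qd : q * d <= 1 by lra.
have low : expR (- (q + 2 * q ^+ 2)) <= 1 - q.
  rewrite expRN -[leLHS]mul1r ler_pdivrMr ?expR_gt0//.
  apply: (@le_trans _ _ ((1 - q) * (1 + (q + 2 * q ^+ 2)))).
    have : 0 <= q * q * (1 - 2 * q) by apply: mulr_ge0; [apply: mulr_ge0; lra|lra].
    by lra.
  by rewrite ler_wpM2l ?expR_ge1Dx//; lra.
have q01 : 0 <= q <= 1 by apply/andP; split; lra.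
have tail := @expect_prod_le q (enum D) q01 qd.
rewrite big_enum/= -mue in tail.
rewrite -(ler_pM2l (expR_gt0 (- (q + 2 * q ^+ 2) * ((1 - eps) * mu)))).
rewrite -expectZ -expRD.
apply: (@le_trans _ _ (expR (- (q - q ^+ 2 * d) * mu))).
  apply: le_trans (tail _).
  - apply: expect_mono => A; case: (leP _ ((1 - eps) * mu)) => [XA|_]; last first.
      by rewrite mulr0 prodr_ge0// => i _; case: (_ \subset _); rewrite ?mulr1 ?mulr0; lra.
    rewrite mulr1; apply: (@le_trans _ _ (expR (- (q + 2 * q ^+ 2)) ^+ #|occurrences A|)).
      rewrite -expRM_natr ler_expR !mulNr lerN2.
      by rewrite ler_wpM2l//; nra.
    rewrite big_enum/= (bigID (fun i => E i \subset A))/=.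
    rewrite [X in _ <= _ * X]big1 => [|i /andP[_ /negbTE->]]; last by rewrite mulr0 subr0.
    rewrite mulr1 (eq_bigr (fun=> 1 - q)) => [|i /andP[_ ->]]; last by rewrite mulr1.
    rewrite prodr_const; have -> : #|[pred i in D | E i \subset A]| = #|occurrences A|.
      by apply: eq_card => i; rewrite !inE.
    by rewrite lerXn2r ?nnegrE ?expR_ge0//; lra.
  - move=> i; rewrite mem_enum => iD.
    by rewrite big_enum_cond/=; exact: Dd.
rewrite ler_expR.
have -> : eps ^+ 2 * mu / (4 * (2 + d)) = eps * q * mu / 2.
  by rewrite /q; field; rewrite gt_eqF// ltr_pwDl.
have E1 : q ^+ 2 * (2 + d) * mu = eps * q * mu / 2 by rewrite -qe; field.
have : 0 <= q ^+ 2 * eps * mu by apply: mulr_ge0 => //; apply: mulr_ge0; [exact: sqr_ge0|exact: ltW].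
by lra.
Qed.
End LowerTail.
End Tails.
End RandomSubset.

(** * Selections *)

Lemma sum_invsqr_le (R : realType) (m0 N : nat) : (1 < m0)%N ->
  \sum_(m0 <= m < N) (m%:R ^- 2) <= (m0.-1)%:R^-1 :> R.
Proof.
move=> m01; have [Nm0|m0N] := leqP N m0; first by rewrite big_geq// invr_ge0.
suff H d : \sum_(m0 <= m < m0 + d) (m%:R ^- 2) <=
    (m0.-1)%:R^-1 - (m0 + d).-1%:R^-1 :> R.
  by rewrite -(subnKC (ltnW m0N)) (le_trans (H _))// gerBl invr_ge0.
elim: d => [|d IH]; first by rewrite addn0 big_geq// subrr.
rewrite addnS big_nat_recr ?leq_addr//= (le_trans (lerD IH (lexx _)))//.
set n := (m0 + d)%N; have n1 : (1 < n)%N by rewrite (leq_trans m01)// leq_addr.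
have [x xe] : exists x, n = x.+1 by exists n.-1; rewrite prednK// (leq_trans _ n1).
rewrite xe/=; suff : (x.+1)%:R ^- 2 <= x%:R^-1 - (x.+1)%:R^-1 :> R.
  by move: (_ ^- 2) (x.+1%:R^-1) (x%:R^-1) => a b c; lra.
have x0 : 0 < x%:R :> R by rewrite ltr0n; move: n1; rewrite xe.
rewrite -natr1; set y := x%:R in x0 *.
have -> : y^-1 - (y + 1)^-1 = (y * (y + 1))^-1 by field; rewrite !gt_eqF// ltr_pwDl.
by rewrite lef_pV2 ?posrE ?exprn_gt0 ?mulr_gt0 ?ltr_pwDl//; nra.
Qed.

Lemma invD1_half_le (R : realType) (e : R) : 0 < e -> e <= 1 ->
  (1 + e / 2)^-1 <= expR (- (e / 4)).
Proof.
move=> e0 e1; apply: le_trans (expR_ge1Dx _).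
have he : 0 < 1 + e / 2 by lra.
rewrite -[leLHS]mul1r ler_pdivrMr//.
have : 0 <= e * (1 - e) by rewrite mulr_ge0 ?subr_ge0// ltW.
by lra.
Qed.

Section Selection.
Variables (R : realType) (h K : nat).

(* Off an event of probability [O(m^-2)], fewer than [degree_bound k * w m]
   selected [k]-tuples have sum [m]: the case of [k-1] bounds the number of them
   meeting a given one, and [K] disjoint excesses give [tau m ^+ K <= m^-2]. *)
Fixpoint degree_bound (k : nat) : nat :=
  if k is k'.+1 then (3 + 2 * K * (k * k) * degree_bound k')%N else 1%N.

Lemma degree_bound_gt0 k : (0 < degree_bound k)%N.
Proof. by case: k => //= k; rewrite addnA. Qed.

(** The two summands make the upper and the lower tail at most n^-2. The exponents there are
    [eps ^+ 2 * mu] divided by 16 times the degree bound and by 4 times [2 + d], and both have to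
    reach [2 * ln n]. *)
Definition selection_const : nat :=
  (32 * (h * h * degree_bound h.-1) + 8 * (2 + h * h * forced_bound h h.-1))%N.

Section FiniteHorizon.
Variable N : nat.
Local Notation T := 'I_N.+1.

Definition tuples k m : {set {ffun 'I_k -> T}} :=
  [set y : {ffun 'I_k -> T} | (\sum_i (y i : nat) == m)%N].
Definition reps k m (A : {set T}) := occurrences (tuples k m) (@values N k) A.

Lemma card_reps k m A :
  #|reps k m A|%:R = tuple_sum N (fun b => (inord b \in A)%:R) k m :> R.
Proof.
rewrite -sum1_card natr_sum /tuple_sum [LHS]big_mkcond [RHS]big_mkcond/=.
apply: eq_bigr => y _; rewrite !inE set_weight1.
by case: eqP => //= _; case: (_ \subset _).
Qed.

Lemma sum_tuples (p : nat -> R) k m :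
  \sum_(y in tuples k m) prob_sub (fun b : T => p b) (values y) = tuple_sum N p k m.
Proof. by apply: eq_bigl => y; rewrite inE. Qed.

(** A tuple that meets a given one has one of its [k.+1] coordinates among at most [k.+1] values.
    Deleting it leaves a selected [k]-tuple, and for each sum there are at most [L] of these. *)
Lemma low_degree_reps k m A (L : R) : 0 <= L ->
  (forall m', (m' <= m)%N -> #|reps k m' A|%:R <= L) ->
  low_degree (tuples k.+1 m) (@values N k.+1) (k.+1%:R * k.+1%:R * L) A.
Proof.
move=> L0 rL; apply/forallP => y; apply/implyP => yA.
pose q b : R := (inord b \in A)%:R.
have p01 b : 0 <= q b <= 1 by rewrite /q; case: (_ \in _); rewrite ?lexx ?ler01.
have := @tuple_sum_meet R N q k m (values y) L.
move=> /(_ p01 _ L0).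
have -> : \sum_(y0 : {ffun 'I_k.+1 -> T} | (\sum_i (y0 i : nat) == m)%N && ~~ [disjoint values y0 & values y])
   set_weight q (values y0) =
   #|[set j in reps k.+1 m A | ~~ [disjoint values j & values y]]|%:R :> R.
  rewrite -sum1_card natr_sum [LHS]big_mkcond [RHS]big_mkcond/=.
  apply: eq_bigr => z _; rewrite !inE set_weight1.
  by case: eqP => //= _; case: (_ \subset _) => //=; case: ifP.
move=> H; apply: le_trans (H _) _ => [m' m'm|]; first by rewrite -card_reps; exact: rL.
rewrite ler_wpM2r// ler_wpM2l// ler_nat.
by apply: leq_trans (leq_imset_card _ _) _; rewrite cardsT card_ord.
Qed.

Variables (m0 : nat) (p w tau : nat -> R).
Hypotheses (h0 : (0 < h)%N) (p01 : forall b, 0 <= p b <= 1)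
  (m0h : (h + 4 <= m0)%N) (p_small : forall b, (b < m0)%N -> p b = 0)
  (w1 : forall m, (m0 <= m)%N -> 1 <= w m)
  (w_mono : forall m m', (m0 <= m)%N -> (m <= m')%N -> w m <= w m')
  (tau01 : forall m, (m0 <= m)%N -> 0 < tau m <= 1)
  (tauK : forall m, (m0 <= m)%N -> tau m ^+ K <= m%:R ^- 2)
  (p_sparse : forall k m, (0 < k < h)%N -> (m0 <= m)%N -> (m <= N)%N ->
     tuple_sum N p k m <= tau m * w m).

Let pT := fun b : T => p b.
Let pT01 : forall b, 0 <= pT b <= 1. Proof. by move=> b; exact: p01. Qed.

Let m00 : (0 < m0)%N. Proof. by apply: leq_trans m0h; rewrite addn4. Qed.

Definition supported (A : {set T}) := forall b, b \in A -> p b != 0.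

Lemma supported_ge A b : supported A -> b \in A -> (m0 <= b)%N.
Proof. by move=> As /As; apply: contraNT; rewrite -ltnNge => /p_small ->. Qed.

Lemma reps_small A k m : supported A -> (0 < k)%N -> (m < m0)%N -> reps k m A = set0.
Proof.
move=> As k0 mm0; apply/setP => y; rewrite !inE; apply/negP => /andP[/eqP ym /subsetP yA].
have : (m0 <= y (Ordinal k0))%N.
  by apply: supported_ge As _; apply: yA; apply/imsetP; exists (Ordinal k0).
apply/negP; rewrite -ltnNge; apply: leq_ltn_trans mm0.
by rewrite -ym (bigD1 (Ordinal k0))//= leq_addr.
Qed.

Definition degree_cap k m : R := k%:R * k%:R * ((degree_bound k.-1)%:R * w m).

(** The threshold is [mu + t] of [upper_tail] with [mu = tau m * w m]. Half of [t] exceeds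
    [K * degree_cap k m], which admits sequences of length [K], and it exceeds [w m], which makes
    the ratio [mu / (mu + t / 2)] at most [tau m]. *)
Definition many_reps k m A : bool :=
  low_degree (tuples k m) (@values N k) (degree_cap k m) A &&
  (tau m * w m + 2 * (K%:R * degree_cap k m + w m) <= #|reps k m A|%:R).

Lemma degree_cap_ge0 k m : (m0 <= m)%N -> 0 <= degree_cap k m.
Proof. by move=> m0m; rewrite !mulr_ge0// (le_trans ler01)// w1. Qed.

Lemma many_reps_prob k m : (0 < k < h)%N -> (m0 <= m)%N -> (m <= N)%N ->
  expect pT (fun A => (many_reps k m A)%:R) <= m%:R ^- 2.
Proof.
move=> kh m0m mN; have /andP[t0 t1] := tau01 m0m.
have wm1 := w1 m0m; have C0 := degree_cap_ge0 k m0m.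
have mu0 : 0 < tau m * w m by rewrite mulr_gt0// (lt_le_trans ltr01).
have := @upper_tail R _ pT pT01 _ (tuples k m) (@values N k) (tau m * w m)
  (2 * (K%:R * degree_cap k m + w m)) (degree_cap k m) _ mu0 C0 K _ _.
rewrite sum_tuples => /(_ (p_sparse kh m0m mN)).
have -> : 2 * (K%:R * degree_cap k m + w m) / 2 = K%:R * degree_cap k m + w m.
  by field.
rewrite lerDl => /(_ (le_trans ler01 wm1)) H; apply: le_trans (H _) _.
  by rewrite mulr_ge0// addr_ge0 ?mulr_ge0// (le_trans ler01).
have KC0 : 0 <= K%:R * degree_cap k m by rewrite mulr_ge0.
have wm0 : 0 <= w m := le_trans ler01 wm1.
have den : 0 < tau m * w m + (K%:R * degree_cap k m + w m).
  by rewrite ltr_pwDl// addr_ge0.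
apply: le_trans (tauK m0m).
rewrite lerXn2r ?nnegrE ?divr_ge0//; [exact: ltW|exact: ltW|exact: ltW|].
rewrite ler_pdivrMr// ler_pM2l//.
by have := ltW mu0; lra.
Qed.

Lemma many_reps_cap k m : (0 < k)%N -> (m0 <= m)%N ->
  tau m * w m + 2 * (K%:R * degree_cap k m + w m) <= (degree_bound k)%:R * w m.
Proof.
move=> k0 m0m; have /andP[_ t1] := tau01 m0m; have wm1 := w1 m0m.
case: k k0 => // k _; rewrite /degree_cap [degree_bound k.+1]/=.
set c := K%:R * _.
have -> : (3 + 2 * K * (k.+1 * k.+1) * degree_bound k)%:R * w m = 3 * w m + 2 * c.
  by rewrite /c natrD !natrM; ring.
have : 0 <= (1 - tau m) * w m by rewrite mulr_ge0 ?subr_ge0// (le_trans ler01).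
by lra.
Qed.

(** The bound for [k]-tuples gives low degree to the [k.+1]-tuples, so the absence of [many_reps]
    can only mean that these are few. Monotonicity of [w] transfers the bound from the sum [m'] to
    [m]. *)
Lemma reps_bounded A : supported A ->
  (forall k m, (0 < k < h)%N -> (m0 <= m)%N -> (m <= N)%N -> ~~ many_reps k m A) ->
  forall k m m', (k < h)%N -> (m0 <= m)%N -> (m <= N)%N -> (m' <= m)%N ->
  #|reps k m' A|%:R <= (degree_bound k)%:R * w m.
Proof.
move=> As nbad; elim=> [|k IH] m m' kh m0m mN m'm.
  rewrite mul1r card_reps; apply: le_trans (w1 m0m); exact: tuple_sum0_le.
have wm0 := le_trans ler01 (w1 m0m).
have [m'm0|m0m'] := ltnP m' m0; first by rewrite reps_small// cards0 mulr_ge0.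
have m'N := leq_trans m'm mN.
apply: (@le_trans _ _ ((degree_bound k.+1)%:R * w m')); last first.
  by rewrite ler_wpM2l// w_mono.
apply: le_trans (many_reps_cap (k := k.+1) _ m0m') => //.
have := nbad k.+1 m'; rewrite kh m0m' m'N => /(_ isT isT isT).
rewrite negb_and => /orP[/negP[]|]; last by rewrite -ltNge => /ltW.
apply: low_degree_reps => [|m'' m''m'].
  by rewrite mulr_ge0// (le_trans ler01)// w1.
by apply: IH => //; exact: ltnW.
Qed.

Variables (l u eps : nat -> R) (S : pred nat).
Hypothesis S_bounds : forall n, S n -> (m0 <= n)%N -> (n <= N)%N ->
  [/\ 0 < eps n <= 1, l n <= tuple_sum N p h n, tuple_sum N p h n <= u n
    & selection_const%:R * w n * ln n%:R <= eps n ^+ 2 * l n].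

Let mu n := tuple_sum N p h n.

Lemma ln_half n : (1 < n)%N -> 1 / 2 <= ln n%:R :> R.
Proof.
move=> n1; apply: (@le_trans _ _ (ln 2%:R)); last first.
  by rewrite ler_ln ?posrE ?ltr0n ?ler_nat// (ltn_trans _ n1).
have e2 : expR (- (1 / 2)) = (expR (1 / 2 : R))^-1 by rewrite expRN.
have : expR (1 / 2) <= 2%:R :> R.
  have := expR_ge1Dx (- (1 / 2) : R); rewrite e2 => H.
  rewrite -[leRHS]invrK -[leLHS]invrK lef_pV2 ?posrE ?invr_gt0 ?expR_gt0//.
  by apply: le_trans H; lra.
by rewrite -ler_ln ?posrE ?expR_gt0// expRK.
Qed.

Lemma expRN2ln n : (0 < n)%N -> expR (- (2 * ln n%:R)) = n%:R ^- 2 :> R.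
Proof.
by move=> n0; rewrite expRN mulrC expRM_natr lnK// posrE ltr0n.
Qed.

Lemma mu_large n : S n -> (m0 <= n)%N -> (n <= N)%N ->
  selection_const%:R * w n * ln n%:R <= eps n ^+ 2 * mu n.
Proof.
move=> Sn m0n nN; have [/andP[e0 _] lmu _ H] := S_bounds Sn m0n nN.
by apply: le_trans H _; rewrite ler_wpM2l// sqr_ge0.
Qed.

Let n_gt1 n : (m0 <= n)%N -> (1 < n)%N.
Proof. by move=> m0n; apply: leq_trans m0n; apply: leq_trans m0h; rewrite addnS ltnS addnS. Qed.

Definition top_cap n : R := h%:R * h%:R * ((degree_bound h.-1)%:R * w n).

Definition too_many n A : bool :=
  low_degree (tuples h n) (@values N h) (top_cap n) A &&
  ((1 + eps n) * mu n <= #|reps h n A|%:R).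

Definition too_few n A : bool := #|reps h n A|%:R <= (1 - eps n) * mu n.

Lemma too_many_prob n : S n -> (m0 <= n)%N -> (n <= N)%N ->
  expect pT (fun A => (too_many n A)%:R) <= n%:R ^- 2.
Proof.
move=> Sn m0n nN; have [/andP[e0 e1] _ _ _] := S_bounds Sn m0n nN.
have large := mu_large Sn m0n nN; have wn1 := w1 m0n.
have lnn := ln_half (n_gt1 m0n).
set C := top_cap n; set e := eps n in e0 e1 large *.
have C1 : 1 <= C.
  by rewrite /C /top_cap !mulr_ege1// ler1n ?degree_bound_gt0.
have C0 : 0 < C := lt_le_trans ltr01 C1.
have {}large : 32 * C * ln n%:R <= e ^+ 2 * mu n.
  apply: le_trans large; rewrite /selection_const natrD [in leRHS]natrM.
  rewrite -/C; have -> : C = (h * h * degree_bound h.-1)%:R * w n.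
    by rewrite /C /top_cap !natrM; ring.
  have ln0 : 0 <= ln n%:R :> R by lra.
  have wn0 : 0 <= w n by lra.
  rewrite ler_wpM2r//.
  by rewrite mulrA ler_wpM2r// lerDl.
have mu0 : 0 < mu n.
  rewrite -(@pmulr_rgt0 _ (e ^+ 2)) ?exprn_gt0//; apply: lt_le_trans large.
  by apply: mulr_gt0; [exact: mulr_gt0|lra].
(* The longest sequences with [s * C <= t / 2] for [t = e * mu n]. As [x >= 1], rounding down loses
   at most a factor 2. *)
pose x := e * mu n / (2 * C); pose s := Num.truncn x.
have eemu : e ^+ 2 * mu n <= e * mu n.
  by rewrite ler_wpM2r ?(ltW mu0)// expr2 ler_piMr// ltW.
have C16 : 16 * C <= 32 * C * ln n%:R.
  have : 0 <= C * (ln n%:R - 1 / 2) by rewrite mulr_ge0 ?subr_ge0// ltW.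
  by lra.
have x1 : 1 <= x.
  by rewrite /x ler_pdivlMr; [lra|exact: mulr_gt0].
have sx : s%:R <= x by rewrite /s truncn_le (le_trans ler01).
have s_ge : x / 2 <= s%:R.
  have := truncnS_gt x; rewrite -/s -natr1.
  have : 1 <= s%:R :> R by rewrite ler1n /s truncn_gt0.
  by lra.
have xC : x * (2 * C) = e * mu n by rewrite /x divfK// gt_eqF// mulr_gt0.
clearbody s; clearbody x.
have := @upper_tail R _ pT pT01 _ (tuples h n) (@values N h) (mu n) (e * mu n) C.
rewrite sum_tuples => /(_ (lexx _) mu0 (ltW C0) s).
have -> : mu n + e * mu n = (1 + e) * mu n by ring.
move=> H; apply: le_trans (H _ _) _.
- have := ler_wpM2r (ltW C0) sx; lra.
- by rewrite mulr_ge0// ltW.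
rewrite -expRN2ln; last exact: ltnW (n_gt1 m0n).
have -> : mu n / (mu n + e * mu n / 2) = (1 + e / 2)^-1.
  have -> : mu n + e * mu n / 2 = mu n * (1 + e / 2) by field.
  by rewrite invfM mulrA divff ?mul1r// gt_eqF.
apply: (@le_trans _ _ (expR (- (e / 4)) ^+ s)).
  by rewrite lerXn2r ?nnegrE ?expR_ge0 ?invr_ge0 ?invD1_half_le// addr_ge0// divr_ge0// ltW.
rewrite -expRM_natr ler_expR mulNr lerN2.
have E1 : e / 4 * (x / 2) * (16 * C) = e ^+ 2 * mu n.
  have -> : e / 4 * (x / 2) * (16 * C) = e * (x * (2 * C)) by field.
  by rewrite xC; ring.
apply: (@le_trans _ _ (e / 4 * (x / 2))); last first.
  by apply: ler_wpM2l => //; rewrite divr_ge0// ltW.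
have C16_gt0 : 0 < 16 * C by apply: mulr_gt0.
rewrite -(ler_pM2r C16_gt0) E1.
by apply: le_trans large; rewrite le_eqVlt; apply/orP; left; apply/eqP; ring.
Qed.

Lemma too_few_prob n : S n -> (m0 <= n)%N -> (n <= N)%N ->
  expect pT (fun A => (too_few n A)%:R) <= n%:R ^- 2.
Proof.
move=> Sn m0n nN; have [e01 _ _ _] := S_bounds Sn m0n nN.
have large := mu_large Sn m0n nN; have wn1 := w1 m0n.
have lnn := ln_half (n_gt1 m0n).
have wn0 : 0 <= w n by lra.
have ln0 : 0 <= ln n%:R :> R by lra.
pose d : R := (h * h * forced_bound h h.-1)%:R * w n.
have de : d = (h * h * forced_bound h h.-1)%:R * w n by [].
have d0 : 0 <= d by rewrite mulr_ge0.
clearbody d.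
have := @lower_tail R _ pT pT01 _ (tuples h n) (@values N h) d d0 _ _ e01
  (esym (sum_tuples p h n)).
move=> H; apply: le_trans (H _) _.
(* The weight of [values z :\: values y] is that of [values z] once the values of [y] are forced.
   Sums below [m0] vanish together with [p], so the sparsity hypothesis covers all sums up to
   [n]. *)
- move=> y _; case: (h) h0 p_sparse de y {H} => // h' _ sparse {}de y.
  have p01' b : 0 <= force (values y) p b <= 1.
    by rewrite /force; case: ifP; rewrite ?ler01 ?lexx// p01.
  have vh : (#|values y| <= h'.+1)%N.
    by apply: leq_trans (leq_imset_card _ _) _; rewrite cardsT card_ord.
  have GD k m : (0 < k <= h')%N -> (m <= n)%N -> tuple_sum N p k m <= w n.
    move=> kh mn; have [mm0|m0m] := ltnP m m0; last first.
      apply: le_trans (sparse _ _ _ m0m (leq_trans mn nN)) _ => //.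
      have /andP[_ t1] := tau01 m0m; have := w_mono m0m mn; have := w1 m0m.
      by nra.
    rewrite -sum_tuples big1 ?(le_trans ler01)// => z; rewrite inE => /eqP zm.
    case: k kh z zm => // k _ z zm.
    rewrite /prob_sub (bigD1 (z ord0))/=; last by apply/imsetP; exists ord0.
    rewrite /pT p_small ?mul0r//; apply: leq_ltn_trans mm0.
    by rewrite -zm (bigD1 ord0)//= leq_addr.
  have := @tuple_sum_meet R N (force (values y) p) h' n (values y)
    ((forced_bound h'.+1 h')%:R * w n) p01'.
  move=> meet; apply: le_trans (le_trans (meet _ _) _).
  + rewrite [leLHS]big_mkcond [leRHS]big_mkcond/=; apply: ler_sum => z _.
    rewrite inE; case: ifP => // _.
    rewrite /prob_sub /set_weight [leRHS](big_setID (values y))/=.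
      rewrite [X in _ <= X * _]big1 ?mul1r.
      rewrite (eq_bigr (fun b : T => force (values y) p b))// => b; rewrite inE => /andP[bn _].
      by rewrite /force inord_val (negbTE bn).
    by move=> b /setIP[_ bv]; rewrite /force inord_val bv.
  + move=> m mn; apply: (tuple_sum_force p01 wn1 vh GD) => //.
  + by rewrite mulr_ge0.
  + rewrite de mulrA -!natrM ler_wpM2r//.
    by rewrite ler_nat leq_mul// leq_mul.
rewrite -expRN2ln; last exact: ltnW (n_gt1 m0n).
rewrite ler_expR lerN2 ler_pdivlMr; last by rewrite mulr_gt0//; lra.
apply: le_trans large.
have sc : (8 * (2 + h * h * forced_bound h h.-1))%:R * w n <=
    selection_const%:R * w n.
  by rewrite ler_wpM2r// ler_nat /selection_const leq_addl.
apply: le_trans (ler_wpM2r ln0 sc).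
have -> : (8 * (2 + h * h * forced_bound h h.-1))%:R * w n = 8 * (2 * w n + d).
  by rewrite de natrM natrD; ring.
have : 0 <= (w n - 1) * ln n%:R by rewrite mulr_ge0// subr_ge0.
by lra.
Qed.

Definition bad A : R :=
  \sum_(m0 <= m < N.+1) (\sum_(1 <= k < h) (many_reps k m A)%:R +
     ((S m && too_many m A)%:R + (S m && too_few m A)%:R)).

Lemma finite_selection : exists2 A : {set T}, supported A &
  forall n, S n -> (m0 <= n)%N -> (n <= N)%N ->
  (1 - eps n) * l n <= #|reps h n A|%:R <= (1 + eps n) * u n.
Proof.
have m02 : (1 < m0)%N by exact: n_gt1.
(* Each [m] contributes [h - 1] events [many_reps] and two tails, hence at most [h.+1] times m^-2.
   The sum over [m >= m0] is at most [h.+1 / m0.-1], which is below 1 as [m0 >= h + 4]. *)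
have : expect pT bad < 1.
  apply: (@le_lt_trans _ _ (\sum_(m0 <= m < N.+1) (h.+1)%:R * (m%:R ^- 2 : R))).
    rewrite /bad expect_sum !big_seq; apply: ler_sum => m.
    rewrite mem_index_iota ltnS => /andP[m0m mN].
    have nn : 0 <= (m%:R ^- 2 : R) by rewrite invr_ge0 exprn_ge0.
    rewrite !expectD expect_sum.
    apply: (@le_trans _ _ (\sum_(1 <= k < h) (m%:R ^- 2 : R) + (m%:R ^- 2 + m%:R ^- 2))).
      apply: lerD; last apply: lerD.
      - rewrite !big_seq; apply: ler_sum => k; rewrite mem_index_iota => kh.
        exact: many_reps_prob.
      - case: (boolP (S m)) => Sm /=; first exact: too_many_prob.
        by rewrite expect_cst.
      - case: (boolP (S m)) => Sm /=; first exact: too_few_prob.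
        by rewrite expect_cst.
    rewrite sumr_const_nat -[_ *+ (h - 1)]mulr_natl.
    have -> : (m%:R ^- 2 + m%:R ^- 2 : R) = 2%:R * m%:R ^- 2 by ring.
    by rewrite -mulrDl ler_wpM2r// -natrD ler_nat subn1 addn2 prednK.
  rewrite -mulr_sumr.
  apply: le_lt_trans (ler_wpM2l (ler0n _ _) (sum_invsqr_le _ _ m02)) _.
  rewrite ltr_pdivrMr ?ltr0n; last by rewrite -ltnS prednK.
  by rewrite mul1r ltr_nat -ltnS prednK// (leq_trans _ m0h)// addn4.
case/(expect_on_exists pT01) => A As badA; exists A => // n Sn m0n nN.
have nn m : 0 <= \sum_(1 <= k < h) (many_reps k m A)%:R :> R by exact: sumr_ge0.
have bad0 m : (m0 <= m)%N -> (m <= N)%N -> (forall k, (0 < k < h)%N -> ~~ many_reps k m A) /\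
    ~~ (S m && too_many m A) /\ ~~ (S m && too_few m A).
  move=> m0m mN.
  have : \sum_(1 <= k < h) (many_reps k m A)%:R +
     ((S m && too_many m A)%:R + (S m && too_few m A)%:R) < 1 :> R.
    apply: le_lt_trans badA; rewrite /bad [leRHS](big_rem m) ?mem_index_iota ?m0m//=.
    by rewrite lerDl sumr_ge0// => i _; rewrite !addr_ge0.
  case: (S m && too_many m A); case: (S m && too_few m A) => /=;
    rewrite ?addr0 ?add0r; first by have := nn m; lra.
  - by have := nn m; lra.
  - by have := nn m; lra.
  move=> H; split => // k kh; apply/negP => many; move: H.
  rewrite (big_rem k) ?mem_index_iota//= many ltNge => /negP; apply.
  by rewrite lerDl sumr_ge0.
have bounded := reps_bounded As (fun k m kh m0m mN => (bad0 m m0m mN).1 k kh).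
have [_ []] := bad0 n m0n nN; rewrite Sn/= => few many.
have [/andP[e0 e1] lmu muu _] := S_bounds Sn m0n nN.
apply/andP; split.
  move: many; rewrite /too_few -ltNge => /ltW; apply: le_trans.
  by rewrite ler_wpM2l// subr_ge0.
move: few; rewrite negb_and => /orP[/negP[]|].
  rewrite /top_cap; case: (h) h0 bounded => // h' _ bounded.
  apply: low_degree_reps => [|m' m'n].
    by rewrite mulr_ge0// (le_trans ler01)// w1.
  exact: bounded.
rewrite -ltNge => /ltW/le_trans; apply.
by rewrite ler_wpM2l//; lra.
Qed.
End FiniteHorizon.
End Selection.

(* From here on, names such as [set0] or [subsetP] refer to [classical_sets]
   instead of [finset]. *)
From mathcomp Require Import all_classical all_reals all_analysis.
Local Open Scope classical_set_scope.
Local Open Scope ring_scope.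

(** * Compactness: from finite horizons to an infinite set *)

Section Koenig.
Variable good : nat -> set nat -> Prop.
Hypothesis good_local : forall n (A A' : set nat),
  (forall i, (i <= n)%N -> A i <-> A' i) -> good n A -> good n A'.
Hypothesis good_finite : forall N, exists A : set nat, forall n, (n <= N)%N -> good n A.

(** The nodes of the binary tree with descendants at every level. If both extensions of such a
    prefix failed, at horizons [N1] and [N2], a selection for the larger horizon would contradict
    one of the failures. *)
Let extendible (s : seq bool) := forall N, exists A : set nat,
  (forall i, (i < size s)%N -> A i <-> nth false s i) /\
  forall n, (n <= N)%N -> good n A.

Let extend s : extendible s -> {b : bool | extendible (rcons s b)}.
Proof.
move=> exts; apply: cid; apply: contrapT => /forallNP no.
have [/existsNP[N1 n1] /existsNP[N2 n2]] := (no true, no false).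
have [A [As Ag]] := exts (maxn N1 N2).
have [At|Af] := pselect (A (size s)).
  apply: n1; exists A; split=> [i|n nN]; last by apply: Ag; rewrite leq_max nN.
  rewrite size_rcons ltnS leq_eqVlt nth_rcons => /predU1P[->|si].
    by rewrite ltnn eqxx; split.
  by rewrite si; exact: As.
apply: n2; exists A; split=> [i|n nN]; last by apply: Ag; rewrite leq_max nN orbT.
rewrite size_rcons ltnS leq_eqVlt nth_rcons => /predU1P[->|si].
  by rewrite ltnn eqxx; split.
by rewrite si; exact: As.
Qed.

Let prefix_ext0 : extendible [::].
Proof. by move=> N; have [A Ag] := good_finite N; exists A; split. Qed.

Let pref : nat -> {s : seq bool | extendible s} := fix pref n :=
  if n is n'.+1 then let: exist s es := pref n' in
    exist extendible (rcons s (sval (extend es))) (svalP (extend es))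
  else exist extendible _ prefix_ext0.

Let size_pref n : size (sval (pref n)) = n.
Proof.
by elim: n => //= n IH; case: (pref n) IH => s es /= <-; rewrite size_rcons.
Qed.

Let nth_pref n i : (i < n)%N -> nth false (sval (pref n)) i = nth false (sval (pref i.+1)) i.
Proof.
elim: n => // n IH; rewrite ltnS leq_eqVlt => /predU1P[->//|ni].
rewrite -IH//=; have := size_pref n; case: (pref n) => s es /= sn.
by rewrite nth_rcons sn ni.
Qed.

Lemma koenig : exists A : set nat, forall n, good n A.
Proof.
exists [set i | nth false (sval (pref i.+1)) i] => n.
have [A [As Ag]] := svalP (pref n.+1) n.
apply: good_local (Ag n (leqnn n)) => i ni /=.
by rewrite -(nth_pref (n := n.+1)) ?ltnS//; apply: As; rewrite size_pref ltnS.
Qed.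
End Koenig.

Lemma sum_tuples_widen (V : nmodType) k n N (w : ('I_k -> nat) -> V) : (n <= N)%N ->
  \sum_(y : {ffun 'I_k -> 'I_N.+1} | (\sum_i (y i : nat) == n)%N) w (fun i => y i) =
  \sum_(y : {ffun 'I_k -> 'I_n.+1} | (\sum_i (y i : nat) == n)%N) w (fun i => y i).
Proof.
move=> nN.
pose f (y : {ffun 'I_k -> 'I_n.+1}) : {ffun 'I_k -> 'I_N.+1} := [ffun i => inord (y i)].
pose g (y : {ffun 'I_k -> 'I_N.+1}) : {ffun 'I_k -> 'I_n.+1} := [ffun i => inord (y i)].
have fE y i : f y i = y i :> nat.
  by rewrite ffunE inordK// ltnS (leq_trans _ nN)// -ltnS.
rewrite (reindex_onto f g) => [|y /eqP yn]; last first.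
  apply/ffunP => i; apply: val_inj; rewrite /= fE ffunE inordK//.
  by rewrite ltnS -yn (bigD1 i)//= leq_addr.
apply: eq_big => [y|y _]; last by congr w; apply/funext => i; rewrite fE.
rewrite (_ : g (f y) = y) ?eqxx ?andbT; last first.
  by apply/ffunP => i; apply: val_inj; rewrite ffunE/= fE inordK.
by congr (_ == _); apply: eq_bigr => i _; rewrite fE.
Qed.

Definition restrict (A : set nat) N : {set 'I_N.+1} := [set b : 'I_N.+1 | (b : nat) \in A]%SET.

Lemma rep_countE N k m (A : set nat) : (m <= N)%N ->
  rep_count A k m = #|reps k m (restrict A N)|.
Proof.
move=> mN; rewrite /rep_count -sum1_card -[RHS]sum1_card.
transitivity (\sum_(y : {ffun 'I_k -> 'I_N.+1} | (\sum_i (y i : nat) == m)%N)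
   nat_of_bool [forall i, (y i : nat) \in A])%N.
  rewrite (sum_tuples_widen (fun y => nat_of_bool [forall i, (y i : nat) \in A]) mN).
  rewrite [LHS]big_mkcond [RHS]big_mkcond/=; apply: eq_bigr => y _.
  by rewrite inE andbC; case: (_ == _) => //=; case: ifP.
rewrite [LHS]big_mkcond [RHS]big_mkcond/=; apply: eq_bigr => y _.
rewrite !inE; case: (_ == _) => //=.
suff -> : [forall i, (y i : nat) \in A] = (values y \subset restrict A N) by case: (_ \subset _).
apply/forallP/fintype.subsetP => [yA b /imsetP[i _ ->]|yA i]; first by rewrite inE.
by have := yA (y i) (imset_f _ (finset.in_setT _)); rewrite !inE.
Qed.

Lemma rep_count_local k n (A A' : set nat) :
  (forall i, (i <= n)%N -> A i <-> A' i) -> rep_count A k n = rep_count A' k n.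
Proof.
move=> AA'; congr #|pred_of_set _|; apply/setP => y; rewrite !inE; congr (_ && _).
by apply: eq_forallb => i; apply/idP/idP; rewrite !inE => /AA'; apply; rewrite -ltnS.
Qed.

Theorem selection (R : realType) (h K m0 : nat) (p w tau l u eps : nat -> R) (S : pred nat) :
  (0 < h)%N -> (forall b, 0 <= p b <= 1) ->
  (h + 4 <= m0)%N -> (forall b, (b < m0)%N -> p b = 0) ->
  (forall m, (m0 <= m)%N -> 1 <= w m) ->
  (forall m m', (m0 <= m)%N -> (m <= m')%N -> w m <= w m') ->
  (forall m, (m0 <= m)%N -> 0 < tau m <= 1) ->
  (forall m, (m0 <= m)%N -> tau m ^+ K <= m%:R ^- 2) ->
  (forall N k m, (0 < k < h)%N -> (m0 <= m)%N -> (m <= N)%N ->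
     tuple_sum N p k m <= tau m * w m) ->
  (forall N n, S n -> (m0 <= n)%N -> (n <= N)%N ->
    [/\ 0 < eps n <= 1, l n <= tuple_sum N p h n, tuple_sum N p h n <= u n
    & (selection_const h K)%:R * w n * ln n%:R <= eps n ^+ 2 * l n]) ->
  exists2 A : set nat, (forall b, A b -> p b != 0) &
    forall n, S n -> (m0 <= n)%N ->
    (1 - eps n) * l n <= (rep_count A h n)%:R <= (1 + eps n) * u n.
Proof.
move=> h0 p01 m0h p_small w1 w_mono tau01 tauK p_sparse S_bounds.
pose good n (A : set nat) := (forall b, (b <= n)%N -> A b -> p b != 0) /\
  (S n -> (m0 <= n)%N -> (1 - eps n) * l n <= (rep_count A h n)%:R <= (1 + eps n) * u n).
have [||A Ag] := @koenig good.
- move=> n A A' AA' [Ap Ah]; split => [b bn /AA'-/(_ bn)/Ap|Sn m0n]; first exact.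
  by rewrite -(rep_count_local _ AA'); exact: Ah.
- move=> N; have [A As Ag] := finite_selection h0 p01 m0h p_small w1 w_mono
    tau01 tauK (p_sparse N) (S_bounds N).
  exists [set b | exists2 c : 'I_N.+1, c \in A & b = c :> nat].
  have rA : restrict [set b | exists2 c : 'I_N.+1, c \in A & b = c :> nat] N = A.
    apply/setP => b; rewrite !inE; apply/idP/idP.
      by rewrite inE => -[c cA /val_inj ->].
    by move=> bA; rewrite inE; exists b.
  move=> n nN; split => [b bn [c /As pc ->]//|Sn m0n].
  by rewrite (rep_countE _ _ nN) rA; exact: Ag.
exists A; first by move=> b Ab; have [/(_ b (leqnn b) Ab)] := Ag b.
by move=> n; have [] := Ag n.
Qed.

(** * Regular variation *)

Section Translation.
Variable R : realType.
Local Notation mu := (@lebesgue_measure R).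

Definition translate (u : R) : measurableTypeR R -> measurableTypeR R := fun x => x - u.

Lemma measurable_translate u : measurable_fun setT (translate u).
Proof. by apply: measurable_funB. Qed.

HB.instance Definition _ u :=
  isMeasurableFun.Build _ _ _ _ (translate u) (@measurable_translate u).

Lemma lebesgue_measure_translate u (A : set R) : measurable A ->
  mu (translate u @^-1` A) = mu A.
Proof.
move=> mA; apply/esym.
apply: (@lebesgue_measure_unique R (pushforward mu (translate u))) => //= _ [[a b]] _ <-.
rewrite /pushforward.
have -> : translate u @^-1` `]a, b] = `]a + u, b + u]%classic.
  by apply/seteqP; split => x /=; rewrite !in_itv/= /translate; lra.
rewrite /= !lebesgue_measure_itv/= !lte_fin ltrD2r.
by case: ifP => // _; rewrite -!EFinB; congr (_%:E); lra.
Qed.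

Definition tail_part (G : nat -> set R) (n : nat) : set R :=
  `[0, 2] `&` \bigcap_(m in [set m | (n <= m)%N]) G m.

(** The interval [0, 2] is the increasing union of the sets [tail_part G n], so their measures tend
    to 2. This is the only use of measurability in the uniformity argument. *)
Lemma eventually_cover (G : nat -> set R) : (forall m, measurable (G m)) ->
  (forall v, \forall m \near \oo, G m v) ->
  \forall n \near \oo, ((7 / 4)%:E <
    mu (tail_part G n))%E.
Proof.
move=> mG Gv.
pose V := tail_part G.
have mV n : measurable (V n).
  by apply: measurableI => //; apply: bigcap_measurable => //; exists n => /=.
have UV : \bigcup_n V n = `[0, 2]%classic.
  apply/seteqP; split => [x [n _ []]//|x x02].
  have [N _ NG] := Gv x; exists N => //; split => // m /=; exact: NG.
have ndV : nondecreasing_seq V.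
  move=> n m nm; apply/subsetPset => x [x02 xn]; split => // k /= mk.
  by apply: xn => /=; exact: leq_trans mk.
have : mu \o V @ \oo --> mu (\bigcup_n V n).
  by apply: nondecreasing_cvg_mu => //; rewrite UV; exact: measurable_itv.
rewrite UV lebesgue_measure_itv/= lte_fin ltr0n/= -EFinB subr0.
move=> cv; have lt2 : ((7 / 4)%:E < (2 : R)%:E)%E by rewrite lte_fin; lra.
exact: (cv _ (open_ereal_gt' lt2)).
Qed.

(* Both sets of good shifts have measure more than [7/4] in [[0, 2]], so the
   first one meets the translate by [u n] of the second one inside [[0, 3]]. *)
Lemma uniform_core (H : R -> R) (c s u : nat -> R) : measurable_fun setT H ->
  (forall v, \forall m \near \oo, `|H (s m + v) - H (s m)| < c m) ->
  (forall v, \forall m \near \oo, `|H (s m + u m + v) - H (s m + u m)| < c m) ->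
  (forall m, 0 <= u m <= 1) ->
  \forall m \near \oo, `|H (s m + u m) - H (s m)| < 2 * c m.
Proof.
move=> mH Hs Hu u01.
pose G a m := [set v | `|H (a m + v) - H (a m)| < c m].
have mG a m : measurable (G a m).
  have -> : G a m = setT `&` (fun v => `|H (a m + v) - H (a m)|) @^-1` `]-oo, c m[.
    by rewrite setTI; apply/seteqP; split => v /=; rewrite in_itv.
  have mf : measurable_fun setT (fun v => `|H (a m + v) - H (a m)|).
    apply: measurableT_comp => //; apply: measurable_funB => //.
    by apply: measurableT_comp => //; exact: measurable_funD.
  by apply: mf => //; exact: measurable_itv.
have V := eventually_cover (mG s) Hs.
have W := eventually_cover (mG (fun m => s m + u m)) Hu.
near=> n.
have muV : ((7 / 4)%:E < mu (tail_part (G s) n))%E by near: n.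
have muW : ((7 / 4)%:E < mu (tail_part (G (fun m => s m + u m)%R) n))%E by near: n.
move: muV muW; set Vn := tail_part (G s) n.
set Wn := tail_part (G (fun m => s m + u m)) n; move=> muV muW.
have mVn : measurable Vn.
  by apply: measurableI => //; apply: bigcap_measurable => //; exists n => /=.
have mWn : measurable Wn.
  by apply: measurableI => //; apply: bigcap_measurable => //; exists n => /=.
have {}muW : ((7 / 4)%:E < mu (translate (u n) @^-1` Wn))%E.
  by rewrite lebesgue_measure_translate.
have mW' : measurable (translate (u n) @^-1` Wn).
  by rewrite -[X in measurable X]setTI; exact: measurable_translate.
have /set0P[v [[_ Vv] [_ Wv]]] : Vn `&` translate (u n) @^-1` Wn != set0.
  apply/eqP => VW0.
  have sub : Vn `|` translate (u n) @^-1` Wn `<=` `[0, 3].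
    move=> x [[]|[]]; rewrite /= /translate !in_itv/=; have := u01 n; lra.
  have := le_measure mu _ _ sub; rewrite !inE => /(_ _ _)/=.
  rewrite measureU// lebesgue_measure_itv/= lte_fin ltr0n/= -EFinB subr0.
  move=> /(_ (measurableU _ _ mVn mW') (measurable_itv _)).
  have := lteD muV muW; rewrite -EFinD => lt1 le1.
  by have := lt_le_trans lt1 le1; rewrite lte_fin; lra.
have {}Vv : `|H (s n + v) - H (s n)| < c n by exact: (Vv n (leqnn n)).
have {}Wv : `|H (s n + v) - H (s n + u n)| < c n.
  have := Wv n (leqnn n); rewrite /G/= /translate.
  by have -> : s n + u n + (v - u n) = s n + v by ring.
rewrite distrC in Wv.
have := ler_normD (H (s n + u n) - H (s n + v)) (H (s n + v) - H (s n)).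
have -> : H (s n + u n) - H (s n + v) + (H (s n + v) - H (s n)) = H (s n + u n) - H (s n) by ring.
by lra.
Unshelve. all: by end_near. Qed.
End Translation.

(** * Uniform convergence of increments and the index *)

Section Increments.
Variable R : realType.
Implicit Types (H : R -> R).

Definition increment_lim H (u a : R) := forall e, 0 < e -> exists S, forall s, S <= s ->
  `|H (s + u) - H s - a| <= e.

Lemma increment_lim_uniq H u a b : increment_lim H u a -> increment_lim H u b -> a = b.
Proof.
move=> Ha Hb; apply/eqP; rewrite -subr_eq0 -normr_le0; apply/ler_addgt0Pl => e e0.
have e20 : 0 < e / 2 by rewrite divr_gt0.
have [S1 H1] := Ha _ e20; have [S2 H2] := Hb _ e20.
have := H1 (Num.max S1 S2); have := H2 (Num.max S1 S2).
rewrite !le_max !lexx orbT => /(_ isT) h2 /(_ isT) h1.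
set x := H _ - _ in h1 h2; rewrite addr0.
have -> : a - b = (x - b) - (x - a) by ring.
by rewrite (le_trans (ler_normB _ _))//; lra.
Qed.

Lemma increment_limN H u a : increment_lim H u a -> increment_lim H (- u) (- a).
Proof.
move=> Ha e e0; have [S HS] := Ha e e0; exists (S + u) => s Ss.
have := HS (s - u); rewrite subrK lerBrDr => /(_ Ss).
by rewrite -normrN; congr (`|_| <= _); ring.
Qed.

Lemma increment_limD H u v a b :
  increment_lim H u a -> increment_lim H v b -> increment_lim H (u + v) (a + b).
Proof.
move=> Ha Hb e e0; have e20 : 0 < e / 2 by rewrite divr_gt0.
have [S1 H1] := Ha _ e20; have [S2 H2] := Hb _ e20.
exists (Num.max S1 (S2 - u)) => s; rewrite ge_max => /andP[s1 s2].
have h1 := H1 s s1; have := H2 (s + u); rewrite -lerBlDr => /(_ s2) h2.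
have -> : H (s + (u + v)) - H s - (a + b) = (H (s + u + v) - H (s + u) - b) + (H (s + u) - H s - a).
  by rewrite addrA; ring.
by rewrite (le_trans (ler_normD _ _))//; lra.
Qed.

(** After subtraction of [a 1 * u] the additive function has period 1, so it is bounded on the whole
    line, which forces it to vanish. *)
Lemma additive_bounded_linear (a : R -> R) C : (forall u v, a (u + v) = a u + a v) ->
  (forall u, 0 <= u <= 1 -> `|a u| <= C) -> forall u, a u = a 1 * u.
Proof.
move=> aD aC.
have a0 : a 0 = 0 by have := aD 0 0; rewrite addr0; lra.
have aN u : a (- u) = - a u by have := aD u (- u); rewrite subrr a0; lra.
have an n u : a (n%:R * u) = n%:R * a u.
  elim: n => [|n IH]; first by rewrite !mul0r.
  by rewrite -natr1 !mulrDl !mul1r aD IH.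
have az (z : int) u : a (z%:~R * u) = z%:~R * a u.
  case: z => n; first exact: an.
  by rewrite NegzE mulrNz !mulNr aN -an.
pose b u := a u - a 1 * u.
have bC u : `|b u| <= C + `|a 1|.
  pose z := Num.floor u; pose t := u - z%:~R.
  have t01 : 0 <= t <= 1.
    by have := floor_le u; have := floorD1_gt u; rewrite intrD /t /z; lra.
  have -> : b u = b t.
    rewrite /b /t aD -mulNr -[in a (- _)](mulr1 z%:~R) aN az; ring.
  rewrite /b (le_trans (ler_normB _ _))// lerD ?aC// normrM.
  by rewrite ler_piMr// ger0_norm; case/andP: t01.
move=> u; apply/eqP; rewrite -subr_eq0 -/(b u) -normr_le0 leNgt; apply/negP => bu0.
pose n := (Num.truncn ((C + `|a 1|) / `|b u|)).+1.
have := bC (n%:R * u).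
have -> : b (n%:R * u) = n%:R * b u by rewrite /b an; ring.
rewrite normrM normr_nat leNgt => /negP; apply.
by rewrite -ltr_pdivrMr// truncnS_gt.
Qed.

(** Counterexamples for every [m] would form sequences to which [uniform_core] applies. The
    tolerance may depend on [m]: taking [c m = m] gives local boundedness, before linearity of the
    limits is known, and a constant [c] then gives uniformity. *)
Lemma uniform_increment H (c : nat -> R) : measurable_fun setT H ->
  (forall v (s : nat -> R), (forall m, m%:R <= s m) ->
     \forall m \near \oo, `|H (s m + v) - H (s m)| < c m) ->
  exists m : nat, forall s u, m%:R <= s -> 0 <= u <= 1 -> `|H (s + u) - H s| < 2 * c m.
Proof.
move=> mH Hc; apply: contrapT => /forallNP no.
have {}no m : exists su : R * R, [/\ m%:R <= su.1, 0 <= su.2 <= 1 &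
    2 * c m <= `|H (su.1 + su.2) - H su.1|].
  have /existsNP[s /existsNP[u /not_implyP[ms /not_implyP[u01 /negP]]]] := no m.
  by rewrite -leNgt => ge2; exists (s, u).
have [su suP] := choice no.
have := @uniform_core R H c (fun m => (su m).1) (fun m => (su m).2) mH _ _ _.
case.
- by move=> v; apply: Hc => m; have [] := suP m.
- move=> v; apply: Hc => m; have [ms /andP[u0 _] _] := suP m.
  by rewrite (le_trans ms)// lerDl.
- by move=> m; have [] := suP m.
move=> N _ NP; have [_ _] := suP N; rewrite leNgt => /negP; apply.
exact: (NP N (leqnn N)).
Qed.

Lemma increment_bounded H : measurable_fun setT H ->
  (forall u, exists a, increment_lim H u a) ->
  exists C S, forall s u, S <= s -> 0 <= u <= 1 -> `|H (s + u) - H s| <= C.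
Proof.
move=> mH Hlim.
have [v s sm|m Hm] := @uniform_increment H (fun m => m%:R) mH; last first.
  by exists (2 * m%:R), m%:R => s u ms u01; exact/ltW/Hm.
have [a /(_ 1 ltr01)[S HS]] := Hlim v.
exists (Num.truncn (Num.max S (`|a| + 1))).+1 => // m /= mS.
have {}mS : Num.max S (`|a| + 1) < m%:R.
  by apply: (lt_le_trans (truncnS_gt _)); rewrite ler_nat.
move: mS; rewrite gt_max => /andP[Sm am].
have := HS (s m) (le_trans (ltW Sm) (sm m)) => h1.
have := ler_normD (H (s m + v) - H (s m) - a) a; rewrite subrK => h2.
by apply: le_lt_trans h2 _; apply: le_lt_trans am; rewrite [leRHS]addrC lerD2r.
Qed.

(* [H s] stands for [ln (F (expR s))], for a regularly varying [F]. *)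
Definition log_regular H (kappa : R) := forall e, 0 < e -> exists S, forall s u,
  S <= s -> 0 <= u -> `|H (s + u) - H s - kappa * u| <= e * (u + 1).

(** The limits are additive in [u] and bounded on [0, 1], hence linear; their slope is the index.
    After subtraction of the linear part the increments are uniformly small over shifts in [0, 1],
    and unit steps add up to the error [e * (u + 1)]. *)
Theorem log_regularP H : measurable_fun setT H ->
  (forall u, 0 <= u -> exists a, increment_lim H u a) ->
  exists2 kappa, log_regular H kappa & forall u, increment_lim H u (kappa * u).
Proof.
move=> mH Hlim0.
have Hlim u : exists a, increment_lim H u a.
  case: (leP 0 u) => [|u0]; first exact: Hlim0.
  have [|a Ha] := Hlim0 (- u); first by rewrite oppr_ge0 ltW.
  by exists (- a); rewrite -[u]opprK; exact: increment_limN.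
have [a aP] := choice Hlim.
have aD u v : a (u + v) = a u + a v.
  exact: increment_lim_uniq (aP _) (increment_limD (aP u) (aP v)).
have [C [S0 CP]] := increment_bounded mH Hlim.
have aC u : 0 <= u <= 1 -> `|a u| <= C.
  move=> u01; apply/ler_addgt0Pl => e e0; have [S HS] := aP u e e0.
  have := CP (Num.max S S0) u; rewrite le_max lexx orbT => /(_ isT u01) h1.
  have := HS (Num.max S S0); rewrite le_max lexx => /(_ isT) h2.
  set x := H _ - _ in h1 h2; have -> : a u = x - (x - a u) by ring.
  by rewrite (le_trans (ler_normB _ _))// addrC lerD.
have aE := additive_bounded_linear aD aC.
set kappa := a 1 in aE.
exists kappa; last by move=> u; rewrite -aE.
pose H' s := H s - kappa * s.
have mH' : measurable_fun setT H' by apply: measurable_funB => //; exact: measurable_funM.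
have H'E s u : H' (s + u) - H' s = H (s + u) - H s - kappa * u by rewrite /H'; ring.
move=> e e0.
have [v s sm|m Hm] := @uniform_increment H' (fun=> e / 2) mH'.
  have e40 : 0 < e / 4 by rewrite divr_gt0.
  have [S HS] := aP v _ e40; exists (Num.truncn S).+1 => // m /= mS.
  have Sm : S <= s m.
    by apply: le_trans (sm m); apply/ltW/(lt_le_trans (truncnS_gt _)); rewrite ler_nat.
  by rewrite H'E -aE (le_lt_trans (HS _ Sm))//; lra.
have step s u : m%:R <= s -> 0 <= u <= 1 -> `|H (s + u) - H s - kappa * u| <= e.
  by move=> ms u01; rewrite -H'E; apply/ltW; have := Hm s u ms u01; lra.
exists m%:R => s u ms u0.
suff: forall n t, m%:R <= t -> forall v, n%:R <= v <= n.+1%:R ->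
    `|H (t + v) - H t - kappa * v| <= e * n.+1%:R.
  move=> /(_ (Num.truncn u) s ms u); have /andP[un un1] := truncn_itv u0.
  rewrite un (ltW un1) => /(_ isT) h; apply: le_trans h _.
  by rewrite ler_wpM2l ?(ltW e0)// -natr1 lerD2r.
elim=> [|n IH] t mt v /andP[v1 v2]; first by rewrite mulr1 step// v1.
have := IH (t + 1) _ (v - 1); have mt1 : m%:R <= t + 1 by lra.
have -> : t + 1 + (v - 1) = t + v by ring.
move=> /(_ mt1 _).
have -> : n%:R <= v - 1 <= n.+1%:R.
  by apply/andP; move: v1 v2; rewrite -[n.+2%:R]natr1 -!natr1; split; lra.
move=> /(_ isT) h1; have h2 := step t 1 mt; rewrite ler01 lexx in h2.
have {}h2 := h2 isT.
have -> : H (t + v) - H t - kappa * v =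
  (H (t + v) - H (t + 1) - kappa * (v - 1)) + (H (t + 1) - H t - kappa * 1) by ring.
rewrite (le_trans (ler_normD _ _))// -[n.+2%:R]natr1 [leRHS]mulrDr [X in _ <= _ + X]mulr1.
exact: lerD h1 h2.
Qed.
End Increments.

Lemma equiv_nearP (R : realType) (T : Type) (F : filter_on T) (f g : T -> R) :
  f ~_F g <-> forall e, 0 < e -> \forall x \near F, `|f x - g x| <= e * `|g x|.
Proof. exact: eqaddoP. Qed.

(** * The counting function and Potter bounds *)

Section Counting.
Variables (R : realType) (B : set nat).

Lemma counting_funE (x : R) : counting_fun B x =
  (\sum_(k < (Num.truncn x).+1) ((0 < k) && ((k : nat) \in B)))%N.
Proof.
rewrite /counting_fun -sum1_card big_mkcond; apply: eq_bigr => k _.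
by rewrite inE; case: (_ && _).
Qed.

Lemma counting_fun_natE n : counting_fun B (n%:R : R) =
  (\sum_(k < n.+1) ((0 < k) && ((k : nat) \in B)))%N.
Proof. by rewrite counting_funE natrK. Qed.

Lemma counting_fun_mono (x y : R) : x <= y -> (counting_fun B x <= counting_fun B y)%N.
Proof.
move=> xy; rewrite !counting_funE.
pose F k := nat_of_bool ((0 < k)%N && (k \in B)).
rewrite -(big_mkord xpredT F) -(big_mkord xpredT F).
rewrite [leqRHS](@big_cat_nat _ _ _ (Num.truncn x).+1)//= ?leq_addr//.
by rewrite ltnS; exact: le_truncn.
Qed.

Lemma counting_fun_gt0 b (x : R) : (0 < b)%N -> B b -> b%:R <= x -> (0 < counting_fun B x)%N.
Proof.
move=> b0 Bb /counting_fun_mono; apply: leq_trans.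
by rewrite counting_fun_natE (bigD1 ord_max)//= b0 mem_set.
Qed.
End Counting.

Section Potter.
Variable R : realType.
Implicit Types (G F : R -> R).

(** Potter's bounds in logarithmic form: up to a factor between exp(-e) and exp(e), the ratio G y /
    G x lies between the powers of y / x with exponents kappa - e and kappa + e. *)
Definition potter G (kappa : R) := forall e, 0 < e -> exists2 X, 1 <= X &
  forall x y, X <= x -> x <= y ->
  `|ln (G y) - ln (G x) - kappa * (ln y - ln x)| <= e * (ln y - ln x + 1).

Lemma log_regular_potter G kappa :
  log_regular (fun s => ln (G (expR s))) kappa -> potter G kappa.
Proof.
move=> GR e e0; have [S HS] := GR e e0.
exists (Num.max 1 (expR S)) => [|x y]; first by rewrite le_max lexx.
rewrite ge_max => /andP[x1 Sx] xy.
have x0 : 0 < x by apply: lt_le_trans x1.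
have y0 : 0 < y by apply: lt_le_trans xy.
have := HS (ln x) (ln y - ln x).
rewrite subr_ge0 ler_ln ?posrE// xy [ln x + _]addrC subrK !lnK ?posrE//.
by apply=> //; rewrite -[S]expRK ler_ln ?posrE ?expR_gt0.
Qed.

Lemma potter_upper G kappa e : potter G kappa ->
  (exists n1, forall n, (n1 <= n)%N -> 0 < G n%:R) -> 0 < e ->
  exists2 C, 0 < C & forall n, (0 < n)%N -> G n%:R <= C * n%:R `^ (kappa + e).
Proof.
move=> GP [n1 Gpos] e0; have [X X1 HX] := GP e e0.
pose n0 := maxn n1 (Num.truncn X).+1.
have Xn0 : X <= n0%:R.
  by apply/ltW/(lt_le_trans (truncnS_gt _)); rewrite ler_nat leq_maxr.
pose C1 := expR (ln (G n0%:R) - (kappa + e) * ln n0%:R + e).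
pose C2 := \sum_(i < n0) `|G i%:R| * i%:R `^ (- (kappa + e)).
have C20 : 0 <= C2 by apply: sumr_ge0 => i _; rewrite mulr_ge0// powR_ge0.
have C10 : 0 < C1 by exact: expR_gt0.
exists (C1 + C2) => [|n n_gt0]; first by rewrite ltr_pwDl.
have nR0 : 0 < n%:R :> R by rewrite ltr0n.
have [nn0|n0n] := ltnP n n0.
  apply: (@le_trans _ _ (C2 * n%:R `^ (kappa + e))); last first.
    by rewrite ler_wpM2r ?powR_ge0// lerDr ltW.
  rewrite /C2 (bigD1 (Ordinal nn0))//= mulrDl -mulrA -powRD; last first.
    by rewrite (gt_eqF nR0) implybT.
  rewrite addNr powRr0 mulr1 (le_trans (ler_norm _))// lerDl mulr_ge0 ?powR_ge0//.
  by apply: sumr_ge0 => i _; rewrite mulr_ge0// powR_ge0.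
apply: (@le_trans _ _ (C1 * n%:R `^ (kappa + e))); last first.
  by rewrite ler_wpM2r ?powR_ge0// lerDl.
have Gn : 0 < G n%:R by apply: Gpos; rewrite (leq_trans _ n0n)// leq_maxl.
rewrite -[leLHS]lnK ?posrE// /powR gt_eqF// -expRD ler_expR.
have := HX n0%:R n%:R Xn0; rewrite ler_nat => /(_ n0n).
by move=> /(le_trans (ler_norm _)); lra.
Qed.

Lemma potter_inv G kappa : potter G kappa -> (forall x, 0 < x -> 0 <= G x) ->
  potter (fun x => (G x)^-1) (- kappa).
Proof.
move=> GP G0 e e0; have [X X1 HX] := GP e e0; exists X => // x y Xx xy.
have lnV' t : 0 < t -> ln (G t)^-1 = - ln (G t).
  move=> t0; have := G0 t t0; rewrite le_eqVlt => /predU1P[<-|Gt].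
    by rewrite invr0 ln0// oppr0.
  by rewrite lnV.
rewrite !lnV'; [|lra|lra].
have := HX x y Xx xy; rewrite -normrN; congr (`|_| <= _); ring.
Qed.

Lemma potter_lower G kappa e : potter G kappa -> (forall x, 0 < x -> 0 <= G x) ->
  (exists n1, forall n, (n1 <= n)%N -> 0 < G n%:R) -> 0 < e ->
  exists2 c, 0 < c & forall n, (0 < n)%N -> 0 < G n%:R -> c * n%:R `^ (kappa - e) <= G n%:R.
Proof.
move=> GP G0 [n1 Gn1] e0.
have [|C C0 HC] := potter_upper (potter_inv GP G0) _ e0.
  by exists n1 => n /Gn1; rewrite invr_gt0.
exists C^-1 => [|n n0 Gn]; first by rewrite invr_gt0.
have nR0 : 0 < n%:R :> R by rewrite ltr0n.
have := HC n n0; have -> : - kappa + e = - (kappa - e) by ring.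
rewrite powRN => H; have P0 : 0 < n%:R `^ (kappa - e) by rewrite powR_gt0.
rewrite -[leRHS]invrK -[leLHS]invrK lef_pV2 ?posrE ?invr_gt0//; last first.
  by rewrite mulr_gt0// invr_gt0.
by rewrite invfM invrK.
Qed.

Lemma ln_ratio_lim G u (l : R) : (\forall x \near +oo, 0 < G x) -> 0 < l ->
  G (expR u * x) / G x @[x --> +oo] --> l ->
  increment_lim (fun s => ln (G (expR s))) u (ln l).
Proof.
move=> [M [Mreal GM]] l0 lim e e0.
have /cvgrPdist_le/(_ e e0)[M' [M'real HM]] :
    ln (G (expR u * x) / G x) @[x --> +oo] --> ln l.
  by apply: continuous_cvg => //; exact: continuous_ln.
pose M1 := Num.max 1 (Num.max M M' + 1).
have M10 : 0 < M1 by rewrite lt_max ltr01.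
exists (Num.max (ln M1) (ln M1 - u)) => s; rewrite ge_max => /andP[s1 s2].
have e1 : M1 <= expR s by rewrite -[M1]lnK ?posrE// ler_expR.
have e2 : M1 <= expR (s + u) by rewrite -[M1]lnK ?posrE// ler_expR; lra.
have [MM MM'] : M < M1 /\ M' < M1.
  have : Num.max M M' < M1 by rewrite /M1 lt_max ltrDl ltr01 orbT.
  by rewrite gt_max => /andP.
have g1 : 0 < G (expR s) by apply/GM/(lt_le_trans MM).
have g2 : 0 < G (expR (s + u)) by apply/GM/(lt_le_trans MM).
have := HM (expR s) (lt_le_trans MM' e1).
rewrite -expRD [u + s]addrC ln_div ?posrE//.
by rewrite distrC.
Qed.
End Potter.

Section Regular.
Variable R : realType.

Lemma regularly_varying_potter (F : R -> R) : regularly_varying F ->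
  exists2 kappa, potter F kappa &
    forall lambda, 0 < lambda -> F (lambda * x) / F x @[x --> +oo] --> lambda `^ kappa.
Proof.
move=> [[Fpos mF] Flim].
have Fnear : \forall x \near +oo, 0 < F x.
  by exists 0; split => // x; exact: Fpos.
have [||kappa kP kE] := @log_regularP R (fun s => ln (F (expR s))).
- have mFe : measurable_fun setT (F \o expR).
    have sub : [set expR x | x in [set: R]] `<=` `]0, +oo[%classic.
      by move=> _ [s _ <-] /=; rewrite in_itv/= andbT expR_gt0.
    exact: (measurable_comp (measurable_itv `]0, +oo[) sub mF (@measurable_expR R)).
  exact: (measurableT_comp (@measurable_ln R) mFe).
- move=> u _; have [l l0 lP] := Flim (expR u) (expR_gt0 u).
  by exists (ln l); exact: ln_ratio_lim.
exists kappa; first exact: log_regular_potter.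
move=> lambda l0; have [l lgt0 lP] := Flim lambda l0.
have -> : lambda `^ kappa = l => //.
rewrite -[lambda]lnK ?posrE// in lP *.
have := increment_lim_uniq (kE (ln lambda)) (ln_ratio_lim Fnear lgt0 lP) => E.
by rewrite /powR gt_eqF ?expR_gt0// expRK E lnK.
Qed.

Lemma regular_set_potter (B : set nat) (beta : R) : regular_set B beta ->
  (exists2 b, (0 < b)%N & B b) -> potter (fun x : R => (counting_fun B x)%:R) beta.
Proof.
move=> [beta0 Blim] [b b0 Bb].
have Bnear : \forall x \near +oo, 0 < (counting_fun B (x : R))%:R :> R.
  exists b%:R; split => // x /ltW bx; rewrite ltr0n; exact: counting_fun_gt0 bx.
pose H (s : R) : R := ln (counting_fun B (expR s))%:R.
have lim u : 0 <= u -> increment_lim H u (beta * u).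
  move=> u0; have eu1 : 1 <= expR u by rewrite -expR0 ler_expR.
  have /equiv_nearP eqv := Blim (expR u) eu1.
  have -> : beta * u = ln (expR u `^ beta) by rewrite ln_powR expRK.
  apply: (@ln_ratio_lim R (fun x => (counting_fun B x)%:R)) => //; first by rewrite powR_gt0// expR_gt0.
  apply/cvgrPdist_le => e e0.
  have l0 : 0 < expR u `^ beta by rewrite powR_gt0// expR_gt0.
  have := eqv (e / expR u `^ beta) (divr_gt0 e0 l0).
  apply: filterS2 Bnear => x Bx h.
  rewrite normrM normr_nat (gtr0_norm l0) mulrA divfK ?gt_eqF// in h.
  have -> : expR u `^ beta - (counting_fun B (expR u * x))%:R / (counting_fun B x)%:R =
    (expR u `^ beta * (counting_fun B x)%:R - (counting_fun B (expR u * x))%:R) / (counting_fun B x)%:R.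
    by rewrite mulrBl mulfK// gt_eqF.
  rewrite normrM distrC normfV normr_nat.
  by rewrite ler_pdivrMr.
have [||kappa kP kE] := @log_regularP R H.
(* The logarithm of the count is monotone even where the count is 0: [ln 0 = 0], and nonzero counts
   have nonnegative logarithms. *)
- apply: nondecreasing_measurable => // s t st; rewrite /H.
  have Bst : (counting_fun B (expR s) <= counting_fun B (expR t))%N.
    by apply: counting_fun_mono; rewrite ler_expR.
  have [->|s0] := posnP (counting_fun B (expR s)).
    rewrite ln0//; have [->|t0] := posnP (counting_fun B (expR t)); first by rewrite ln0.
    by rewrite ln_ge0// ler1n.
  by rewrite ler_ln ?posrE ?ltr0n ?ler_nat// (leq_trans s0).
- by move=> u u0; exists (beta * u); exact: lim.
have -> : beta = kappa; last exact: log_regular_potter.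
have := increment_lim_uniq (lim 1 ler01) (kE 1); rewrite !mulr1; exact.
Qed.
End Regular.

(** * Additive energy and sums with few summands *)

Section Dilations.
Variable R : realType.
Implicit Types (p q : nat -> R).

Lemma coef_dilated N p c i : (0 < c)%N ->
  (dilated_poly N p c)`_i = if (c %| i)%N && (i %/ c <= N)%N then p (i %/ c)%N else 0.
Proof.
move=> c0; rewrite coef_sum.
under eq_bigr do rewrite coefZ coefXn.
case: ifPn => [/andP[/dvdnP[b ->]]|ci].
  rewrite mulnK// => bN; rewrite (bigD1 (inord b))//= inordK// mulnC eqxx mulr1.
  rewrite big1 ?addr0// => j jb; rewrite eqn_pmul2l//; case: eqP => [e|]; last by rewrite mulr0.
  by move: jb; rewrite -val_eqE/= inordK// e eqxx.
rewrite big1// => b _; case: eqP => [e|_]; last by rewrite mulr0.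
by move: ci; rewrite e dvdn_mulr// mulKn// -ltnS ltn_ord.
Qed.

Lemma dilations_coef_le N m p h i : (forall b, 0 <= p b) -> (i <= m)%N ->
  (dilations_poly N p h)`_i <= (dilations_poly m p h)`_i.
Proof.
move=> p0 im; rewrite !coef_sum; apply: ler_sum => c _.
rewrite !coef_dilated//; case: (_ %| _)%N => //=.
have -> : (i %/ c.+1 <= m)%N by exact: leq_trans (leq_div _ _) im.
by case: ifP.
Qed.

Lemma energy_dilations_le N q h k : (0 < k)%N ->
  energy k (dilations_poly N q h) <= 4 ^+ (k * h) * energy k (dilated_poly N q 1).
Proof.
move=> k0; apply: (energy_sum_le (U := fun c => dilated_poly N q c.+1)) => //.
  exact: energy_ge0.
move=> c _; have -> : dilated_poly N q c.+1 = dilated_poly N q 1 \Po 'X^(c.+1).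
  rewrite /dilated_poly raddf_sum/=; apply: eq_bigr => b _.
  by rewrite comp_polyZ comp_Xn_poly mul1n -exprM.
by rewrite energy_comp_Xn.
Qed.

(** Excluding 0 agrees with [counting_fun] and keeps the constant coefficients of the polynomials
    equal to 0. *)
Definition indicator (B : set nat) (b : nat) : R := ((0 < b)%N && (b \in B))%:R.

Lemma powR_nat_le (x y : nat) (a : R) : 0 <= a -> (x <= y)%N -> x%:R `^ a <= y%:R `^ a.
Proof. by move=> a0 xy; rewrite ge0_ler_powR// ?nnegrE// ler_nat. Qed.

Lemma powR_between (x y : nat) (a : R) : (0 < y)%N -> (y <= x)%N ->
  forall D : nat, (x <= D * y)%N -> x%:R `^ a <= D%:R `^ `|a| * y%:R `^ a.
Proof.
move=> y0 yx D xDy.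
have D0 : (0 < D)%N.
  by rewrite lt0n; apply: contraTN xDy => /eqP ->; rewrite mul0n -ltnNge (leq_trans y0).
case: (leP 0 a) => a0.
  rewrite ger0_norm// -powRM// -natrM; exact: powR_nat_le.
rewrite -[leLHS]mul1r; apply: ler_pM; rewrite ?powR_ge0//.
  by rewrite -[leLHS](powRr0 D%:R) ler_powR ?ler1n.
rewrite -[a]opprK powRN [leRHS]powRN lef_pV2 ?posrE ?powR_gt0 ?ltr0n ?(leq_trans y0)//.
by apply: powR_nat_le => //; rewrite oppr_ge0 ltW.
Qed.

Section EnergyBound.
Variables (B : set nat) (beta : R) (k : nat).
Hypothesis k0 : (0 < k)%N.
Hypothesis B_energy : forall e, 0 < e -> exists C, forall y, (0 < y)%N ->
  energy k (dilated_poly y (indicator B) 1) <= C * y%:R `^ (2 * k%:R * beta - 1 + e).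

Variables (q : nat -> R) (sigma : R) (h : nat).
Hypotheses (q0 : forall b, 0 <= q b) (qB : forall b, q b != 0 -> (0 < b)%N /\ B b).
Hypothesis q_le : forall e, 0 < e -> exists C, forall b, (0 < b)%N ->
  q b <= C * b%:R `^ (sigma + e).

Definition scale_poly Q a : {poly R} :=
  \poly_(i < Q ^ a.+1) (if (Q ^ a <= i)%N then q i else 0).

Lemma nonneg_scale Q a : nonneg_poly (scale_poly Q a).
Proof. by move=> i; rewrite coef_poly; case: ifP => // _; case: ifP. Qed.

Lemma scale_energy Q e : (1 < Q)%N -> 0 < e -> exists2 C, 0 <= C & forall a,
  energy k (scale_poly Q a) <=
  C * (Q ^ a)%:R `^ (2 * k%:R * (sigma + e) + (2 * k%:R * beta - 1 + e)).
Proof.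
move=> Q1 e0; have [C1 HC1] := q_le e0; have [C2 HC2] := B_energy e0.
set s := sigma + e in HC1 *; set t := 2 * k%:R * beta - 1 + e in HC2 *.
have Q0 : (0 < Q)%N by exact: ltnW.
have C10 : 0 <= C1 by have := HC1 1%N isT; rewrite powR1 mulr1; apply: le_trans.
have C20 : 0 <= C2.
  have := HC2 1%N isT; rewrite powR1 mulr1; apply: le_trans; exact: energy_ge0.
pose D := Q%:R `^ `|s| : R; have D0 : 0 <= D by exact: powR_ge0.
exists (((C1 * D) ^+ k) ^+ 2 * (C2 * Q%:R `^ `|t|)) => [|a].
  by apply: mulr_ge0; [exact: sqr_ge0|by rewrite mulr_ge0 ?powR_ge0].
have Qa0 : (0 < Q ^ a)%N by rewrite expn_gt0 Q0.
apply: (@le_trans _ _ (energy k ((C1 * D * (Q ^ a)%:R `^ s) *: dilated_poly (Q ^ a.+1) (indicator B) 1))).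
  apply: energy_mono => [|i]; first exact: nonneg_scale.
  rewrite coefZ coef_poly coef_dilated// dvd1n divn1/=.
  have rhs0 : 0 <= C1 * D * (Q ^ a)%:R `^ s by rewrite !mulr_ge0// powR_ge0.
  case: ltnP => iQ; last by rewrite mulr_ge0//; case: ifP; rewrite // ler0n.
  rewrite (ltnW iQ); case: ifPn => Qi; last by rewrite mulr_ge0// ler0n.
  have [->|qi] := eqVneq (q i) 0; first by rewrite mulr_ge0// ler0n.
  have [i0 Bi] := qB qi; rewrite /indicator i0 (mem_set Bi) mulr1.
  apply: (le_trans (HC1 i i0)); rewrite -mulrA ler_wpM2l//.
  by apply: powR_between => //; rewrite -expnS ltnW.
rewrite energyZ exprMn.
have -> : (((C1 * D) ^+ k * ((Q ^ a)%:R `^ s) ^+ k) ^+ 2) =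
   ((C1 * D) ^+ k) ^+ 2 * (Q ^ a)%:R `^ (2 * k%:R * s).
  rewrite exprMn; congr (_ * _); rewrite -exprM -powR_mulrn ?powR_ge0// -powRrM natrM.
  by congr (_ `^ _); ring.
rewrite -[leLHS]mulrA -[leRHS]mulrA ler_wpM2l ?sqr_ge0//.
apply: (@le_trans _ _ ((Q ^ a)%:R `^ (2 * k%:R * s) * (C2 * (Q ^ a.+1)%:R `^ t))).
  by rewrite ler_wpM2l ?powR_ge0// HC2// expn_gt0 Q0.
have Qan0 : (Q ^ a)%:R != 0 :> R by rewrite pnatr_eq0 -lt0n.
rewrite [in leRHS]powRD ?Qan0 ?implybT//.
rewrite mulrCA -[leRHS]mulrA ler_wpM2l// [leRHS]mulrCA ler_wpM2l ?powR_ge0//.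
by apply: powR_between => //; rewrite ?expnS// leq_pmull.
Qed.

(** The weight is cut into the scales [Q ^ a <= b < Q ^ a.+1], on each of which it is at most a
    constant times the indicator of [B]. The scale energies are powers of [Q ^ a]; the maximum with
    0 occurs because the first scale dominates if the exponent is negative. *)
Lemma energy_bound e : 0 < e -> exists C, forall m, (0 < m)%N ->
  energy k (dilations_poly m q h) <=
  C * m%:R `^ (e + Num.max 0 (2 * k%:R * (sigma + beta) - 1)).
Proof.
move=> e0.
pose e1 := e / (2 * (2 * k%:R + 1)).
have k20 : 0 < 2 * (2 * k%:R + 1) :> R by rewrite mulr_gt0// ltr_wpDl.
have e10 : 0 < e1 by rewrite divr_gt0.
pose r := (Num.truncn (2 / e)).+1.
have r0 : 0 < r%:R :> R by rewrite ltr0n.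
have re : r%:R^-1 <= e / 2.
  by rewrite -[leRHS]invrK lef_pV2 ?posrE ?invr_gt0 ?divr_gt0// invf_div ltW// truncnS_gt.
(* Adding up the scales costs a factor [4 ^ k] for each of them. With this ratio the total
   [4 ^ (k * A)] equals the power of [Q ^ A <= m] with exponent [r^-1 <= e / 2]. *)
pose Q := (4 ^ (k * r))%N.
have Q1 : (1 < Q)%N by rewrite -{1}(expn0 4) ltn_exp2l// muln_gt0 k0.
have [C1 C10 HC1] := scale_energy Q1 e10.
set z := 2 * k%:R * (sigma + e1) + _ in HC1.
pose g := Num.max 0 (2 * k%:R * (sigma + beta) - 1).
have g0 : 0 <= g by rewrite le_max lexx.
have zg : z <= e / 2 + g.
  have -> : z = e / 2 + (2 * k%:R * (sigma + beta) - 1).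
    by rewrite /z /e1; field; rewrite gt_eqF// ltr_wpDl.
  by rewrite lerD2l le_max lexx orbT.
exists (4 ^+ (k * h) * (4 ^+ k * C1)) => m m0.
apply: (le_trans (energy_dilations_le _ _ _ k0)).
rewrite -[leRHS]mulrA ler_wpM2l ?exprn_ge0//.
pose A := trunc_log Q m.
have QAm : (Q ^ A <= m)%N by exact: trunc_logP.
have mR0 : 0 < m%:R :> R by rewrite ltr0n.
have mR1 : 1 <= m%:R :> R by rewrite ler1n.
apply: (@le_trans _ _ (energy k (\sum_(a < A.+1) scale_poly Q a))).
  apply: energy_mono => [|i].
    by move=> i; rewrite coef_dilated//; case: ifP.
  rewrite coef_dilated// dvd1n divn1/= coef_sum.
  have nn (a : 'I_A.+1) : 0 <= (scale_poly Q a)`_i by exact: nonneg_scale.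
  case: ifPn => [im|_]; last by rewrite sumr_ge0.
  have [->|qi] := eqVneq (q i) 0; first by rewrite sumr_ge0.
  have [i0 _] := qB qi.
  have la : (trunc_log Q i < A.+1)%N by rewrite ltnS leq_trunc_log.
  rewrite (bigD1 (Ordinal la))//= coef_poly trunc_log_ltn// trunc_logP//.
  by rewrite lerDl sumr_ge0.
have MA (a : nat) : (a < A.+1)%N -> energy k (scale_poly Q a) <= C1 * m%:R `^ (e / 2 + g).
  move=> aA; apply: (le_trans (HC1 a)); rewrite ler_wpM2l//.
  have Qa1 : 1 <= (Q ^ a)%:R :> R by rewrite ler1n expn_gt0 (ltnW Q1).
  apply: (@le_trans _ _ ((Q ^ a)%:R `^ (e / 2 + g))); first by rewrite ler_powR.
  rewrite powR_nat_le//; first by rewrite addr_ge0// divr_ge0// ltW.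
  by apply: leq_trans QAm; rewrite leq_exp2l.
apply: (le_trans (energy_sum_le k0 _ MA)).
  by rewrite mulr_ge0// powR_ge0.
rewrite mulnS exprD -mulrA -[leRHS]mulrA ler_wpM2l ?exprn_ge0//.
rewrite mulrCA ler_wpM2l//.
have -> : e + g = e / 2 + (e / 2 + g) by field.
rewrite [in leRHS]powRD; last by rewrite (gt_eqF mR0) implybT.
rewrite ler_wpM2r ?powR_ge0//.
apply: (@le_trans _ _ (m%:R `^ (r%:R^-1))); last by rewrite ler_powR.
have -> : 4 ^+ (k * A) = ((Q ^ A)%:R : R) `^ (r%:R^-1).
  have -> : (Q ^ A)%:R = (4 ^+ (k * A)) `^ r%:R :> R.
    by rewrite powR_mulrn ?exprn_ge0// -exprM natrX /Q natrX -exprM mulnAC.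
  by rewrite -powRrM divff ?gt_eqF// powRr1// exprn_ge0.
by rewrite powR_nat_le// invr_ge0 ltW.
Qed.
End EnergyBound.
End Dilations.

(** * A power saving for sums with fewer than h summands *)

Section CoefBound.
Variable R : realType.
Implicit Types (p : nat -> R).

Lemma powR_subadd (theta : R) i j : 0 <= theta ->
  (i + j)%:R `^ theta <= 2 `^ theta * (i%:R `^ theta + j%:R `^ theta) :> R.
Proof.
move=> t0; wlog ij : i j / (i <= j)%N => [H|].
  by case: (leqP i j) => [/H//|/ltnW/H]; rewrite addnC [_ + i%:R `^ _]addrC.
apply: (@le_trans _ _ (2 `^ theta * j%:R `^ theta)); last first.
  by rewrite ler_wpM2l ?powR_ge0// lerDr powR_ge0.
rewrite -powRM// -natrM powR_nat_le// mul2n -addnn leq_add2r//.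
Qed.

(* The exponent gained by weighting with [theta] exceeds the loss. *)
Lemma exponent_gap (k1 k2 h : nat) (omega : R) : (0 < k1)%N -> (k1 <= k2)%N ->
  (k1 + k2).+1 = h -> (k2.*2 <= h)%N -> h%:R^-1 <= omega ->
  let theta := Num.max 0 ((2 * k1%:R)^-1 - omega) in
  - (2 * theta) + Num.max 0 (2 * k1%:R * (omega + theta) - 1) +
    Num.max 0 (2 * k2%:R * omega - 1) < 2 * (h%:R * omega - 1).
Proof.
move=> k10 k12 kh k2h oh; set x := _^-1 - omega.
have h0 : 0 < h%:R :> R by rewrite ltr0n -kh.
have o0 : 0 < omega by apply: lt_le_trans oh; rewrite invr_gt0.
have ho : 1 <= h%:R * omega by rewrite mulrC -ler_pdivrMr// mul1r.
have K1 : 0 < 2 * k1%:R :> R by rewrite mulr_gt0// ltr0n.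
have hE : h%:R = k1%:R + k2%:R + 1 :> R by rewrite -kh -natr1 natrD.
have K2h : 2 * k2%:R <= h%:R :> R by rewrite -natrM ler_nat mul2n.
have K12 : 2 * k1%:R <= 2 * k2%:R :> R by rewrite ler_pM2l// ler_nat.
case: (leP 0 x) => x0 /=.
  have [xe|xne] := eqVneq x 0.
    have e1 : 2 * k1%:R * omega = 1.
      have -> : omega = (2 * k1%:R)^-1 by apply/esym/eqP; rewrite -subr_eq0 -/x xe.
      by rewrite divff// gt_eqF.
    have : 2 * k1%:R * omega <= 2 * k2%:R * omega by rewrite ler_wpM2r// ltW.
    rewrite xe mulr0 oppr0 add0r addr0 e1 subrr maxxx add0r => le12.
    rewrite (max_idPr _); last by lra.
    by rewrite hE; lra.
  have -> : 2 * k1%:R * (omega + x) - 1 = 0.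
    have -> : omega + x = (2 * k1%:R)^-1 by rewrite /x addrC subrK.
    by rewrite divff ?gt_eqF// subrr.
  rewrite maxxx addr0.
  have xgt0 : 0 < x by rewrite lt_def xne.
  have : Num.max 0 (2 * k2%:R * omega - 1) <= h%:R * omega - 1.
    rewrite ge_max subr_ge0 ho/= lerD2r.
    by rewrite ler_wpM2r// ltW.
  by lra.
rewrite mulr0 oppr0 add0r addr0.
have e1 : 1 <= 2 * k1%:R * omega.
  have : (2 * k1%:R)^-1 <= omega by move: x0; rewrite /x subr_lt0 => /ltW.
  by rewrite -[(_)^-1]mul1r ler_pdivrMr// mulrC.
have : 2 * k1%:R * omega <= 2 * k2%:R * omega by rewrite ler_wpM2r// ltW.
move=> le12; rewrite !(max_idPr _); [|lra|lra].
by rewrite hE; lra.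
Qed.

Variables (B : set nat) (beta omega : R) (H h : nat).
Hypotheses (H0 : (0 < H)%N) (Hh : (2 * H + 1 <= h)%N) (ho : h%:R^-1 <= omega).
Hypothesis B_energy : forall k, (H <= k)%N -> forall e, 0 < e -> exists C, forall y, (0 < y)%N ->
  energy k (dilated_poly y (indicator R B) 1) <= C * y%:R `^ (2 * k%:R * beta - 1 + e).

(** The weights f(b) / B(b) satisfy this, and so do their scalings and truncations. The saving
    [delta] below is uniform over the class, so that it can be fixed before the weights are
    modified. *)
Definition weight_family p := [/\ forall b, 0 <= p b,
  forall b, p b != 0 -> (0 < b)%N /\ B b &
  forall e, 0 < e -> exists C, forall b, (0 < b)%N -> p b <= C * b%:R `^ (omega - beta + e)].

(** The exponent [h.-1] is split into nearly equal halves [k1] and [k2], both at least [H] because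
    [h >= 2 * H + 1]. One factor receives the weight by [weight_coefXn], this weight is spread over
    [k1] factors, and Cauchy-Schwarz bounds the coefficient by the energies of the two halves. *)
Lemma coef_top_bound : exists2 delta, 0 < delta & forall p, weight_family p ->
  exists2 C, 0 <= C & forall m, (0 < m)%N ->
  (dilations_poly m p h ^+ h.-1)`_m <= C * m%:R `^ (h%:R * omega - 1 - delta).
Proof.
pose k1 := (h.-1)./2; pose k2 := uphalf h.-1.
have h0 : (0 < h)%N by apply: leq_trans Hh; rewrite addn1.
have H2h : (H.*2 <= h.-1)%N by rewrite -ltnS prednK// -mul2n -[X in (X < _)%N]addn0 (leq_trans _ Hh)// ltn_add2l.
have k1H : (H <= k1)%N by rewrite /k1 -(doubleK H) half_leq.
have k12 : (k1 <= k2)%N by rewrite /k1 /k2 uphalf_half leq_addl.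
have k2H : (H <= k2)%N by exact: leq_trans k12.
have kh1 : (k1 + k2 = h.-1)%N by rewrite /k1 /k2 uphalf_half addnCA addnn odd_double_half.
have kh : ((k1 + k2).+1 = h)%N by rewrite kh1 prednK.
have k2h : (k2.*2 <= h)%N.
  by rewrite /k2 uphalf_half doubleD -[leqRHS]prednK// -{3}(odd_double_half h.-1); case: odd.
have k10 : (0 < k1)%N by exact: leq_trans k1H.
have k20 : (0 < k2)%N by exact: leq_trans k2H.
have /= := exponent_gap k10 k12 kh k2h ho.
set theta := Num.max 0 _; set g1 := Num.max 0 (_ * (_ + _) - 1); set g2 := Num.max 0 (_ - 1).
move=> /= gap.
(* A quarter of the gap: the target is squared, which uses [2 * delta], and each of the two energy
   bounds loses another [delta]. *)
pose delta := (2 * (h%:R * omega - 1) - (- (2 * theta) + g1 + g2)) / 4.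
have delta0 : 0 < delta by rewrite divr_gt0// subr_gt0.
have theta0 : 0 <= theta by rewrite le_max lexx.
exists delta => // p [p0 pB p_le].
pose w i : R := i%:R `^ theta.
pose q b := p b * b%:R `^ theta.
have q0 b : 0 <= q b by rewrite mulr_ge0// powR_ge0.
have qB b : q b != 0 -> (0 < b)%N /\ B b.
  by move=> qb; apply: pB; apply: contraNneq qb => pb; rewrite /q pb mul0r.
have q_le e : 0 < e -> exists C, forall b, (0 < b)%N -> q b <= C * b%:R `^ (omega + theta - beta + e).
  move=> e0; have [C HC] := p_le e e0; exists C => b b0.
  have -> : omega + theta - beta + e = (omega - beta + e) + theta by ring.
  rewrite powRD; last by rewrite pnatr_eq0 (gtn_eqF b0) implybT.
  by rewrite mulrA ler_wpM2r ?powR_ge0// HC.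
have [C1 HC1] := @energy_bound R B beta k1 k10 (B_energy k1H) q _ h q0 qB q_le delta delta0.
have [C2 HC2] := @energy_bound R B beta k2 k20 (B_energy k2H) p _ h p0 pB p_le delta delta0.
have := @weight_coefXn R w (2 `^ theta) h.-2 _ (powR_ge0 _ _) _.
case=> [i|i j|C3 C30 HC3]; [exact: powR_ge0|exact: powR_subadd|].
have h2 : h.-2.+1 = h.-1 by rewrite prednK// -kh1 addn_gt0 k10.
rewrite h2 in HC3.
have C10 : 0 <= C1.
  have := HC1 1%N isT; rewrite powR1 mulr1; apply: le_trans; exact: energy_ge0.
have C20 : 0 <= C2.
  have := HC2 1%N isT; rewrite powR1 mulr1; apply: le_trans; exact: energy_ge0.
pose C4 := h%:R `^ theta; have C40 : 0 <= C4 by exact: powR_ge0.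
exists (C3 * Num.sqrt ((C4 ^+ k1) ^+ 2 * C1 * C2)) => [|m m0].
  by rewrite mulr_ge0// sqrtr_ge0.
have mR0 : 0 < m%:R :> R by rewrite ltr0n.
have mn0 : m%:R != 0 :> R by rewrite gt_eqF.
set V := dilations_poly m p h.
have V0 : nonneg_poly V by exact: nonneg_dilations.
have wV0 : nonneg_poly (weight_poly w V).
  by move=> i; rewrite coef_weight_poly mulr_ge0// powR_ge0.
(* Further factors may be weighted at no cost, since [w i >= 1] for positive [i] and the constant
   coefficient of [V] is 0. *)
have VwV i : V`_i <= (weight_poly w V)`_i.
  rewrite coef_weight_poly; case: i => [|i].
    rewrite (_ : V`_0 = 0) ?mulr0//.
    rewrite /V coef_sum big1// => c _; rewrite coef_dilated// dvdn0 div0n/=.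
    by apply/eqP; apply: contraT => /pB[].
  by rewrite ler_peMl// /w -[leLHS](powRr0 i.+1%:R) ler_powR// ler1n.
have E1 : energy k1 (weight_poly w V) <= (C4 ^+ k1) ^+ 2 * (C1 * m%:R `^ (delta + g1)).
  apply: (@le_trans _ _ (energy k1 (C4 *: dilations_poly m q h))).
    apply: energy_mono => // i; rewrite coef_weight_poly coefZ !coef_sum !mulr_sumr.
    apply: ler_sum => c _; rewrite !coef_dilated//.
    case: ifP => [/andP[/dvdnP[b ->] _]|_]; last by rewrite !mulr0.
    rewrite mulnK// /w /q /C4 natrM powRM//.
    have -> : b%:R `^ theta * c.+1%:R `^ theta * p b =
      c.+1%:R `^ theta * (p b * b%:R `^ theta) by ring.
    by rewrite ler_wpM2r ?mulr_ge0 ?powR_ge0// powR_nat_le.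
  rewrite energyZ ler_wpM2l ?sqr_ge0//; apply: le_trans (HC1 m m0) _.
  rewrite /g1; have -> : omega + theta - beta + beta = omega + theta by ring.
  exact: lexx.
have E2 : energy k2 V <= C2 * m%:R `^ (delta + g2).
  apply: le_trans (HC2 m m0) _.
  rewrite /g2; have -> : omega - beta + beta = omega by ring.
  exact: lexx.
have key : (weight_poly w V * V ^+ h.-2)`_m <=
    Num.sqrt ((C4 ^+ k1) ^+ 2 * C1 * C2) * m%:R `^ (h%:R * omega - 1 - delta + theta).
  apply: (@le_trans _ _ ((weight_poly w V ^+ k1 * V ^+ k2)`_m)).
    have -> : (h.-2 = k1.-1 + k2)%N by rewrite -kh1 -{1}(prednK k10).
    rewrite exprD mulrA -{2}(prednK k10) exprS.
    apply: (coefM_le (m := m)) => //; first exact: nonneg_polyM (nonneg_polyXn _ _).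
      exact: nonneg_polyXn.
    move=> i im; apply: (coefM_le (m := m)) => //; first exact: nonneg_polyXn.
    by move=> j jm; apply: (coefXn_le (m := m)).
  rewrite -[leLHS]ger0_norm; last by apply: nonneg_polyM; exact: nonneg_polyXn.
  rewrite -(@ler_pXn2r _ 2)// ?nnegrE ?mulr_ge0 ?sqrtr_ge0 ?powR_ge0//.
  rewrite real_normK ?num_real//; apply: (le_trans (coefM_sqr_le _ _ _)).
  have nnC : 0 <= (C4 ^+ k1) ^+ 2 * C1 * C2.
    by apply: mulr_ge0 => //; apply: mulr_ge0 => //; exact: sqr_ge0.
  rewrite exprMn sqr_sqrtr//.
  apply: (le_trans (ler_pM (energy_ge0 _ _) (energy_ge0 _ _) E1 E2)).
  rewrite -[(m%:R `^ _) ^+ 2]powR_mulrn ?powR_ge0// -powRrM.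
  have -> : (h%:R * omega - 1 - delta + theta) * 2 = (delta + g1) + (delta + g2).
    by rewrite /delta; field.
  rewrite [in leRHS]powRD ?mn0 ?implybT//.
  by rewrite le_eqVlt; apply/orP; left; apply/eqP; ring.
have := HC3 V m V0; rewrite -(ler_pM2l (powR_gt0 (- theta) mR0)) mulrA -powRD ?mn0 ?implybT//.
rewrite addNr powRr0 mul1r => /le_trans; apply.
rewrite mulrCA -[leRHS]mulrA ler_wpM2l//.
apply: (@le_trans _ _ (m%:R `^ (- theta) * (Num.sqrt ((C4 ^+ k1) ^+ 2 * C1 * C2) *
   m%:R `^ (h%:R * omega - 1 - delta + theta)))).
  by rewrite ler_wpM2l ?powR_ge0.
rewrite mulrCA ler_wpM2l ?sqrtr_ge0// -powRD ?mn0 ?implybT//.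
by rewrite addrC addrK.
Qed.

(** A sum with [j] summands is completed to [h.-1] summands by copies of one fixed [b] with
    [p b > 0]. This multiplies the coefficient by at least a constant, and replaces [m] by some [M]
    between [m] and a constant multiple of [m]. *)
Theorem coef_bound : exists2 delta, 0 < delta & forall p, weight_family p ->
  exists2 C, 0 <= C & forall N j m, (0 < j < h)%N -> (0 < m)%N ->
  (dilations_poly N p h ^+ j)`_m <= C * m%:R `^ (h%:R * omega - 1 - delta).
Proof.
have [delta delta0 top] := coef_top_bound; exists delta => // p pw.
have [p0 pB _] := pw; have [C C0 HC] := top p pw.
set s := h%:R * omega - 1 - delta in HC *.
have [[b pb]|none] := pselect (exists b, p b != 0); last first.
  exists 0 => // N j m /andP[j0 _] m0; rewrite mul0r.
  have -> : dilations_poly N p h = 0.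
    apply/polyP => i; rewrite coef0 coef_sum big1// => c _; rewrite coef_dilated//.
    by case: ifP => // _; apply/eqP; apply: contraT => pi; case: none; exists (i %/ c.+1)%N.
  by rewrite expr0n gtn_eqF//= coef0.
have pbgt : 0 < p b by rewrite lt_def pb p0.
have [b0 _] := pB b pb.
pose D := (h * b).+1; pose e := Num.min 1 (p b).
have e0 : 0 < e by rewrite lt_min ltr01.
exists (C * D%:R `^ `|s| / e ^+ h) => [|N j m /andP[j0 jh] m0].
  by rewrite divr_ge0 ?exprn_ge0 ?mulr_ge0 ?powR_ge0// ltW.
pose r := (h.-1 - j)%N; pose M := (m + r * b)%N.
have jr : (j + r = h.-1)%N by rewrite subnKC// -ltnS prednK// (leq_trans _ jh).
have M0 : (0 < M)%N by rewrite addn_gt0 m0.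
have nn P : nonneg_poly (dilations_poly P p h) by exact: nonneg_dilations.
have h_gt0 : (0 < h)%N by exact: leq_trans jh.
have Vb : p b <= (dilations_poly M p h)`_b \/ (r = 0)%N.
  have [r0|r0] := posnP r; first by right.
  left; have := @dilated_le R M p h 1 b p0.
  rewrite h_gt0 => /(_ isT); apply: le_trans.
  rewrite coef_dilated// dvd1n divn1/= ifT//.
  by rewrite /M (leq_trans (leq_pmull b r0))// leq_addl.
have Vr : e ^+ h <= (dilations_poly M p h ^+ r)`_(r * b).
  apply: (@le_trans _ _ (e ^+ r)).
    apply: ler_wiXn2l; [exact: ltW|by rewrite ge_min lexx|].
    by rewrite /r (leq_trans (leq_subr _ _))// leq_pred.
  case: Vb => [Vb|->]; last by rewrite !expr0 mul0n coef1.
  elim: (r) => [|r' IH]; first by rewrite !expr0 mul0n coef1.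
  rewrite !exprS mulSn coefM (bigD1 (inord b))//= inordK ?ltnS ?leq_addr//.
  rewrite addKn; apply: (@le_trans _ _ ((dilations_poly M p h)`_b * (dilations_poly M p h ^+ r')`_(r' * b))).
    apply: ler_pM => //; rewrite ?exprn_ge0 ?(ltW e0)//.
    by apply: le_trans Vb; rewrite ge_min lexx orbT.
  rewrite lerDl sumr_ge0// => i _; rewrite mulr_ge0 ?nn//; exact: nonneg_polyXn.
rewrite mulrAC ler_pdivlMr ?exprn_gt0//.
apply: (@le_trans _ _ ((dilations_poly M p h ^+ h.-1)`_M)).
  rewrite -jr exprD coefM (bigD1 (inord m))//= inordK ?ltnS ?leq_addr// addKn.
  apply: (@le_trans _ _ ((dilations_poly M p h ^+ j)`_m * (dilations_poly M p h ^+ r)`_(r * b))).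
    apply: ler_pM => //; [exact: nonneg_polyXn|by rewrite exprn_ge0// ltW|].
    apply: (coefXn_le (m := m)) => // i im.
    by apply: dilations_coef_le => //; rewrite (leq_trans im)// leq_addr.
  by rewrite lerDl sumr_ge0// => i _; rewrite mulr_ge0//; exact: nonneg_polyXn.
apply: le_trans (HC M M0) _; rewrite -mulrA ler_wpM2l//.
apply: powR_between => //; rewrite ?leq_addr//.
rewrite /M /D mulSn leq_add2l.
apply: leq_trans (leq_pmulr _ m0); rewrite leq_mul2r.
by rewrite (leq_trans (leq_subr _ _)) ?leq_pred ?orbT.
Qed.
End CoefBound.

Lemma power_bound_all (R : realType) (u : nat -> R) (t C : R) :
  (\forall n \near \oo, u n <= C * n%:R `^ t) ->
  exists2 C', 0 <= C' & forall n, (0 < n)%N -> u n <= C' * n%:R `^ t.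
Proof.
move=> [n0 _ uC].
pose D := \sum_(i < n0) `|u i| * i%:R `^ (- t).
have D0 : 0 <= D by apply: sumr_ge0 => i _; rewrite mulr_ge0// powR_ge0.
exists (`|C| + D) => [|n n_gt0]; first exact: addr_ge0.
have nR0 : n%:R != 0 :> R by rewrite pnatr_eq0 -lt0n.
have [nn0|n0n] := ltnP n n0; last first.
  apply: (le_trans (uC n n0n)); rewrite ler_wpM2r ?powR_ge0//.
  by rewrite (le_trans (ler_norm _))// lerDl.
apply: (@le_trans _ _ (D * n%:R `^ t)); last by rewrite ler_wpM2r ?powR_ge0// lerDr.
rewrite /D (bigD1 (Ordinal nn0))//= mulrDl -mulrA -powRD ?nR0 ?implybT//.
rewrite addNr powRr0 mulr1 (le_trans (ler_norm _))// lerDl mulr_ge0 ?powR_ge0//.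
by apply: sumr_ge0 => i _; rewrite mulr_ge0// powR_ge0.
Qed.

(** * The energy of the base set *)

Section EnergyIndicator.
Variables (R : realType) (B : set nat) (beta : R).

Lemma indicator01 b : 0 <= indicator R B b <= 1.
Proof. by rewrite /indicator ler0n lern1 leq_b1. Qed.

Lemma coef_indicator_le k N n :
  (dilated_poly N (indicator R B) 1 ^+ k)`_n <= (rep_count B k n)%:R.
Proof.
pose M := maxn N n.
have i0 b : 0 <= indicator R B b by case/andP: (indicator01 b).
apply: (@le_trans _ _ ((dilated_poly M (indicator R B) 1 ^+ k)`_n)).
  apply: (coefXn_le (m := n)) => //; first exact: nonneg_dilated.
  move=> i _; rewrite !coef_dilated// dvd1n divn1/=.
  case: ifP => [iN|_]; last by case: ifP.
  by rewrite (leq_trans iN (leq_maxl _ _)).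
have -> : dilated_poly M (indicator R B) 1 ^+ k = \prod_(i < k) dilated_poly M (indicator R B) 1.
  by rewrite prodr_const card_ord.
rewrite dilated_poly1E (sum_tuples_widen (fun y => \prod_i indicator R B (y i))) ?leq_maxr//.
rewrite /rep_count -sum1_card natr_sum [leLHS]big_mkcond [leRHS]big_mkcond/=.
apply: ler_sum => y _; rewrite inE; case: eqP => _; last by case: ifP; rewrite ?ler01.
rewrite andbT; case: ifPn => [_|/forallPn[i yi]].
  by apply: prodr_ile1 => i _; exact: indicator01.
by rewrite (bigD1 i)//= /indicator (negbTE yi) andbF mul0r.
Qed.

Hypotheses (B_potter : potter (fun x : R => (counting_fun B x)%:R) beta)
  (B_pos : exists2 b, (0 < b)%N & B b).

Lemma counting_pos_eventually : exists n1, forall n, (n1 <= n)%N ->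
  0 < (counting_fun B (n%:R : R))%:R :> R.
Proof.
have [b b0 Bb] := B_pos; exists b => n bn; rewrite ltr0n.
by apply: counting_fun_gt0 b0 Bb _; rewrite ler_nat.
Qed.

(** The [k]-th power has degree at most [k * y] and coefficients at most [rep_count B k], so (ii) at
    [k * y] bounds its energy. The exponent [e] absorbs x^o(1) and the Potter error in B(x). *)
Lemma energy_indicator H k e : low_additive_energy R B H -> (H <= k)%N -> (0 < k)%N -> 0 < e ->
  exists C, forall y, (0 < y)%N ->
  energy k (dilated_poly y (indicator R B) 1) <= C * y%:R `^ (2 * k%:R * beta - 1 + e).
Proof.
move=> BE Hk k0 e0; have [eps eps0 /eqO_exP[K /= K0 BO]] := BE k Hk.
set t := 2 * k%:R * beta - 1 + e.
have kR0 : 0 < k%:R :> R by rewrite ltr0n.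
have e1 : 0 < e / (4 * k%:R) by rewrite divr_gt0// mulr_gt0.
have [CB CB0 HB] := potter_upper B_potter counting_pos_eventually e1.
pose S n : R := \sum_(0 <= i < n.+1) (rep_count B k i)%:R ^+ 2.
have [|C C0 HC] := @power_bound_all R S t (K * CB ^+ (2 * k)).
  have epse : \forall x \near +oo, eps x <= e / 2.
    have /cvgrPdist_le/(_ (e / 2)) : eps x @[x --> +oo] --> (0 : R) by [].
    rewrite divr_gt0// => /(_ isT); apply: filterS => x; rewrite sub0r normrN.
    by apply: le_trans; exact: ler_norm.
  have [M [_ HM]] := filterI BO epse.
  exists (Num.truncn M).+2 => // n /= Mn.
  have n0 : (0 < n)%N by exact: leq_trans Mn.
  have Mn' : M < n%:R by apply: (lt_le_trans (truncnS_gt _)); rewrite ler_nat ltnW.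
  have [/= O1 O2] := HM _ Mn'.
  have nR1 : 1 <= n%:R :> R by rewrite ler1n.
  have nRn : n%:R != 0 :> R by rewrite pnatr_eq0 -lt0n.
  have S0 : 0 <= S n by apply: sumr_ge0 => i _; exact: sqr_ge0.
  rewrite natrK -/(S n) (ger0_norm S0) in O1.
  apply: (le_trans O1); rewrite -[leRHS]mulrA; apply: ler_wpM2l; first exact: ltW.
  rewrite ger0_norm ?mulr_ge0 ?powR_ge0 ?invr_ge0 ?exprn_ge0//.
  apply: (@le_trans _ _ ((CB * n%:R `^ (beta + e / (4 * k%:R))) ^+ (2 * k) / n%:R * n%:R `^ (e / 2))).
    apply: ler_pM; rewrite ?powR_ge0 ?divr_ge0 ?exprn_ge0//; last by rewrite ler_powR.
    by rewrite ler_wpM2r ?invr_ge0// lerXn2r ?nnegrE ?HB// mulr_ge0 ?powR_ge0// ltW.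
  rewrite exprMn -2!mulrA ler_wpM2l ?exprn_ge0 ?(ltW CB0)//.
  rewrite -powR_mulrn ?powR_ge0// -powRrM -[n%:R^-1]powR_inv1// -!powRD ?nRn ?implybT//.
  rewrite /t natrM; set z := _ + (_ + _); have -> : z = 2 * k%:R * beta - 1 + e.
    by rewrite /z; field; rewrite gt_eqF.
  exact: lexx.
exists (C * k%:R `^ `|t|) => y y0; rewrite /energy.
have sz : (size (dilated_poly y (indicator R B) 1 ^+ k)%R <= (k * y).+1)%N.
  apply: leq_trans (size_poly_exp_leq _ _) _; rewrite ltnS mulnC leq_mul2l; apply/orP; right.
  have : (size (dilated_poly y (indicator R B) 1) <= y.+1)%N.
    apply/leq_sizeP => j yj; rewrite coef_dilated// dvd1n divn1/=.
    by rewrite leqNgt yj.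
  by case: (size _).
rewrite (poly_dotE _ sz).
apply: (@le_trans _ _ (S (k * y)%N)).
  rewrite /S big_mkord; apply: ler_sum => i _; rewrite -expr2.
  rewrite lerXn2r ?nnegrE// ?coef_indicator_le//.
  by apply: nonneg_polyXn; apply: nonneg_dilated => b; case/andP: (indicator01 b).
apply: (le_trans (HC _ _)); first by rewrite muln_gt0 k0.
rewrite -mulrA ler_wpM2l// powR_between// ?leq_pmull//.
Qed.
End EnergyIndicator.

(** * The weights f(b) / B(b) *)

Section Powers.
Variable R : realType.

Lemma nat_powR_dominates (a D : R) : 0 < a -> \forall n \near \oo, D <= n%:R `^ a.
Proof.
move=> a0; pose E := Num.max 1 D; exists (Num.truncn (E `^ a^-1)).+1 => // n /= En.
have E1 : 1 <= E by rewrite le_max lexx.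
have E0 : 0 <= E := le_trans ler01 E1.
apply: (@le_trans _ _ E); first by rewrite le_max lexx orbT.
rewrite -[E]powRr1// -[X in E `^ X](mulVf (lt0r_neq0 a0)) powRrM.
rewrite ge0_ler_powR ?nnegrE ?powR_ge0 ?(ltW a0)//.
by apply/ltW/(lt_le_trans (truncnS_gt _)); rewrite ler_nat.
Qed.

Lemma ln_nat_le (a : R) n : 0 < a -> (0 < n)%N -> ln n%:R <= a^-1 * n%:R `^ a.
Proof.
move=> a0 n0; have P0 : 0 < n%:R `^ a :> R by rewrite powR_gt0// ltr0n.
have := ltW (ln_sublinear P0).
by rewrite ln_powR -ler_pdivlMl.
Qed.

Lemma slowly_varying_root h (F : R -> R) kappa : (0 < h)%N -> regularly_varying F ->
  (forall lambda, 0 < lambda -> F (lambda * x) / F x @[x --> +oo] --> lambda `^ kappa) ->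
  slowly_varying (fun x => root_weight h F x * x `^ (- ((kappa + 1) / h%:R))).
Proof.
move=> h0 [[Fpos mF] _] Flim; split; first split.
- by move=> x x0; rewrite mulr_gt0// powR_gt0// mulr_gt0// Fpos.
- apply: measurable_funM; last by apply: measurable_funTS; exact: measurable_powR.
  have mxF : measurable_fun (`]0, +oo[%classic : set R) (fun x : R => x * F x).
    by apply: measurable_funM.
  rewrite (_ : root_weight h F = (fun y : R => y `^ h%:R^-1) \o (fun x : R => x * F x))//.
  exact: (measurableT_comp (measurable_powR h%:R^-1) mxF).
move=> lambda l0.
have hR0 : 0 < h%:R :> R by rewrite ltr0n.
set om := (kappa + 1) / h%:R.
pose r : R := h%:R^-1.
have c0 : 0 < lambda * lambda `^ kappa by rewrite mulr_gt0// powR_gt0.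
have pw y : 0 < y -> expR (r * ln y) = y `^ r by move=> y0; rewrite /powR gt_eqF.
have lim1 : expR (r * ln (lambda * (F (lambda * x) / F x))) * lambda `^ (- om) @[x --> +oo]
    --> (1 : R).
  have -> : (1 : R) = expR (r * ln (lambda * lambda `^ kappa)) * lambda `^ (- om).
    rewrite (pw _ c0) -[X in X * lambda `^ kappa]powRr1 ?ltW// -powRD ?(gt_eqF l0) ?implybT//.
    rewrite -powRrM -powRD ?(gt_eqF l0) ?implybT// /om.
    by rewrite [1 + kappa]addrC subrr powRr0.
  apply: cvgM; last exact: cvg_cst.
  apply: (@continuous_cvg _ _ _ _ _ _ (fun y : R => expR (r * ln y))).
    apply: (@continuous_comp _ _ _ (fun y : R => r * ln y) expR); last exact: continuous_expR.
    by apply: continuousM; [exact: cst_continuous|exact: continuous_ln].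
  by apply: cvgM; [exact: cvg_cst|exact: Flim].
apply: cvg_trans lim1; apply: near_eq_cvg; exists 0; split => // x x0.
have lx0 : 0 < lambda * x by rewrite mulr_gt0.
have Fx0 := Fpos x x0; have Flx0 := Fpos _ lx0.
rewrite /root_weight -/r pw ?mulr_gt0 ?invr_gt0//.
have VF : (F x)^-1 `^ r = (F x `^ r)^-1.
  apply: (mulIf (lt0r_neq0 (powR_gt0 r Fx0))).
  rewrite mulVf ?lt0r_neq0 ?powR_gt0// -powRM ?invr_ge0 ?ltW//.
  by rewrite mulVf ?lt0r_neq0// powR1.
rewrite !powRM ?mulr_ge0 ?invr_ge0 ?(ltW l0) ?(ltW x0) ?(ltW Fx0) ?(ltW Flx0)// VF.
by field; rewrite !lt0r_neq0 ?powR_gt0.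
Qed.
End Powers.

(** The successor on the right makes room for the element 0, which [counting_fun] omits. *)
Lemma sum_rep_count_le (R : realType) (B : set nat) h M :
  (\sum_(m < M.+1) rep_count B h m <= (counting_fun B (M%:R : R)).+1 ^ h)%N.
Proof.
pose A := restrict B M.
have -> : (\sum_(m < M.+1) rep_count B h m = \sum_(m < M.+1) #|reps h m A|)%N.
  by apply: eq_bigr => m _; rewrite (@rep_countE M)// -ltnS.
apply: (@leq_trans (#|A| ^ h)%N).
  have -> : (#|A| ^ h = #|(ffun_on A : {pred {ffun 'I_h -> 'I_M.+1}})|)%N by rewrite card_ffun_on card_ord.
  rewrite -[leqRHS]sum1_card.
  under [leqLHS]eq_bigr do rewrite -sum1_card big_mkcond/=.
  rewrite exchange_big/= [leqRHS]big_mkcond/=; apply: leq_sum => y _.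
  case: ifPn => [yA|yA].
    have [ym|ym] := leqP (\sum_i (y i : nat)) M; last first.
      rewrite big1// => m _; rewrite !inE; case: eqP => // e.
      by move: ym; rewrite e ltnNge -ltnS ltn_ord.
    rewrite (bigD1 (inord (\sum_i (y i : nat))))//=.
    rewrite [X in (_ + X <= _)%N]big1 => [|m mn]; first by rewrite addn0; case: ifP.
    rewrite !inE; case: eqP => // e; move: mn.
    by rewrite -val_eqE/= inordK// e eqxx.
  rewrite big1// => m _; rewrite !inE; case: ifP => // /andP[_ /fintype.subsetP yv].
  by move: yA; case/negP; apply/ffun_onP => i; apply: yv; apply/imsetP; exists i.
have -> : (#|A| = \sum_(k < M.+1) ((k : nat) \in B))%N.
  by rewrite -sum1_card big_mkcond; apply: eq_bigr => k _; rewrite inE; case: ifP.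
have lA : (\sum_(k < M.+1) ((k : nat) \in B) <= (counting_fun B (M%:R : R)).+1)%N.
  rewrite counting_fun_natE 2!big_ord_recl/= add0n.
  rewrite -[leqRHS]add1n leq_add ?leq_b1//.
by case: h => [//|h']; rewrite leq_exp2r.
Qed.

Section WeightedSums.
Variables (R : realType).
Implicit Types (q : nat -> R).

Definition wsum h q n : R := (dilated_poly n q 1 ^+ h)`_n.

Lemma dilated_prodE h q N n :
  (dilated_poly N q 1 ^+ h)`_n =
  \sum_(y : {ffun 'I_h -> 'I_N.+1} | (\sum_i (y i : nat) == n)%N) \prod_i q (y i).
Proof. by rewrite -dilated_poly1E prodr_const card_ord. Qed.

Lemma wsumE h q N n : (n <= N)%N -> (dilated_poly N q 1 ^+ h)`_n = wsum h q n.
Proof.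
move=> nN; rewrite /wsum !dilated_prodE.
by rewrite (sum_tuples_widen (fun y => \prod_i q (y i))).
Qed.

(** The weight g of condition (iii), extended by 0 off the positive elements of [B]. *)
Definition ratio_weight (B : set nat) h (F : R -> R) b : R :=
  root_weight h F b%:R / (counting_fun B (b%:R : R))%:R * indicator R B b.

Lemma weighted_repE B h F n :
  weighted_rep B h (root_weight h F) n = wsum h (ratio_weight B h F) n.
Proof.
rewrite /wsum dilated_prodE /weighted_rep /ratio_weight.
rewrite [LHS]big_mkcond [RHS]big_mkcond/=; apply: eq_bigr => y _.
rewrite inE andbC; case: (_ == _) => //=; case: forallP => [yB|yB].
  apply: eq_bigr => i _; rewrite /indicator yB andbT; case: posnP => [->|_].
    rewrite counting_fun_natE big_ord_recl big_ord0 /=.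
    by rewrite invr0 mulr0 mul0r.
  by rewrite mulr1.
have [i yi] : exists i, ~~ ((y i : nat) \in B).
  by apply/existsP; rewrite -negb_forall; apply/negP => /forallP.
by rewrite (bigD1 i)//= /indicator (negbTE yi) andbF mulr0 mul0r.
Qed.
End WeightedSums.

Section Weights.
Variables (R : realType) (B : set nat) (beta : R) (h : nat) (F : R -> R) (kappa : R).
Local Notation Bc := (fun x : R => (counting_fun B x)%:R : R).
Hypotheses (h0 : (0 < h)%N) (B_potter : potter Bc beta)
  (B_pos : exists2 b, (0 < b)%N & B b) (Fpos : forall x, 0 < x -> 0 < F x)
  (F_potter : potter F kappa).

Definition omega : R := (kappa + 1) / h%:R.
Local Notation gB := (ratio_weight B h F).

Let hR0 : 0 < h%:R :> R. Proof. by rewrite ltr0n. Qed.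

Let F_pos_nat : exists n1, forall n, (n1 <= n)%N -> 0 < F n%:R.
Proof. by exists 1%N => n n0; apply: Fpos; rewrite ltr0n. Qed.

Lemma root_weight_expr n : (0 < n)%N -> root_weight h F n%:R ^+ h = n%:R * F n%:R.
Proof.
move=> n0; have nF : 0 <= n%:R * F n%:R by rewrite mulr_ge0// ltW// Fpos// ltr0n.
by rewrite -powR_mulrn ?powR_ge0// -powRrM mulVf ?gt_eqF// powRr1.
Qed.

Lemma ratio_weight_ge0 b : 0 <= gB b.
Proof.
by rewrite /ratio_weight mulr_ge0// divr_ge0// powR_ge0.
Qed.

Lemma ratio_weight_support b : gB b != 0 -> (0 < b)%N /\ B b.
Proof.
rewrite /ratio_weight /indicator; case: posnP => [|b0]; first by rewrite mulr0 eqxx.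
case: (boolP (b \in B)) => [|_]; last by rewrite mulr0 eqxx.
by rewrite inE.
Qed.

Lemma F_lower e : 0 < e -> exists2 c, 0 < c & forall n, (0 < n)%N -> c * n%:R `^ (kappa - e) <= F n%:R.
Proof.
move=> e0; have [|c c0 Hc] := potter_lower F_potter _ F_pos_nat e0.
  by move=> x /Fpos/ltW.
by exists c => // n n0; apply: Hc => //; rewrite Fpos// ltr0n.
Qed.

Lemma B_lower e : 0 < e -> exists2 c, 0 < c & forall b, (0 < b)%N -> B b ->
  c * b%:R `^ (beta - e) <= Bc b%:R.
Proof.
move=> e0; have [|c c0 Hc] := potter_lower B_potter _ (counting_pos_eventually R B_pos) e0.
  by move=> x _; exact: ler0n.
by exists c => // b b0 Bb; apply: Hc => //; rewrite ltr0n (counting_fun_gt0 b0 Bb).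
Qed.

Lemma ratio_weight_le e : 0 < e -> exists C, forall b, (0 < b)%N ->
  gB b <= C * b%:R `^ (omega - beta + e).
Proof.
move=> e0.
have e1 : 0 < h%:R * (e / 2) by rewrite mulr_gt0// divr_gt0.
have e2 : 0 < e / 2 by rewrite divr_gt0.
have [CF CF0 HF] := potter_upper F_potter F_pos_nat e1.
have [cB cB0 HB] := B_lower e2.
have C0 : 0 <= CF `^ h%:R^-1 / cB by rewrite divr_ge0 ?powR_ge0// ltW.
exists (CF `^ h%:R^-1 / cB) => b b0.
have rhs0 : 0 <= CF `^ h%:R^-1 / cB * b%:R `^ (omega - beta + e) by rewrite mulr_ge0 ?powR_ge0.
have [->//|gb] := eqVneq (gB b) 0.
have [_ Bb] := ratio_weight_support gb.
have bR0 : 0 < b%:R :> R by rewrite ltr0n.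
have bRn : b%:R != 0 :> R by rewrite gt_eqF.
rewrite /ratio_weight /indicator b0 (mem_set Bb) mulr1.
have P0 : 0 < cB * b%:R `^ (beta - e / 2) by rewrite mulr_gt0// powR_gt0.
have B0 : 0 < Bc b%:R := lt_le_trans P0 (HB b b0 Bb).
have Fb := HF b b0.
have fb : root_weight h F b%:R <= CF `^ h%:R^-1 * b%:R `^ (omega + e / 2).
  rewrite /root_weight.
  have -> : omega + e / 2 = (kappa + h%:R * (e / 2) + 1) * h%:R^-1.
    by rewrite /omega; field; rewrite gt_eqF.
  rewrite [in leRHS]powRrM -powRM ?powR_ge0 ?(ltW CF0)//.
  rewrite ge0_ler_powR ?invr_ge0 ?nnegrE ?mulr_ge0 ?powR_ge0 ?(ltW CF0) ?(ltW (Fpos _))//.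
  rewrite powRD ?bRn ?implybT// powRr1 ?(ltW bR0)// mulrA mulrC.
  by rewrite ler_wpM2r// ltW.
rewrite ler_pdivrMr//; apply: (le_trans fb).
apply: (@le_trans _ _ (CF `^ h%:R^-1 / cB * b%:R `^ (omega - beta + e) * (cB * b%:R `^ (beta - e / 2)))).
  have -> : omega + e / 2 = (omega - beta + e) + (beta - e / 2) by field.
  rewrite [in leLHS]powRD ?bRn ?implybT//.
  by rewrite le_eqVlt; apply/orP; left; apply/eqP; field; rewrite gt_eqF.
by rewrite ler_wpM2l// HB.
Qed.

Section Bounded.
Hypothesis F_le : asymp_le \oo (fun n => F n%:R) (fun n => (rep_count B h n)%:R).

Lemma rep_count_lower : \forall n \near \oo, F n%:R <= 2 * (rep_count B h n)%:R.
Proof.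
have [e elim Fe] := F_le.
have /cvgrPdist_le/(_ 1 ltr01) e1 := elim.
apply: filterS2 Fe e1 => n Fn; rewrite sub0r normrN => en.
apply: (le_trans Fn); rewrite ler_wpM2r//.
by have := le_trans (ler_norm _) en; lra.
Qed.

(* Compare [sum_(n <= m < 2n) F m >> n F n] with the number of [h]-tuples of
   elements of [B] up to [2n]. *)
Lemma root_weight_le_counting : exists2 C, 0 <= C &
  \forall n \near \oo, root_weight h F n%:R <= C * Bc n%:R.
Proof.
pose D : R := ln 2; have D0 : 0 <= D by rewrite ln_ge0// ler1n.
have [X X1 HX] := F_potter ltr01; have [Y Y1 HY] := B_potter ltr01.
have [n2 Hn2] := counting_pos_eventually R B_pos.
have [n3 _ Hn3] := rep_count_lower.
pose n0 := maxn (maxn n2 n3) (maxn (Num.truncn X).+1 (Num.truncn Y).+1).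
pose c1 := expR (- (`|kappa| * D + D + 1)).
pose c2 := expR (`|beta| * D + D + 1).
have c10 : 0 < c1 by exact: expR_gt0.
have c20 : 0 < c2 by exact: expR_gt0.
pose C3 := 2 * (2 * c2) ^+ h / c1.
have C30 : 0 <= C3 by rewrite divr_ge0 ?mulr_ge0 ?exprn_ge0 ?ltW// mulr_gt0.
exists (C3 `^ h%:R^-1); first exact: powR_ge0.
exists n0 => // n /= n0n.
have [n2n n3n] : (n2 <= n)%N /\ (n3 <= n)%N.
  by split; apply: leq_trans n0n; rewrite !leq_max leqnn ?orbT.
have Xn : X <= n%:R.
  apply/ltW/(lt_le_trans (truncnS_gt _)); rewrite ler_nat; apply: leq_trans n0n.
  by rewrite !leq_max leqnn ?orbT.
have Yn : Y <= n%:R.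
  apply/ltW/(lt_le_trans (truncnS_gt _)); rewrite ler_nat; apply: leq_trans n0n.
  by rewrite !leq_max leqnn ?orbT.
have n_gt0 : (0 < n)%N by rewrite -(ltr0n R); apply: lt_le_trans Xn; apply: lt_le_trans X1.
have nR0 : 0 < n%:R :> R by rewrite ltr0n.
have lnm m : (n <= m)%N -> (m <= 2 * n)%N -> 0 <= ln (m%:R : R) - ln (n%:R : R) <= D.
  move=> nm m2n; have m0 : 0 < m%:R :> R by rewrite ltr0n (leq_trans n_gt0).
  have nmR : n%:R <= m%:R :> R by rewrite ler_nat.
  have m2nR : m%:R <= 2 * n%:R :> R by rewrite -natrM ler_nat.
  have twon : 0 < 2 * n%:R :> R by rewrite mulr_gt0.
  apply/andP; split; first by rewrite subr_ge0; rewrite ler_ln; [exact: nmR|rewrite posrE; exact: nR0|rewrite posrE; exact: m0].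
  rewrite lerBlDr; apply: (@le_trans _ _ (ln (2 * n%:R))).
    by rewrite ler_ln; [exact: m2nR|rewrite posrE; exact: m0|rewrite posrE; exact: twon].
  by rewrite lnM ?posrE.
have Fm m : (n <= m)%N -> (m <= 2 * n)%N -> c1 * F n%:R <= F m%:R.
  move=> nm m2n; have /andP[l1 l2] := lnm m nm m2n.
  have m0 : 0 < m%:R :> R by rewrite ltr0n (leq_trans n_gt0).
  have nmR : n%:R <= m%:R :> R by rewrite ler_nat.
  have H1 := HX n%:R m%:R Xn nmR.
  rewrite -normrN in H1; have {}H1 := le_trans (ler_norm _) H1.
  have Fn0 := Fpos nR0; have Fm0 := Fpos m0.
  rewrite -[F n%:R]lnK ?posrE// -[leRHS]lnK ?posrE// /c1 -expRD ler_expR.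
  move: H1; set a := ln (F n%:R); set b := ln (F m%:R); set d := ln m%:R - ln n%:R in l1 l2 *.
  have k1 : - (`|kappa| * D) <= kappa * d.
    have h1 : `|kappa| * d <= `|kappa| * D by rewrite ler_wpM2l.
    have h2 : - `|kappa| * d <= kappa * d by rewrite ler_wpM2r// lerNl (le_trans (ler_norm _))// normrN.
    by lra.
  by clearbody a b d D; lra.
have Bn : Bc (2 * n)%N%:R <= c2 * Bc n%:R.
  have n2n' : (n <= 2 * n)%N by rewrite leq_pmull.
  have /andP[l1 l2] := lnm _ n2n' (leqnn _).
  have n2nR : n%:R <= (2 * n)%N%:R :> R by rewrite ler_nat.
  have /(le_trans (ler_norm _)) := HY n%:R (2 * n)%N%:R Yn n2nR.
  have B1 := Hn2 _ n2n; have B2 := Hn2 _ (leq_trans n2n n2n').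
  move=> /= H1; rewrite -[leLHS]lnK ?posrE// -[X in c2 * X]lnK ?posrE// /c2 -expRD ler_expR.
  move: H1; set a := ln _; set b := ln _; set d := ln (2 * n)%N%:R - ln n%:R in l1 l2 *.
  have k1 : beta * d <= `|beta| * D.
    have h1 : `|beta| * d <= `|beta| * D by rewrite ler_wpM2l.
    have h2 : beta * d <= `|beta| * d by rewrite ler_wpM2r// ler_norm.
    by lra.
  by clearbody a b d D; lra.
have sumF : n%:R * (c1 * F n%:R) <= 2 * (2 * c2 * Bc n%:R) ^+ h.
  apply: (@le_trans _ _ (\sum_(n <= m < 2 * n) F m%:R)).
    have -> : n%:R * (c1 * F n%:R) = \sum_(n <= m < 2 * n) (c1 * F n%:R).
      by rewrite sumr_const_nat mul2n -addnn addnK mulr_natl.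
    rewrite !big_seq; apply: ler_sum => m; rewrite mem_index_iota => /andP[nm m2n].
    by apply: Fm => //; exact: ltnW.
  apply: (@le_trans _ _ (\sum_(n <= m < 2 * n) 2 * (rep_count B h m)%:R)).
    rewrite !big_seq; apply: ler_sum => m; rewrite mem_index_iota => /andP[nm m2n].
    by apply: Hn3 => /=; exact: leq_trans nm.
  rewrite -mulr_sumr ler_wpM2l//.
  apply: (@le_trans _ _ ((\sum_(m < (2 * n).+1) rep_count B h m)%N%:R)).
    rewrite natr_sum -(big_mkord xpredT (fun m => (rep_count B h m)%:R : R)).
    have nn : (n <= (2 * n).+1)%N by rewrite ltnW// ltnS leq_pmull.
    rewrite [leRHS](@big_cat_nat _ _ _ n)//=.
    rewrite [X in _ <= _ + X]big_nat_recr ?leq_pmull//=.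
    by rewrite addrCA lerDl addr_ge0// sumr_ge0.
  apply: (@le_trans _ _ (((counting_fun B ((2 * n)%N%:R : R)).+1 ^ h)%N%:R)).
    by rewrite ler_nat sum_rep_count_le.
  rewrite natrX lerXn2r ?nnegrE ?mulr_ge0 ?(ltW c20)//.
  rewrite -natr1 -mulrA; apply: (@le_trans _ _ (2 * Bc (2 * n)%N%:R)).
    have : 1 <= Bc (2 * n)%N%:R.
      by rewrite ler1n -(ltr0n R); apply: Hn2; rewrite (leq_trans n2n)// leq_pmull.
    by lra.
  by rewrite ler_wpM2l.
have sumF' : n%:R * F n%:R <= C3 * Bc n%:R ^+ h.
  rewrite /C3 mulrAC ler_pdivlMr// -mulrA [F n%:R * c1]mulrC.
  have -> : 2 * (2 * c2) ^+ h * Bc n%:R ^+ h = 2 * (2 * c2 * Bc n%:R) ^+ h.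
    by rewrite [(2 * c2 * _) ^+ h]exprMn mulrA.
  exact: sumF.
rewrite /root_weight.
have -> : Bc n%:R = (Bc n%:R ^+ h) `^ h%:R^-1.
  by rewrite -powR_mulrn// -powRrM divff ?gt_eqF// powRr1.
rewrite -powRM// ?exprn_ge0// ge0_ler_powR ?invr_ge0 ?nnegrE//.
  by rewrite mulr_ge0// ltW// Fpos.
by rewrite mulr_ge0// exprn_ge0.
Qed.

Lemma ratio_weight_bounded : exists2 G, 0 < G & forall b, gB b <= G.
Proof.
have [C C0 [n1 _ main]] := root_weight_le_counting.
have [n2 Hn2] := counting_pos_eventually R B_pos.
pose n0 := maxn n1 n2.
have S0 : 0 <= \sum_(i < n0) gB i by apply: sumr_ge0 => i _; exact: ratio_weight_ge0.
exists (C + \sum_(i < n0) gB i + 1) => [|b]; first by rewrite ltr_wpDl// addr_ge0.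
have [bn0|n0b] := ltnP b n0.
  rewrite (bigD1 (Ordinal bn0))//=.
  have : 0 <= \sum_(i < n0 | i != Ordinal bn0) gB i by apply: sumr_ge0 => i _; exact: ratio_weight_ge0.
  by lra.
apply: (@le_trans _ _ C); last by lra.
move: n0b; rewrite geq_max => /andP[n1b n2b].
apply: (@le_trans _ _ (root_weight h F b%:R / Bc b%:R)).
  rewrite /ratio_weight ler_piMr//; last by case/andP: (indicator01 R B b).
  by rewrite divr_ge0// powR_ge0.
by rewrite ler_pdivrMr; [exact: main|exact: Hn2].
Qed.

Lemma root_weight_lower e : 0 < e -> exists2 c, 0 < c & forall n, (0 < n)%N ->
  c * n%:R `^ (omega - e) <= root_weight h F n%:R.
Proof.
move=> e0; have e1 : 0 < h%:R * e by rewrite mulr_gt0.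
have [c c0 Hc] := F_lower e1.
exists (c `^ h%:R^-1) => [|n n0]; first exact: powR_gt0.
have nR0 : 0 < n%:R :> R by rewrite ltr0n.
have nRn : n%:R != 0 :> R by rewrite gt_eqF.
rewrite /root_weight.
have -> : omega - e = (kappa - h%:R * e + 1) * h%:R^-1.
  by rewrite /omega; field; rewrite gt_eqF.
rewrite [in leLHS]powRrM -powRM ?powR_ge0 ?(ltW c0)//.
rewrite ge0_ler_powR ?invr_ge0 ?nnegrE ?mulr_ge0 ?powR_ge0 ?(ltW c0) ?(ltW (Fpos _))//.
rewrite powRD ?nRn ?implybT// powRr1 ?(ltW nR0)// mulrA [leRHS]mulrC.
by rewrite ler_wpM2r ?(ltW nR0)// Hc.
Qed.

(** Indices are compared in f = O(B), which follows from F <= (1 + o(1)) r_B; so the upper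
    restriction on the index in (iii) is automatic. *)
Lemma omega_le_beta : omega <= beta.
Proof.
rewrite leNgt; apply/negP => bo.
pose e := (omega - beta) / 3; have e0 : 0 < e by rewrite divr_gt0// subr_gt0.
have [c c0 Hc] := root_weight_lower e0.
have [C C0 HC] := root_weight_le_counting.
have [D D0 HD] := potter_upper B_potter (counting_pos_eventually R B_pos) e0.
have near_gt := @nat_powR_dominates R e (C * D / c + 1) e0.
have near0 : \forall n \near \oo, (0 < n)%N by exists 1%N.
have [N _ /(_ N (leqnn N)) [/= [h1 h2] N0]] := filterI (filterI HC near_gt) near0.
have NR0 : 0 < N%:R :> R by rewrite ltr0n.
have NRn : N%:R != 0 :> R by rewrite gt_eqF.
have := le_trans (Hc N N0) h1.
have P0 : 0 < N%:R `^ (beta + e) :> R by rewrite powR_gt0.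
have -> : omega - e = e + (beta + e) by rewrite /e; field.
rewrite powRD ?NRn ?implybT// => h3.
have : c * N%:R `^ e * N%:R `^ (beta + e) <= C * D * N%:R `^ (beta + e).
  by rewrite -[leLHS]mulrA (le_trans h3)// -mulrA ler_wpM2l// HD.
rewrite ler_pM2r// mulrC -ler_pdivlMr// => h4.
by have := le_trans h2 h4; lra.
Qed.
End Bounded.
End Weights.

(** * Realizing weights by subsets *)

Section Truncation.
Variable R : realType.
Implicit Types (p q : nat -> R).

Lemma tuple_sum_mono N p q k m : (forall b, 0 <= p b <= q b) ->
  tuple_sum N p k m <= tuple_sum N q k m.
Proof.
move=> pq; apply: ler_sum => y _; apply: ler_prod => b _; exact: pq.
Qed.

Definition drop_small (m0 : nat) p b : R := if (b < m0)%N then 0 else p b.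

Lemma powR_minus_le (s : R) n b : (b.*2 <= n)%N -> (0 < n)%N ->
  (n - b)%:R `^ s <= 2 `^ `|s| * n%:R `^ s.
Proof.
move=> bn n0.
have nb0 : (0 < n - b)%N.
  rewrite subn_gt0; case: b bn => // b; apply: leq_trans.
  by rewrite -addnn -addn1 leq_add2l.
have /= := @powR_between R n (n - b) (- s) nb0 (leq_subr _ _) 2.
rewrite mulnBr mul2n -addnn mul2n => /(_ _)/= H.
have {}H : n%:R `^ (- s) <= 2 `^ `|s| * (n - b)%:R `^ (- s).
  by rewrite -normrN; apply: H; rewrite -addnBA ?leq_addr.
have A0 : 0 < (n - b)%:R `^ s :> R by rewrite powR_gt0// ltr0n.
have B0 : 0 < n%:R `^ s :> R by rewrite powR_gt0// ltr0n.
move: H; rewrite !powRN -(ler_pM2r B0) mulVf ?gt_eqF// -(ler_pM2r A0) mul1r.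
by move=> /le_trans; apply; rewrite mulrAC mulfVK ?gt_eqF.
Qed.

(** The difference of the [h]-th powers has the factor [P - P'], supported below [m0]. Only
    coefficients of [(h.-1)]-fold products at arguments in [n/2, n] remain, where powers are
    comparable even for negative [s]. *)
Lemma wsum_drop_small h m0 p C K s : (0 < h)%N -> (forall b, 0 <= p b <= K) -> 0 <= C ->
  (forall N m, (0 < m)%N -> (dilated_poly N p 1 ^+ h.-1)`_m <= C * m%:R `^ s) ->
  forall n, (m0.*2 <= n)%N -> (0 < n)%N ->
  wsum h p n <= wsum h (drop_small m0 p) n + (h * m0)%:R * K * C * 2 `^ `|s| * n%:R `^ s.
Proof.
move=> h0 p01 C0 PC n mn n0; have p0 b : 0 <= p b by case/andP: (p01 b).
have K0 : 0 <= K by case/andP: (p01 0%N) => a /(le_trans a).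
pose p' := drop_small m0 p; pose ps b := if (b < m0)%N then p b else 0.
have p'p b : 0 <= p' b <= p b by rewrite /p' /drop_small; case: ifP; rewrite ?lexx p0.
have p'0 b : 0 <= p' b by case/andP: (p'p b).
have ps0 b : 0 <= ps b by rewrite /ps; case: ifP.
set P := dilated_poly n p 1; set P' := dilated_poly n p' 1; set Ps := dilated_poly n ps 1.
have PE : P - P' = Ps.
  apply/polyP => i; rewrite coefB !coef_dilated// /p' /drop_small /ps.
  by case: ifP => _; rewrite ?subr0//; case: ifP; rewrite ?subr0 ?subrr.
have P0 : nonneg_poly P by exact: nonneg_dilated.
have P'0 : nonneg_poly P' by exact: nonneg_dilated.
have Ps0 : nonneg_poly Ps by exact: nonneg_dilated.
have P'P i : P'`_i <= P`_i.
  by rewrite !coef_dilated//; case: ifP => // _; case/andP: (p'p (i %/ 1)%N).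
have step j : (\sum_(i < h) P ^+ (h.-1 - i) * P' ^+ i)`_j <= h%:R * (P ^+ h.-1)`_j.
  rewrite coef_sum -[X in X%:R * _]card_ord -sum1_card natr_sum mulr_suml.
  apply: ler_sum => i _; rewrite mul1r.
  have -> : P ^+ h.-1 = P ^+ (h.-1 - i) * P ^+ i.
    by rewrite -exprD subnK// -ltnS prednK.
  apply: (coefM_le (m := j)) => //; try exact: nonneg_polyXn.
  by move=> k _; apply: (coefXn_le (m := k)).
have eqS : P ^+ h - P' ^+ h = Ps * \sum_(i < h) P ^+ (h.-1 - i) * P' ^+ i.
  by rewrite subrXX PE.
rewrite -lerBlDl /wsum -/P -/P' -coefB eqS coefM.
apply: (@le_trans _ _ (\sum_(j < n.+1) (if (j < m0)%N then h%:R * K * C * 2 `^ `|s| * n%:R `^ s else 0))).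
  apply: ler_sum => j _; rewrite coef_dilated// dvd1n divn1 -ltnS ltn_ord /= /ps.
  case: ifP => [jm|_]; last by rewrite mul0r.
  have j2n : (j.*2 <= n)%N by apply: leq_trans mn; rewrite leq_double ltnW.
  have nj0 : (0 < n - j)%N.
    rewrite subn_gt0; apply: leq_trans mn; apply: (leq_trans jm).
    by rewrite -addnn leq_addr.
  rewrite -!mulrA [leRHS]mulrCA; apply: ler_pM => //.
  - rewrite coef_sum sumr_ge0// => i _.
    by apply: nonneg_polyM; apply: nonneg_polyXn.
  - by case/andP: (p01 j).
  apply: (le_trans (step _)); rewrite ler_wpM2l//.
  by apply: (le_trans (PC _ _ nj0)); rewrite ler_wpM2l// powR_minus_le.
rewrite -big_mkcond/= sumr_const -[leLHS]mulr_natl natrM !mulrA ler_wpM2r ?powR_ge0//.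
rewrite !ler_wpM2r ?powR_ge0// mulrC ler_wpM2l// ler_nat.
rewrite -[leqRHS]card_ord; apply: (leq_trans _ (leq_imset_card (fun i : 'I_m0 => inord i : 'I_n.+1) predT)).
apply/subset_leq_card/fintype.subsetP => j jm; have {}jm : (j < m0)%N by []; apply/imsetP; exists (Ordinal jm) => //.
by apply/val_inj; rewrite /= inordK.
Qed.
End Truncation.

(** * From selection probabilities to a subset *)

Section Existence.
Variable (R : realType) (h : nat).
Hypothesis h0 : (0 < h)%N.
Implicit Types (p : nat -> R).

Lemma dilation1_le p N k m : (forall b, 0 <= p b) ->
  (dilated_poly N p 1 ^+ k)`_m <= (dilations_poly N p h ^+ k)`_m.
Proof.
move=> p0; have := @prod_dilated_le R N p h k (fun=> 1%N) m p0.
by rewrite prodr_const card_ord; apply.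
Qed.

Lemma dilated_top_le p (C s : R) : (forall b, 0 <= p b) -> 0 <= C ->
  (forall N j m, (0 < j < h)%N -> (0 < m)%N ->
    (dilations_poly N p h ^+ j)`_m <= C * m%:R `^ s) ->
  forall N m, (0 < m)%N -> (dilated_poly N p 1 ^+ h.-1)`_m <= C * m%:R `^ s.
Proof.
move=> p0 C0 sparse N m m0; have [->|hp] := posnP h.-1.
  by rewrite expr0 coef1 gt_eqF// mulr_ge0 ?powR_ge0.
by apply: (le_trans (dilation1_le _ _ _ p0)); apply: sparse; rewrite ?hp ?ltn_predL.
Qed.

Section Sparse.
Variables (p : nat -> R) (C1 s : R).
Hypotheses (p01 : forall b, 0 <= p b <= 1) (C10 : 0 <= C1)
  (sparse : forall N j m, (0 < j < h)%N -> (0 < m)%N ->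
    (dilations_poly N p h ^+ j)`_m <= C1 * m%:R `^ s).

Lemma merged_tuples_le N k m : (k <= h)%N -> (0 < m)%N ->
  (merge_bound k)%:R * \sum_(l < k) (dilations_poly N p h ^+ l)`_m <=
  (\sum_(k < h.+1) (merge_bound k)%:R * h%:R) * C1 * m%:R `^ s.
Proof.
move=> kh m0.
have S0 : 0 <= C1 * m%:R `^ s by rewrite mulr_ge0 ?powR_ge0.
apply: (@le_trans _ _ ((merge_bound k)%:R * h%:R * (C1 * m%:R `^ s))).
  rewrite -mulrA ler_wpM2l//.
  apply: (@le_trans _ _ (\sum_(l < k) (C1 * m%:R `^ s))).
    apply: ler_sum => -[[|l] lk] _ /=.
      by rewrite expr0 coef1 gt_eqF.
    by apply: sparse => //=; exact: leq_trans kh.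
  by rewrite sumr_const card_ord -[leLHS]mulr_natl ler_wpM2r// ler_nat.
rewrite -[leRHS]mulrA ler_wpM2r//.
have kh' : (k < h.+1)%N by [].
rewrite (bigD1 (Ordinal kh'))//= lerDl sumr_ge0//.
Qed.

Lemma tuple_sum_le_wsum N n : (0 < n)%N -> (n <= N)%N ->
  tuple_sum N p h n <= wsum h p n +
  (\sum_(k < h.+1) (merge_bound k)%:R * h%:R) * C1 * n%:R `^ s.
Proof.
move=> n0 nN; rewrite tuple_sumE.
apply: (le_trans (@wtuple_sum_le R N p h h p01 (fun=> 1%N) n _ _)) => //.
  by rewrite sum1_card card_ord.
by rewrite prodr_const card_ord wsumE// lerD2l merged_tuples_le.
Qed.

Lemma tuple_sum_sparse N k m : (0 < k < h)%N -> (0 < m)%N ->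
  tuple_sum N p k m <= (1 + \sum_(k < h.+1) (merge_bound k)%:R * h%:R) * C1 * m%:R `^ s.
Proof.
move=> /andP[k0 kh] m0; rewrite tuple_sumE.
apply: (le_trans (@wtuple_sum_le R N p h k p01 (fun=> 1%N) m _ _)) => //.
  by rewrite sum1_card card_ord ltnW.
rewrite prodr_const card_ord mulrDl mul1r mulrDl lerD ?merged_tuples_le ?(ltnW kh)//.
apply: (le_trans (dilation1_le _ _ _ _)); first by move=> b; case/andP: (p01 b).
by apply: sparse => //; rewrite k0.
Qed.
End Sparse.

(* Chosen so that [(m `^ (- (delta / 4))) ^+ moment_order <= m^-2]. *)
Definition moment_order (delta : R) := (Num.truncn (8 / delta)).+1.
(** The exponent of [w]. Half of the saving [delta] is given up: a quarter absorbs the constant and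
    a quarter is the factor [tau]. The maximum with 0 keeps [w] at least 1 and nondecreasing. *)
Definition local_exponent (kappa delta : R) := Num.max 0 (kappa - delta / 2).

Theorem existence (kappa delta : R) p C1 : 0 < delta ->
  (forall b, 0 <= p b <= 1) -> 0 <= C1 ->
  (forall N j m, (0 < j < h)%N -> (0 < m)%N ->
    (dilations_poly N p h ^+ j)`_m <= C1 * m%:R `^ (kappa - delta)) ->
  exists2 C, 0 <= C & forall (eps : nat -> R) (S : set nat),
    (\forall n \near within S \oo, 0 < eps n <= 1 /\
      (selection_const h (moment_order delta))%:R *
        (n%:R `^ (local_exponent kappa delta) * ln n%:R) <=
      eps n ^+ 2 * (wsum h p n - C * n%:R `^ (kappa - delta))) ->
    exists2 A : set nat, (forall b, A b -> p b != 0) &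
    \forall n \near within S \oo,
      (1 - eps n) * (wsum h p n - C * n%:R `^ (kappa - delta)) <= (rep_count A h n)%:R
      <= (1 + eps n) * (wsum h p n + C * n%:R `^ (kappa - delta)).
Proof.
move=> delta0 p01 C10 sparse; have p0 b : 0 <= p b by case/andP: (p01 b).
set s := kappa - delta in sparse *; set gam := local_exponent kappa delta.
have gam0 : 0 <= gam by rewrite /gam /local_exponent le_max lexx.
pose M : R := \sum_(k < h.+1) (merge_bound k)%:R * h%:R.
have M0 : 0 <= M by apply: sumr_ge0 => i _; rewrite mulr_ge0.
pose D := (1 + M) * C1; have D0 : 0 <= D by rewrite mulr_ge0// addr_ge0.
have d4 : 0 < delta / 4 by rewrite divr_gt0.
have [m1 _ Hm1] := nat_powR_dominates D d4.
pose m0 := maxn m1 (h + 4)%N.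
have m0pos m : (m0 <= m)%N -> (0 < m)%N.
  by apply: leq_trans; rewrite leq_max addn4 orbT.
pose q := drop_small m0 p.
have q0p b : 0 <= q b <= p b by rewrite /q /drop_small; case: ifP; rewrite ?lexx p0.
have q01 b : 0 <= q b <= 1.
  by have /andP[-> /le_trans ->//] := q0p b; case/andP: (p01 b).
pose C2 := (h * m0)%:R * 1 * C1 * 2 `^ `|s|.
have C20 : 0 <= C2 by rewrite !mulr_ge0 ?powR_ge0.
have dropC n : (m0.*2 <= n)%N -> (0 < n)%N -> wsum h p n <= wsum h q n + C2 * n%:R `^ s.
  move=> mn n0; apply: (@wsum_drop_small R h m0 p C1 1 s) => //.
  exact: dilated_top_le.
(* The first term bounds the tuples with repeated coordinates, the second the loss from dropping the
   elements below [m0]. *)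
exists (M * C1 + C2) => [|eps S]; first by rewrite addr_ge0// mulr_ge0.
set C := M * C1 + C2 => -[n1 _ Hn1].
pose l n := wsum h p n - C * n%:R `^ s; pose u n := wsum h p n + C * n%:R `^ s.
pose n2 := maxn n1 m0.*2.
pose S' : pred nat := fun n => (n \in S) && (n2 <= n)%N.
have [] := @selection R h (moment_order delta) m0 q (fun m => m%:R `^ gam)
  (fun m => m%:R `^ (- (delta / 4))) l u eps S' h0 q01.
- by rewrite leq_max leqnn orbT.
- by move=> b; rewrite /q /drop_small => ->.
- by move=> m /m0pos mp; rewrite -[leLHS](powRr0 m%:R) ler_powR ?ler1n.
- by move=> m m' _ mm; exact: powR_nat_le.
- move=> m /m0pos mp; rewrite powR_gt0 ?ltr0n//=.
  by rewrite -[leRHS](powRr0 m%:R) ler_powR ?ler1n// oppr_le0 ltW.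
- move=> m /m0pos mp.
  rewrite -powR_mulrn ?powR_ge0// -powRrM -powR_mulrn// -powRN ler_powR ?ler1n//.
  have : 8 / delta < (moment_order delta)%:R := truncnS_gt _.
  rewrite ltr_pdivrMr// => H8; rewrite mulNr lerNl opprK.
  by move: H8; set k : R := (moment_order delta)%:R; clearbody k; lra.
- move=> N k m kh mm mN; have mp := m0pos m mm.
  apply: (@le_trans _ _ (tuple_sum N p k m)); first exact: tuple_sum_mono.
  apply: (le_trans (tuple_sum_sparse p01 C10 sparse _ kh mp)); rewrite -/M -/D.
  have mR : 1 <= m%:R :> R by rewrite ler1n.
  have mne : m%:R != 0 :> R by rewrite gt_eqF// ltr0n.
  apply: (@le_trans _ _ (m%:R `^ (delta / 4) * m%:R `^ s)).
    rewrite ler_wpM2r ?powR_ge0//; apply: Hm1 => /=.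
    by apply: leq_trans mm; rewrite leq_max leqnn.
  rewrite -powRD ?mne ?implybT// -powRD ?mne ?implybT//.
  rewrite ler_powR// /gam /local_exponent /s.
  rewrite [leRHS]addrC -lerBlDr; rewrite le_max; apply/orP; right.
  by lra.
- move=> N n /andP[nS n2n] m0n nN; have np := m0pos n m0n.
  have [n1n mmn] : (n1 <= n)%N /\ (m0.*2 <= n)%N.
    by split; apply: leq_trans n2n; rewrite leq_max leqnn ?orbT.
  have [e01 large] := Hn1 n n1n (set_mem nS).
  have Ps0 : 0 <= n%:R `^ s :> R by exact: powR_ge0.
  have MC : 0 <= M * C1 * n%:R `^ s by rewrite !mulr_ge0.
  have C2s : 0 <= C2 * n%:R `^ s by rewrite mulr_ge0.
  split => //; last by rewrite -mulrA.
    rewrite /l; apply: (@le_trans _ _ (wsum h q n)).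
      by rewrite lerBlDr /C mulrDl (le_trans (dropC n mmn np))// lerD2l lerDr.
    rewrite tuple_sumE -(@wsumE _ _ _ N)//.
    have := @wtuple_sum_ge R N q h (fun=> 1%N) n q01.
    by rewrite prodr_const card_ord.
  rewrite /u; apply: (@le_trans _ _ (tuple_sum N p h n)); first exact: tuple_sum_mono.
  apply: (le_trans (tuple_sum_le_wsum p01 C10 sparse np nN)).
  by rewrite lerD2l /C mulrDl lerDl.
move=> A Aq HA; exists A.
  by move=> b /Aq; rewrite /q /drop_small; case: ifP; rewrite ?eqxx.
exists n2 => // n /= n2n Sn; apply: HA; first by rewrite /S' n2n andbT mem_set.
apply: leq_trans n2n; rewrite leq_max; apply/orP; right.
by rewrite -addnn leq_addr.
Qed.
End Existence.

Section Consequences.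
Variables (R : realType) (B : set nat) (h : nat).
Implicit Types F : R -> R.

(** Positivity of [F] gives every large [n] a representation in [B], and one of its [h] coordinates
    is at least n / h. *)
Lemma base_unbounded F : (forall x, 0 < x -> 0 < F x) ->
  asymp_le \oo (fun n => F n%:R) (fun n => (rep_count B h n)%:R) ->
  forall N, exists b, [/\ (N <= b)%N, (0 < b)%N & B b].
Proof.
move=> Fpos /rep_count_lower[n1 _ Hn1] N.
pose n := maxn n1 (h * N.+1).+1.
have nn : (n1 <= n)%N by rewrite leq_max leqnn.
have n0 : 0 < n%:R :> R by rewrite ltr0n leq_max orbT.
have : 0 < 2 * (rep_count B h n)%:R :> R := lt_le_trans (Fpos _ n0) (Hn1 n nn).
rewrite pmulr_rgt0// ltr0n => /card_gt0P[y].
rewrite inE => /andP[/forallP yB /eqP yn].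
have [i yi] : exists i, (N.+1 <= y i)%N.
  apply/existsP; rewrite -[X in is_true X]negbK negb_exists; apply/negP => /forallP yN.
  have : (n <= h * N.+1)%N.
    rewrite -yn -[h in leqRHS]card_ord -sum_nat_const; apply: leq_sum => i _.
    by apply: ltnW; rewrite ltnNge.
  by rewrite leqNgt leq_max ltnSn orbT.
by exists (y i); split; [exact: ltnW | exact: leq_trans yi | exact: set_mem].
Qed.

Lemma index_ge0 F kappa : (forall x, 0 < x -> 0 < F x) -> potter F kappa ->
  (fun n : nat => ln n%:R : R) =O_ \oo (fun n => F n%:R) -> 0 <= kappa.
Proof.
move=> Fpos Fp /eqO_exP[D /= D0 HD]; rewrite leNgt; apply/negP => k0.
have e0 : 0 < - kappa / 2 by rewrite divr_gt0// oppr_gt0.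
have [|C C0 HC] := potter_upper Fp _ e0.
  by exists 1%N => n n1; rewrite Fpos// ltr0n.
have L0 : 0 < ln 2 :> R by rewrite ln_gt0// ltr1n.
have H1 := @nat_powR_dominates R (- kappa / 2) (D * C / ln 2 + 1) e0.
have H2 : \forall n \near \oo, (2 <= n)%N by exists 2%N.
have [N _ /(_ N (leqnn N))/= [[HN H1N] N2]] := filterI (filterI HD H1) H2.
have N0 : (0 < N)%N by apply: leq_trans N2.
have NR : 0 < N%:R :> R by rewrite ltr0n.
have F0 := Fpos _ NR.
have P0 : 0 < N%:R `^ (- kappa / 2) :> R by rewrite powR_gt0.
have lnN : ln 2 <= D * F N%:R.
  rewrite -[F _]gtr0_norm// (le_trans _ HN)// (le_trans _ (ler_norm _))//.
  by rewrite ler_ln ?posrE// ler_nat.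
have {lnN} : ln 2 <= D * C / N%:R `^ (- kappa / 2).
  rewrite (le_trans lnN)// -mulrA ler_wpM2l ?(ltW D0)// (le_trans (HC N N0))//.
  by rewrite -powRN; have -> : - (- kappa / 2) = kappa + - kappa / 2 by field.
rewrite ler_pdivlMr// mulrC -ler_pdivlMr// => H3.
by have := le_trans H1N H3; lra.
Qed.

Lemma theta_bounds (G : filter_on nat) (f g : nat -> R) :
  f =Theta_G g <-> exists2 k : R * R, (0 < k.1) && (0 < k.2) &
    \forall n \near G, k.1 * `|g n| <= `|f n| <= k.2 * `|g n|.
Proof.
rewrite eqThetaE; split => [/asboolP[k k0 H]|[k k0 H]]; last apply/asboolP.
  by exists k => //; apply: filterS H => n [-> ->].
by exists k => //; apply: filterS H => n /andP[].
Qed.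

Lemma weighted_counting_equiv (beta : R) H (frakS : nat -> nat -> R) (scrS : nat -> set nat) F kappa :
  weighted_counting B beta H frakS scrS -> (H <= h)%N -> (0 < h)%N ->
  regularly_varying F ->
  (forall lambda, 0 < lambda -> F (lambda * x) / F x @[x --> +oo] --> lambda `^ kappa) ->
  asymp_le \oo (fun n => F n%:R) (fun n => (rep_count B h n)%:R) ->
  h%:R^-1 <= omega h kappa <= beta ->
  exists2 C : R, 0 < C & forall e, 0 < e -> \forall n \near within (scrS h) \oo,
    `|wsum h (ratio_weight B h F) n - frakS h n * C * F n%:R| <=
    e * `|frakS h n * C * F n%:R|.
Proof.
move=> B_iii Hh h0 F_rv Flim F_le om.
have Fpos : forall x, 0 < x -> 0 < F x by case: F_rv => -[].
have [_ /(_ F F_rv F_le)] := B_iii h Hh.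
move=> /(_ _ _ (slowly_varying_root h0 F_rv Flim)) => /(_ _ _ om)[|C C0 /equiv_nearP HC].
  move=> x x0; rewrite mulrCA -powRD ?(gt_eqF x0) ?implybT//.
  by rewrite subrr powRr0 mulr1.
exists C => // e /HC H1; near=> n.
have n0 : (0 < n)%N by near: n; apply: cvg_within; exists 1%N.
have -> : F n%:R = root_weight h F n%:R ^+ h / n%:R.
  by rewrite root_weight_expr// mulrAC divff ?mul1r ?gt_eqF ?ltr0n.
by rewrite -weighted_repE; near: n.
Unshelve. all: by end_near.
Qed.

(* The sums with a single summand have coefficient 1 at each element of [B]. *)
Lemma exponent_ge0 (C s : R) : (1 < h)%N ->
  (forall N, exists b, [/\ (N <= b)%N, (0 < b)%N & B b]) ->
  (forall N j m, (0 < j < h)%N -> (0 < m)%N ->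
    (dilations_poly N (indicator R B) h ^+ j)`_m <= C * m%:R `^ s) -> 0 <= s.
Proof.
move=> h1 unb HC; rewrite leNgt; apply/negP => s0.
have s0' : 0 < - s by rewrite oppr_gt0.
have [N _ HN] := @nat_powR_dominates R (- s) (C + 1) s0'.
have [b [Nb b0 Bb]] := unb N.
have h0 : (0 < h)%N by exact: ltnW.
have bR : 0 < b%:R :> R by rewrite ltr0n.
have P0 : 0 < b%:R `^ (- s) :> R by rewrite powR_gt0.
have H1 := dilation1_le h0 (p := indicator R B) b 1 b.
have : 1 <= C * b%:R `^ s.
  apply: le_trans (HC b 1%N b _ b0); last by rewrite h1.
  apply: (le_trans _ (H1 _)); last by move=> c; case/andP: (indicator01 R B c).
  by rewrite expr1 coef_dilated// dvd1n divn1 leqnn /= /indicator b0 (mem_set Bb).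
rewrite -[s]opprK powRN ler_pdivlMr// mul1r => H2.
by have := le_trans (HN b Nb) H2; rewrite gerDl ler10.
Qed.

End Consequences.

Lemma wsum_mono (R : realType) h (p q : nat -> R) n :
  (forall b, 0 <= p b <= q b) -> wsum h p n <= wsum h q n.
Proof.
move=> pq; rewrite /wsum !dilated_prodE; apply: ler_sum => y _.
by apply: ler_prod => i _.
Qed.

Lemma wsumZ (R : realType) h (p : nat -> R) c n :
  wsum h (fun b => c * p b) n = c ^+ h * wsum h p n.
Proof.
rewrite /wsum !dilated_prodE mulr_sumr; apply: eq_bigr => y _.
by rewrite big_split /= prodr_const card_ord.
Qed.

Section Families.
Variables (R : realType) (B : set nat) (beta om kappa delta : R) (h : nat).
Hypotheses (h0 : (0 < h)%N) (delta0 : 0 < delta).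
Hypothesis sparse : forall p, weight_family B beta om p -> exists2 C, 0 <= C &
  forall N j m, (0 < j < h)%N -> (0 < m)%N ->
  (dilations_poly N p h ^+ j)`_m <= C * m%:R `^ (kappa - delta).
Local Notation X n := (n%:R `^ (local_exponent kappa delta) * ln n%:R).
Local Notation K1 := ((selection_const h (moment_order delta))%:R).

Lemma family_drop q m : weight_family B beta om q -> weight_family B beta om (drop_small m q).
Proof.
case=> q0 qB qC; split => [b|b|e /qC[C HC]]; rewrite /drop_small.
- by case: ifP.
- by case: ifP => [|_ /qB//]; rewrite eqxx.
exists C => b b0; case: ifP => _; last exact: HC.
by apply: (le_trans (q0 b)); exact: HC.
Qed.

(** The finitely many weights that may exceed 1 are dropped to obtain probabilities; by
    [wsum_drop_small] this costs no more than the error term already present. *)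
Lemma existence_family q K : weight_family B beta om q -> (forall b, q b <= K) ->
  (\forall b \near \oo, q b <= 1) ->
  exists2 C, 0 <= C & forall (eps : nat -> R) (S : set nat),
    (\forall n \near within S \oo, 0 < eps n <= 1 /\
      K1 * X n <= eps n ^+ 2 * (wsum h q n - C * n%:R `^ (kappa - delta))) ->
    exists2 A : set nat, A `<=` B &
    \forall n \near within S \oo,
      (1 - eps n) * (wsum h q n - C * n%:R `^ (kappa - delta)) <= (rep_count A h n)%:R
      <= (1 + eps n) * (wsum h q n + C * n%:R `^ (kappa - delta)).
Proof.
move=> qw qK [b1 _ q1]; have [q0 qB _] := qw.
set s := kappa - delta.
pose p := drop_small b1 q; have pw : weight_family B beta om p := family_drop b1 qw.
have pq b : 0 <= p b <= q b by rewrite /p /drop_small; case: ifP; rewrite ?lexx q0.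
have p01 b : 0 <= p b <= 1.
  rewrite /p /drop_small; case: ltnP => [_|b1b]; first by rewrite lexx ler01.
  by rewrite q0; exact: q1.
have [C1 C10 HC1] := sparse pw; have [Cq Cq0 HCq] := sparse qw.
have [C C0 main] := existence h0 delta0 p01 C10 HC1.
pose C2 := (h * b1)%:R * K * Cq * 2 `^ `|s|.
have K0 : 0 <= K := le_trans (q0 0%N) (qK 0%N).
have C20 : 0 <= C2 by rewrite !mulr_ge0 ?powR_ge0.
have dropC n : (b1.*2 <= n)%N -> (0 < n)%N -> wsum h q n <= wsum h p n + C2 * n%:R `^ s.
  apply: wsum_drop_small => //; first by move=> b; rewrite q0 qK.
  exact: dilated_top_le.
have near_lo : \forall n \near \oo, wsum h q n - (C + C2) * n%:R `^ s <= wsum h p n - C * n%:R `^ s.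
  exists (b1.*2.+1) => // n /= bn.
  by have := dropC n (ltnW bn) (leq_trans _ bn) ; rewrite mulrDl => /(_ isT); lra.
have near_up n : wsum h p n + C * n%:R `^ s <= wsum h q n + (C + C2) * n%:R `^ s.
  rewrite mulrDl addrA; have := wsum_mono h n pq.
  have : 0 <= C2 * n%:R `^ s by rewrite mulr_ge0 ?powR_ge0.
  lra.
exists (C + C2) => [|eps S He]; first exact: addr_ge0.
have [|A AB HA] := main eps S.
  near=> n; have [e01 large] : 0 < eps n <= 1 /\
      K1 * X n <= eps n ^+ 2 * (wsum h q n - (C + C2) * n%:R `^ s) by near: n.
  split => //; apply: (le_trans large); rewrite ler_wpM2l ?sqr_ge0//.
  by near: n; apply: cvg_within.
exists A => [b /AB pb|]; first by have [_ pB _] := pw; have [] := pB b pb.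
near=> n.
have /andP[e0 e1] : 0 < eps n <= 1.
  by have [] : 0 < eps n <= 1 /\
      K1 * X n <= eps n ^+ 2 * (wsum h q n - (C + C2) * n%:R `^ s) by near: n.
have /andP[lo up] : (1 - eps n) * (wsum h p n - C * n%:R `^ s) <= (rep_count A h n)%:R
      <= (1 + eps n) * (wsum h p n + C * n%:R `^ s) by near: n.
apply/andP; split.
  apply: le_trans lo; rewrite ler_wpM2l ?subr_ge0//.
  by near: n; apply: cvg_within.
by apply: (le_trans up); rewrite ler_wpM2l// addr_ge0// ltW.
Unshelve. all: by end_near.
Qed.

(* The choice [eps n ^+ 2 ~ n `^ local_exponent * ln n / F n] makes the
   deviation allowed by the tail bounds just large enough. *)
Lemma realization (F : R -> R) q K (S : set nat) c d :
  (forall x, 0 < x -> 0 < F x) -> weight_family B beta om q -> (forall b, q b <= K) ->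
  (\forall b \near \oo, q b <= 1) -> 0 < c ->
  (\forall n \near within S \oo, c * F n%:R <= wsum h q n <= d * F n%:R) ->
  (forall e, 0 < e -> \forall n \near \oo, X n <= e * F n%:R) ->
  (forall e, 0 < e -> \forall n \near \oo, n%:R `^ (kappa - delta) <= e * F n%:R) ->
  exists2 A : set nat, A `<=` B & forall e, 0 < e ->
    \forall n \near within S \oo, `|(rep_count A h n)%:R - wsum h q n| <= e * F n%:R.
Proof.
move=> Fpos qw qK q1 c0 qF XF sF.
have [C C0 main] := existence_family qw qK q1.
set s := kappa - delta in sF main.
pose D : R := 2 * (K1 + 1) / c.
have D0 : 0 < D by rewrite divr_gt0// mulr_gt0// ltr_wpDl.
pose eps n := Num.sqrt (D * (X n / F n%:R)).
have Fn n : (0 < n)%N -> 0 < F n%:R by move=> n0; apply: Fpos; rewrite ltr0n.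
have Xpos n : (1 < n)%N -> 0 < X n.
  by move=> n1; rewrite mulr_gt0 ?powR_gt0 ?ltr0n ?(ltnW n1)// ln_gt0// ltr1n.
have eps_small e : 0 < e -> \forall n \near \oo, eps n <= e.
  move=> e0; have e1 : 0 < e ^+ 2 / D by rewrite divr_gt0// exprn_gt0.
  near=> n; have n1 : (1 < n)%N by near: n; exists 2%N.
  have -> : e = Num.sqrt (e ^+ 2) by rewrite sqrtr_sqr gtr0_norm.
  rewrite /eps ler_sqrt ?sqr_ge0// mulrC -ler_pdivlMr// ler_pdivrMr ?Fn ?(ltnW n1)//.
  by near: n; exact: XF.
have eps_sq n : (1 < n)%N -> eps n ^+ 2 = D * (X n / F n%:R).
  move=> n1; rewrite sqr_sqrtr// ltW// mulr_gt0// divr_gt0 ?Xpos ?Fn//.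
  exact: ltnW.
have [|A AB HA] := main eps S.
  near=> n; have n1 : (1 < n)%N by near: n; apply: cvg_within; exists 2%N.
  have Fn0 := Fn n (ltnW n1); have X0 := Xpos n n1.
  split.
    rewrite sqrtr_gt0 mulr_gt0 ?divr_gt0//=.
    by near: n; apply: cvg_within; exact: eps_small.
  have W1 : c * F n%:R <= wsum h q n by near: n; apply: filterS qF => n /andP[].
  have W2 : C * n%:R `^ s <= c / 2 * F n%:R.
    have H : n%:R `^ s <= c / 2 / (C + 1) * F n%:R.
      by near: n; apply: cvg_within; apply: sF; rewrite !divr_gt0// ltr_wpDl.
    have C10 : 0 < C + 1 by rewrite ltr_wpDl.
    apply: (@le_trans _ _ ((C + 1) * n%:R `^ s)); first by rewrite ler_wpM2r ?powR_ge0// lerDl.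
    rewrite mulrC -ler_pdivlMr//; apply: (le_trans H).
    by rewrite le_eqVlt; apply/orP; left; apply/eqP; field; rewrite gt_eqF.
  rewrite eps_sq//.
  apply: (@le_trans _ _ (D * (X n / F n%:R) * (c / 2 * F n%:R))).
    have -> : D * (X n / F n%:R) * (c / 2 * F n%:R) = (K1 + 1) * X n.
      by rewrite /D; field; rewrite !gt_eqF.
    by rewrite ler_wpM2r ?(ltW X0)// lerDl.
  rewrite ler_wpM2l//; first by rewrite mulr_ge0 ?(ltW D0)// divr_ge0// ltW.
  by move: W1 W2; lra.
exists A => // e e0.
pose e1 := Num.min 1 (e / (2 * (`|d| + 1))).
have d1 : 0 < `|d| + 1 by rewrite ltr_wpDl.
have e10 : 0 < e1 by rewrite lt_min ltr01 divr_gt0// mulr_gt0.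
have e2 : 0 < e / (4 * (C + 1)) by rewrite divr_gt0// mulr_gt0// ltr_wpDl.
near=> n; have n1 : (1 < n)%N by near: n; apply: cvg_within; exists 2%N.
have Fn0 := Fn n (ltnW n1).
have en : eps n <= e1 by near: n; apply: cvg_within; exact: eps_small.
have en0 : 0 <= eps n by exact: sqrtr_ge0.
have sn : n%:R `^ s <= e / (4 * (C + 1)) * F n%:R by near: n; apply: cvg_within; exact: sF.
have /andP[W1 W2] : c * F n%:R <= wsum h q n <= d * F n%:R by near: n.
have /andP[lo up] : (1 - eps n) * (wsum h q n - C * n%:R `^ s) <= (rep_count A h n)%:R
      <= (1 + eps n) * (wsum h q n + C * n%:R `^ s) by near: n.
have en1 : eps n <= 1 by apply: (le_trans en); rewrite ge_min lexx.
have Ps0 : 0 <= C * n%:R `^ s by rewrite mulr_ge0 ?powR_ge0.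
have W0 : 0 <= wsum h q n by apply: le_trans W1; rewrite mulr_ge0// ltW.
have k1 : eps n * wsum h q n <= e / 2 * F n%:R.
  apply: (@le_trans _ _ (e / (2 * (`|d| + 1)) * ((`|d| + 1) * F n%:R))).
    apply: ler_pM => //; first by rewrite (le_trans en)// ge_min lexx orbT.
    by rewrite (le_trans W2)// ler_wpM2r ?(ltW Fn0)// ler_wpDr// ler_norm.
  by rewrite le_eqVlt; apply/orP; left; apply/eqP; field; rewrite gt_eqF.
have k2 : 2 * (C * n%:R `^ s) <= e / 2 * F n%:R.
  apply: (@le_trans _ _ (2 * ((C + 1) * (e / (4 * (C + 1)) * F n%:R)))).
    by rewrite ler_wpM2l// ler_pM ?powR_ge0// lerDl.
  rewrite le_eqVlt; apply/orP; left; apply/eqP; field.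
  by rewrite gt_eqF// ltr_wpDl.
have k3 : eps n * (C * n%:R `^ s) <= C * n%:R `^ s by rewrite ler_piMl.
have k4 : 0 <= eps n * (C * n%:R `^ s) by rewrite mulr_ge0.
move: lo up k1 k2 k3 k4 Ps0; rewrite ler_norml.
move: (wsum h q n) (C * n%:R `^ s) (rep_count A h n)%:R (eps n) (F n%:R) => W y r ep Fv.
move=> lo up k1 k2 k3 k4 y0.
by apply/andP; split; lra.
Unshelve. all: by end_near.
Qed.
End Families.

Section Growth.
Variables (R : realType) (F : R -> R) (kappa : R).
Hypotheses (Fpos : forall x, 0 < x -> 0 < F x) (F_potter : potter F kappa).

Lemma power_negligible a e : a < kappa -> 0 < e ->
  \forall n \near \oo, n%:R `^ a <= e * F n%:R.
Proof.
move=> ak e0; pose b := (kappa - a) / 2.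
have b0 : 0 < b by rewrite divr_gt0// subr_gt0.
have [c c0 Hc] := F_lower Fpos F_potter b0.
have H := @nat_powR_dominates R b (e * c)^-1 b0.
near=> n; have n0 : (0 < n)%N by near: n; exists 1%N.
have nR : n%:R != 0 :> R by rewrite gt_eqF// ltr0n.
have P0 : 0 < n%:R `^ a :> R by rewrite powR_gt0// ltr0n.
have Pb : (e * c)^-1 <= n%:R `^ b by near: n.
apply: (@le_trans _ _ (e * (c * n%:R `^ (kappa - b)))); last by rewrite ler_wpM2l ?(ltW e0)// Hc.
have -> : kappa - b = b + a by rewrite /b; field.
rewrite powRD ?nR ?implybT// !mulrA ler_pMl//.
by rewrite -ler_pdivrMl ?mulr1// mulr_gt0.
Unshelve. all: by end_near.
Qed.

Lemma power_ln_negligible a e : a < kappa -> 0 < e ->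
  \forall n \near \oo, n%:R `^ a * ln n%:R <= e * F n%:R.
Proof.
move=> ak e0; pose b := (kappa - a) / 2.
have b0 : 0 < b by rewrite divr_gt0// subr_gt0.
have abk : a + b < kappa by rewrite /b; lra.
near=> n; have n0 : (0 < n)%N by near: n; exists 1%N.
have H : n%:R `^ (a + b) <= b * e * F n%:R.
  by near: n; apply: power_negligible => //; exact: mulr_gt0.
have nR : n%:R != 0 :> R by rewrite gt_eqF// ltr0n.
apply: (@le_trans _ _ (n%:R `^ a * (b^-1 * n%:R `^ b))).
  by rewrite ler_wpM2l ?powR_ge0// ln_nat_le.
by rewrite mulrCA -powRD ?nR ?implybT// ler_pdivrMl// mulrA.
Unshelve. all: by end_near.
Qed.

(** For positive [kappa] the local exponent stays below [kappa], and the logarithm is absorbed. For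
    [kappa = 0] it is 0, and the statement becomes the hypothesis ln = o(F). *)
Lemma local_power_negligible delta : 0 <= kappa -> 0 < delta ->
  (0 < kappa \/ forall e, 0 < e -> \forall n \near \oo, ln n%:R <= e * F n%:R) ->
  forall e, 0 < e ->
  \forall n \near \oo, n%:R `^ (local_exponent kappa delta) * ln n%:R <= e * F n%:R.
Proof.
move=> k0 d0 H e e0; have d2 : 0 < delta / 2 by rewrite divr_gt0.
have [kp|kn] := ltP 0 kappa.
  apply: power_ln_negligible => //.
  by rewrite /local_exponent gt_max kp ltrBlDr ltrDl.
have kE : kappa = 0 by apply/le_anti/andP.
case: H => [|/(_ e e0)]; first by rewrite kE ltxx.
rewrite /local_exponent kE max_l; last by lra.
by apply: filterS => n; rewrite powRr0 mul1r.
Qed.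
End Growth.

Section Realizations.
Variables (R : realType) (B : set nat) (beta : R) (h : nat) (F : R -> R) (kappa delta : R).
Local Notation Bc := (fun x : R => (counting_fun B x)%:R : R).
Local Notation gB := (ratio_weight B h F).
Local Notation om := (omega h kappa).
Hypotheses (h0 : (0 < h)%N) (B_potter : potter Bc beta)
  (B_pos : exists2 b, (0 < b)%N & B b) (Fpos : forall x, 0 < x -> 0 < F x)
  (F_potter : potter F kappa)
  (F_le : asymp_le \oo (fun n => F n%:R) (fun n => (rep_count B h n)%:R))
  (kappa0 : 0 <= kappa) (delta0 : 0 < delta).
Hypothesis sparse : forall p, weight_family B beta om p -> exists2 C, 0 <= C &
  forall N j m, (0 < j < h)%N -> (0 < m)%N ->
  (dilations_poly N p h ^+ j)`_m <= C * m%:R `^ (kappa - delta).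
Variables (S : set nat) (c d : R).
Hypotheses (c0 : 0 < c)
  (W_bounds : \forall n \near within S \oo, c * F n%:R <= wsum h gB n <= d * F n%:R).

Lemma ratio_weight_family M : 0 <= M -> weight_family B beta om (fun b => M * gB b).
Proof.
move=> M0; split => [b|b|e e0].
- by rewrite mulr_ge0 ?ratio_weight_ge0.
- by rewrite mulf_eq0 negb_or => /andP[_ /ratio_weight_support].
have [C HC] := ratio_weight_le h0 B_potter B_pos Fpos F_potter e0.
by exists (M * C) => b b0; rewrite -mulrA ler_wpM2l// HC.
Qed.

Lemma ratio_weight_vanishes : om < beta -> forall e, 0 < e -> \forall b \near \oo, gB b <= e.
Proof.
move=> ob e e0; pose t := (beta - om) / 2.
have t0 : 0 < t by rewrite divr_gt0// subr_gt0.
have [C HC] := ratio_weight_le h0 B_potter B_pos Fpos F_potter t0.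
near=> b; have b0 : (0 < b)%N by near: b; exists 1%N.
have P0 : 0 < b%:R `^ t :> R by rewrite powR_gt0// ltr0n.
apply: (le_trans (HC b b0)); have -> : om - beta + t = - t by rewrite /t; field.
rewrite powRN ler_pdivrMr// mulrC -ler_pdivrMr//.
by near: b; exact: nat_powR_dominates.
Unshelve. all: by end_near.
Qed.

Lemma scaled_realization M : 0 < M -> (\forall b \near \oo, M * gB b <= 1) ->
  (0 < kappa \/ forall e, 0 < e -> \forall n \near \oo, ln n%:R <= e * F n%:R) ->
  exists2 A : set nat, A `<=` B & forall e, 0 < e -> \forall n \near within S \oo,
    `|(rep_count A h n)%:R - M ^+ h * wsum h gB n| <= e * F n%:R.
Proof.
move=> M0 Mg kln.
have [G G0 HG] := ratio_weight_bounded h0 B_potter B_pos Fpos F_potter F_le.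
have kd : kappa - delta < kappa by rewrite ltrBlDr ltrDl.
have [|A AB HA] := @realization R B beta om kappa delta h h0 delta0 sparse F (fun b => M * gB b) (M * G) S
  (M ^+ h * c) (M ^+ h * d) Fpos (ratio_weight_family (ltW M0)) (fun b => ler_wpM2l (ltW M0) (HG b)) Mg
  (mulr_gt0 (exprn_gt0 h M0) c0) _ (local_power_negligible Fpos F_potter kappa0 delta0 kln)
  (fun e => @power_negligible R F kappa Fpos F_potter _ e kd).
  apply: filterS W_bounds => n /andP[W1 W2].
  by rewrite wsumZ -!mulrA !ler_wpM2l// exprn_ge0// ltW.
by exists A => // e /HA; apply: filterS => n; rewrite wsumZ.
Qed.

(* If [kappa = 0], then [F] may be as small as [ln], and [M] has to be large:
   this is possible because the weights tend to 0. *)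
Lemma order_realization : (0 < kappa \/ om < beta) ->
  (fun n : nat => ln n%:R : R) =O_ \oo (fun n => F n%:R) ->
  exists2 A : set nat, A `<=` B & exists c', exists2 d', 0 < c' &
    \forall n \near within S \oo, c' * F n%:R <= (rep_count A h n)%:R <= d' * F n%:R.
Proof.
have [G G0 HG] := ratio_weight_bounded h0 B_potter B_pos Fpos F_potter F_le.
have [kp _ _|k_le0] := ltP 0 kappa.
  have [|||A AB HA] := @scaled_realization G^-1.
  - by rewrite invr_gt0.
  - by exists 0%N => // b _; rewrite mulrC ler_pdivrMr// mul1r.
  - by left.
  have P0 : 0 < G^-1 ^+ h by rewrite exprn_gt0// invr_gt0.
  exists A => //; exists (G^-1 ^+ h * c / 2), (G^-1 ^+ h * d + G^-1 ^+ h * c / 2).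
    by rewrite divr_gt0// mulr_gt0.
  have e0 : 0 < G^-1 ^+ h * c / 2 by rewrite divr_gt0// mulr_gt0.
  apply: filterS2 W_bounds (HA _ e0) => n /andP[W1 W2].
  have {}W1 := ler_wpM2l (ltW P0) W1; have {}W2 := ler_wpM2l (ltW P0) W2.
  rewrite ler_norml => /andP[r1 r2]; move: W1 W2 r1 r2.
  rewrite !mulrA.
  move: (G^-1 ^+ h) (wsum h gB n) (rep_count A h n)%:R (F n%:R) => g W r f.
  by move=> *; apply/andP; split; lra.
have kE : kappa = 0 by apply/le_anti/andP.
case=> [//|ob].
move=> /eqO_exP[D /= D0 HD].
pose K1 : R := (selection_const h (moment_order delta))%:R.
(* With [eps = 1/2] the square contributes 1/4, and the error term leaves half of [M ^+ h * c * F];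
   an eighth of [M ^+ h * c] must therefore exceed [K1 * D], where [ln <= D * F]. *)
pose M := Num.max 1 (8 * (K1 * D + 1) / c).
have M1 : 1 <= M by rewrite le_max lexx.
have M0 : 0 < M := lt_le_trans ltr01 M1.
have Mlarge : 8 * (K1 * D + 1) <= M ^+ h * c.
  rewrite -ler_pdivrMr//; apply: (@le_trans _ _ M); first by rewrite le_max lexx orbT.
  by case: h h0 => // h' _; rewrite exprS ler_peMr ?(ltW M0)// exprn_ege1.
have Mg : \forall b \near \oo, M * gB b <= 1.
  have M0' : 0 < M^-1 by rewrite invr_gt0.
  apply: filterS (ratio_weight_vanishes ob M0') => b gM.
  by rewrite mulrC -ler_pdivlMr// mul1r.
have [C C0 main] := @existence_family R B beta om kappa delta h h0 delta0 sparse _ (M * G)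
  (ratio_weight_family (ltW M0)) (fun b => ler_wpM2l (ltW M0) (HG b)) Mg.
have P0 : 0 < M ^+ h by rewrite exprn_gt0.
have small : \forall n \near \oo, C * n%:R `^ (kappa - delta) <= M ^+ h * c / 2 * F n%:R.
  have C1 : 0 < C + 1 by rewrite ltr_wpDl.
  have e0 : 0 < M ^+ h * c / 2 / (C + 1) by rewrite !divr_gt0// mulr_gt0.
  have kd : kappa - delta < kappa by rewrite ltrBlDr ltrDl.
  apply: filterS (power_negligible Fpos F_potter kd e0) => n H.
  apply: (@le_trans _ _ ((C + 1) * n%:R `^ (kappa - delta))).
    by rewrite ler_wpM2r ?powR_ge0// lerDl.
  rewrite mulrC -ler_pdivlMr//; apply: (le_trans H).
  by rewrite le_eqVlt; apply/orP; left; apply/eqP; field; rewrite gt_eqF.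
have [|A AB HA] := main (fun=> 2^-1) S.
  near=> n; have n0 : (0 < n)%N by near: n; apply: cvg_within; exists 1%N.
  have Fn0 : 0 < F n%:R by apply: Fpos; rewrite ltr0n.
  split; first by lra.
  have sm : C * n%:R `^ (kappa - delta) <= M ^+ h * c / 2 * F n%:R.
    by near: n; apply: cvg_within.
  have W1 : c * F n%:R <= wsum h gB n by near: n; apply: filterS W_bounds => n /andP[].
  have {}W1 := ler_wpM2l (ltW P0) W1.
  have lnF : ln n%:R <= D * F n%:R.
    have : `|ln n%:R : R| <= D * `|F n%:R| by near: n; apply: cvg_within.
    by rewrite (gtr0_norm Fn0); apply: le_trans; exact: ler_norm.
  rewrite wsumZ /local_exponent kE max_l; last by rewrite sub0r oppr_le0 divr_ge0// ltW.
  rewrite powRr0 mul1r -/K1.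
  have h1 : K1 * ln n%:R <= K1 * (D * F n%:R) by rewrite ler_wpM2l.
  have h2 := ler_wpM2r (ltW Fn0) Mlarge.
  move: sm W1 h1 h2; rewrite kE sub0r.
  move: (M ^+ h) (wsum h gB n) (C * _) (F n%:R) Fn0 => m W y f f0; rewrite !mulrA.
  by clearbody K1; move=> *; lra.
exists A => //; exists (M ^+ h * c / 4), (2 * (M ^+ h * d + M ^+ h * c / 2)).
  by rewrite divr_gt0// mulr_gt0.
near=> n.
have n0 : (0 < n)%N by near: n; apply: cvg_within; exists 1%N.
have Fn0 : 0 < F n%:R by apply: Fpos; rewrite ltr0n.
have sm : C * n%:R `^ (kappa - delta) <= M ^+ h * c / 2 * F n%:R.
  by near: n; apply: cvg_within.
have /andP[W1 W2] : c * F n%:R <= wsum h gB n <= d * F n%:R by near: n.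
have {}W1 := ler_wpM2l (ltW P0) W1; have {}W2 := ler_wpM2l (ltW P0) W2.
have : (1 - 2^-1) * (wsum h (fun b => M * gB b) n - C * n%:R `^ (kappa - delta)) <= (rep_count A h n)%:R
      <= (1 + 2^-1) * (wsum h (fun b => M * gB b) n + C * n%:R `^ (kappa - delta)) by near: n.
rewrite wsumZ; move: sm W1 W2.
have : 0 <= M ^+ h * c * F n%:R by rewrite !mulr_ge0// ltW.
have : 0 <= C * n%:R `^ (kappa - delta) by rewrite mulr_ge0 ?powR_ge0.
move: (M ^+ h) (wsum h gB n) (C * _) (F n%:R) (rep_count A h n)%:R => m W y f r; rewrite !mulrA.
by move=> y0 f0 sm W1 W2 /andP[r1 r2]; apply/andP; split; lra.
Unshelve. all: by end_near.
Qed.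
End Realizations.

(** * Weights truncated at 1 *)

Section Comparison.
Variables (R : realType) (h : nat).
Implicit Types p q : nat -> R.

Lemma wsum_mono_le p q n : (forall b, (b <= n)%N -> 0 <= p b <= q b) ->
  wsum h p n <= wsum h q n.
Proof.
move=> pq; rewrite /wsum !dilated_prodE; apply: ler_sum => y _.
by apply: ler_prod => i _; apply: pq; rewrite -ltnS.
Qed.

(* A tuple with a coordinate below [a] gains a factor [lam]. *)
Lemma wsum_drop_le a p q lam n : 0 <= lam ->
  (forall b, (b <= n)%N -> 0 <= p b <= q b) ->
  (forall b, (b < a)%N -> (b <= n)%N -> p b <= lam * q b) ->
  wsum h p n <= wsum h (drop_small a p) n + lam * wsum h q n.
Proof.
move=> lam0 pq plam; rewrite /wsum !dilated_prodE mulr_sumr -big_split /=.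
apply: ler_sum => y _; have yn i : (y i <= n)%N by rewrite -ltnS.
have p0 i : 0 <= p (y i) by case/andP: (pq _ (yn i)).
have q0 i : 0 <= q (y i) by case/andP: (pq _ (yn i)) => /le_trans; apply.
have [/existsP[i yi]|/existsPn ya] := boolP [exists i, (y i < a)%N].
  apply: (@le_trans _ _ (lam * \prod_i q (y i))).
    rewrite (bigD1 i)//= [in leRHS](bigD1 i)//= mulrA; apply: ler_pM => //.
    - by apply: prodr_ge0.
    - exact: plam.
    by apply: ler_prod => j _; exact: pq.
  by rewrite lerDr prodr_ge0// => j _; rewrite /drop_small; case: ifP.
rewrite [X in X + _](_ : _ = \prod_i p (y i)).
  by rewrite lerDl mulr_ge0// prodr_ge0.
by apply: eq_bigr => i _; rewrite /drop_small (negbTE (ya i)).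
Qed.

(** The two sides differ by the tuples with a zero coordinate; by the binomial formula these are
    sums with fewer than [h] summands. *)
Lemma rep_count_le_wsum B C s : (0 < h)%N ->
  (forall N j m, (0 < j < h)%N -> (0 < m)%N ->
    (dilations_poly N (indicator R B) h ^+ j)`_m <= C * m%:R `^ s) -> 0 <= C ->
  exists2 D, 0 <= D & forall n, (0 < n)%N ->
  (rep_count B h n)%:R <= wsum h (indicator R B) n + D * n%:R `^ s.
Proof.
move=> h0 sparse C0; exists (\sum_(i < h) ('C(h, i))%:R * C) => [|n n0].
  by apply: sumr_ge0 => i _; rewrite mulr_ge0.
pose ind0 b : R := (b \in B)%:R.
have -> : (rep_count B h n)%:R = wsum h ind0 n.
  rewrite /wsum dilated_prodE /rep_count -sum1_card natr_sum.
  rewrite [LHS]big_mkcond [RHS]big_mkcond/=; apply: eq_bigr => y _.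
  rewrite inE; case: eqP => _; rewrite ?andbF ?andbT//.
  case: ifPn => [/forallP yB|/forallPn[i yi]].
    by rewrite big1// => i _; rewrite /ind0 yB.
  by rewrite (bigD1 i)//= /ind0 (negbTE yi) mul0r.
pose P := dilated_poly n (indicator R B) 1.
have i0 b : 0 <= indicator R B b by case/andP: (indicator01 R B b).
have eqP : dilated_poly n ind0 1 = (ind0 0%N)%:P + P :> {poly R}.
  apply/polyP => i; rewrite coefD coefC !coef_dilated// dvd1n divn1 /indicator /ind0.
  by case: i => [|i] /=; rewrite ?addr0 ?add0r.
rewrite /wsum eqP -/P exprDn big_ord_recr /= subnn expr0 mul1r binn mulr1n coefD addrC.
rewrite lerD2l coef_sum mulr_suml; apply: ler_sum => i _.
rewrite coefMn -polyC_exp coefCM -[leLHS]mulr_natl -mulrA ler_wpM2l//.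
apply: (@le_trans _ _ (P ^+ i)`_n).
  by rewrite ler_piMl ?exprn_ile1 ?ler0n ?lern1 ?leq_b1//; exact/nonneg_polyXn/nonneg_dilated.
case: i => -[|i] ih /=; first by rewrite expr0 coef1 gt_eqF// mulr_ge0 ?powR_ge0.
by apply: (le_trans (dilation1_le h0 _ _ _ i0)); exact: sparse.
Qed.
End Comparison.

Lemma indicator_family (R : realType) (B : set nat) (beta : R) :
  weight_family B beta beta (indicator R B).
Proof.
split => [b|b|e e0]; first by case/andP: (indicator01 R B b).
  rewrite /indicator; case: posnP => [|b0 /=]; first by rewrite eqxx.
  by case: (boolP (b \in B)); rewrite ?eqxx// inE.
exists 1 => b b0; rewrite subrr add0r mul1r.
apply: (@le_trans _ _ 1); first by case/andP: (indicator01 R B b).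
by rewrite -[leLHS](powRr0 b%:R) ler_powR ?ler1n// ltW.
Qed.

Section Truncation.
Variables (R : realType) (B : set nat) (h : nat) (F : R -> R) (kappa beta delta theta M : R).
Local Notation Bc := (fun x : R => (counting_fun B x)%:R : R).
Local Notation gB := (ratio_weight B h F).
Hypotheses (h0 : (0 < h)%N) (B_potter : potter Bc beta)
  (B_pos : exists2 b, (0 < b)%N & B b) (Fpos : forall x, 0 < x -> 0 < F x)
  (F_potter : potter F kappa) (critical : omega h kappa = beta)
  (theta0 : 0 < theta) (delta0 : 0 < delta) (M0 : 0 < M).
Let hR0 : 0 < h%:R :> R. Proof. by rewrite ltr0n. Qed.

(** The scaled weight continued to all integers. At the critical index it varies slowly, since f and
    B have the same index, so its values at [n] and at the elements of [B] near [n] can be compared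
    even if [n] is not in [B]. *)
Definition ratio_fun (b : nat) : R := M * (root_weight h F b%:R / Bc b%:R).
Local Notation rho := ratio_fun.

Lemma ratio_fun_weight b : (0 < b)%N -> B b -> M * gB b = rho b.
Proof. by move=> b0 Bb; rewrite /ratio_weight /indicator b0 (mem_set Bb) mulr1. Qed.

Lemma ratio_fun_potter e : 0 < e -> exists2 N, (0 < N)%N &
  forall x y, (N <= x)%N -> (x <= y)%N -> [/\ 0 < rho x, 0 < rho y &
    `|ln (rho y) - ln (rho x)| <= e * (ln y%:R - ln x%:R + 1)].
Proof.
move=> e0; have e1 : 0 < e / 2 by rewrite divr_gt0.
have e2 : 0 < h%:R * (e / 2) by rewrite mulr_gt0.
have [X X1 HX] := B_potter e1; have [Y Y1 HY] := F_potter e2.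
have [n1 Hn1] := counting_pos_eventually R B_pos.
pose N := maxn n1 (maxn (Num.truncn X).+1 (Num.truncn Y).+1).
have N0 : (0 < N)%N by rewrite !leq_max orbT.
exists N => // x y Nx xy; have Ny := leq_trans Nx xy.
have XN : X <= x%:R.
  apply/ltW/(lt_le_trans (truncnS_gt _)); rewrite ler_nat; apply: leq_trans Nx.
  by rewrite !leq_max leqnn ?orbT.
have YN : Y <= x%:R.
  apply/ltW/(lt_le_trans (truncnS_gt _)); rewrite ler_nat; apply: leq_trans Nx.
  by rewrite !leq_max leqnn ?orbT.
have xyR : x%:R <= y%:R :> R by rewrite ler_nat.
have facts z : (N <= z)%N -> [/\ 0 < z%:R :> R, 0 < F z%:R & 0 < Bc z%:R].
  move=> Nz; have z0 : 0 < z%:R :> R by rewrite ltr0n (leq_trans N0).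
  by split => //; [exact: Fpos|apply: Hn1; apply: leq_trans Nz; rewrite leq_max leqnn].
have rho_ln z : (N <= z)%N -> 0 < rho z /\
    ln (rho z) = ln M + (h%:R^-1 * (ln z%:R + ln (F z%:R)) - ln (Bc z%:R)).
  move=> /facts[z0 Fz Bz].
  have P0 : 0 < root_weight h F z%:R by rewrite powR_gt0// mulr_gt0.
  rewrite /ratio_fun; split; first by rewrite mulr_gt0// divr_gt0.
  rewrite lnM ?posrE ?divr_gt0// ln_div ?posrE// /root_weight ln_powR.
  by rewrite lnM ?posrE.
have [rx ->] := rho_ln x Nx; have [ry ->] := rho_ln y Ny; split => //.
have {HX} HX := HX _ _ XN xyR; have {HY} HY := HY _ _ YN xyR.
move: HX HY.
set lF := ln (F y%:R) - ln (F x%:R); set lB := ln (Bc y%:R) - ln (Bc x%:R).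
set l := ln y%:R - ln x%:R => HX HY.
have -> : ln M + (h%:R^-1 * (ln y%:R + ln (F y%:R)) - ln (Bc y%:R)) -
    (ln M + (h%:R^-1 * (ln x%:R + ln (F x%:R)) - ln (Bc x%:R))) =
    h%:R^-1 * (lF - kappa * l) - (lB - beta * l).
  by rewrite /lF /lB /l -critical /omega; field; rewrite gt_eqF.
apply: (le_trans (ler_normB _ _)).
rewrite normrM gtr0_norm ?invr_gt0//.
have h1 : h%:R^-1 * `|lF - kappa * l| <= e / 2 * (l + 1).
  by rewrite ler_pdivrMl// mulrA.
have -> : e * (l + 1) = e / 2 * (l + 1) + e / 2 * (l + 1) by field.
exact: lerD.
Qed.

Lemma ratio_fun_close (eta t : R) : 0 < eta -> 0 < t -> exists2 N, (0 < N)%N &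
  forall n y, (N <= y)%N -> (y <= n)%N -> eta * n%:R <= y%:R ->
  (expR (- t) * rho n <= rho y) && (expR (- t) * rho y <= rho n).
Proof.
move=> eta0 t0; pose e := t / (`|ln eta| + 1).
have e0 : 0 < e by rewrite divr_gt0// ltr_wpDl.
have [N N0 HN] := ratio_fun_potter e0; exists N => // n y Ny yn etan.
have [ry rn] := HN y n Ny yn.
have y0 : 0 < y%:R :> R by rewrite ltr0n (leq_trans N0).
have n0 : 0 < n%:R :> R by rewrite ltr0n (leq_trans N0)// (leq_trans Ny).
have : ln n%:R - ln y%:R <= `|ln eta|.
  have : ln (eta * n%:R) <= ln y%:R by rewrite ler_ln ?posrE ?mulr_gt0.
  by rewrite lnM ?posrE//; have := ler_norm (- ln eta); rewrite normrN; lra.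
move=> H H2; have {}H2 : `|ln (rho n) - ln (rho y)| <= t.
  apply: (le_trans H2); apply: (@le_trans _ _ (e * (`|ln eta| + 1))).
    by rewrite ler_wpM2l ?(ltW e0)// lerD2r.
  by rewrite /e divfK// gt_eqF// ltr_wpDl.
move: H2; rewrite ler_norml => /andP[H3 H4].
have key a b : 0 < a -> 0 < b -> ln a - ln b <= t -> expR (- t) * a <= b.
  move=> a0 b0 ab; rewrite -[X in _ * X](@lnK _ a) ?posrE// -[leRHS](@lnK _ b) ?posrE//.
  by rewrite -expRD ler_expR; lra.
by rewrite !key//; lra.
Qed.

Lemma ratio_fun_upper : exists N, exists2 C, (0 < N)%N & 0 < C /\
  forall n y, (N <= y)%N -> (y <= n)%N ->
  rho n <= C * (rho y * (n%:R `^ (theta / 2) * y%:R `^ (- (theta / 2)))).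
Proof.
have e0 : 0 < theta / 2 by rewrite divr_gt0.
have [N N0 HN] := ratio_fun_potter e0.
exists N, (expR (theta / 2)) => //; split => [|n y Ny yn]; first exact: expR_gt0.
have [ry rn H] := HN y n Ny yn.
have y0 : 0 < y%:R :> R by rewrite ltr0n (leq_trans N0).
have n0 : 0 < n%:R :> R by rewrite ltr0n (leq_trans N0)// (leq_trans Ny).
rewrite -[leLHS](@lnK _ (rho n)) ?posrE// -[X in X * (_ * _)](@lnK _ (rho y)) ?posrE//.
rewrite /powR !gt_eqF// -!expRD ler_expR.
by have := le_trans (ler_norm _) H; lra.
Qed.
End Truncation.

(** The bookkeeping common to both cases of [truncated_sum]: [W] is the full sum and [Q] the
    truncated one, [W'] runs over the tuples with all coordinates large, and [t * U] bounds the
    tuples with a small coordinate. *)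
Lemma truncation_loss (R : realType) (t d Y g e f W W' Q U : R) :
  0 < t -> t <= 1 -> 0 <= Y -> t * (d + Y) <= e / 2 -> 0 <= g -> g <= e / 2 -> 0 <= f ->
  W <= d * f -> U <= Y * f -> W <= W' + t * U + g * f -> (1 - t) * W' <= Q -> W - Q <= e * f.
Proof.
move=> t0 t1 Y0 tL g0 ge f0 Wd UY WW WQ.
have h1 := ler_wpM2r f0 tL.
have h2 : t * U <= t * (Y * f) by rewrite ler_wpM2l// ltW.
have h3 : t * W <= t * (d * f) by rewrite ler_wpM2l// ltW.
have h4 : (1 - t) * (W - (t * (Y * f) + g * f)) <= Q.
  by apply: le_trans WQ; rewrite ler_wpM2l ?subr_ge0//; lra.
have h5 : 0 <= t * (t * (Y * f) + g * f).
  by rewrite mulr_ge0 ?addr_ge0 ?mulr_ge0// ltW.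
have h6 := ler_wpM2r f0 ge.
move: h1 h3 h4 h5 h6; clear; lra.
Qed.

Section Truncated.
Variables (R : realType) (B : set nat) (h : nat) (F : R -> R) (kappa beta delta theta M : R).
Local Notation Bc := (fun x : R => (counting_fun B x)%:R : R).
Hypotheses (h0 : (0 < h)%N) (B_potter : potter Bc beta)
  (B_pos : exists2 b, (0 < b)%N & B b) (Fpos : forall x, 0 < x -> 0 < F x)
  (F_potter : potter F kappa) (critical : omega h kappa = beta)
  (theta0 : 0 < theta) (delta0 : 0 < delta) (M0 : 0 < M).
Variables (S : set nat) (d D : R).
Variable v : nat -> R.
Local Notation rho := (ratio_fun B h F M).
Hypotheses (v_ge0 : forall b, 0 <= v b) (v_zero : forall b, v b != 0 -> (0 < b)%N /\ B b)
  (v_ratio : forall b, (0 < b)%N -> B b -> v b = rho b).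
Let z n b : R := n%:R `^ (theta / 2) * b%:R `^ (- (theta / 2)).

Let z_ge1 n b : (0 < b)%N -> (b <= n)%N -> 1 <= z n b.
Proof.
move=> b0 bn; rewrite /z powRN ler_pdivlMr ?powR_gt0 ?ltr0n// mul1r.
by apply: powR_nat_le => //; rewrite divr_ge0// ltW.
Qed.

Let z_small eta n b : 0 <= eta -> (0 < b)%N -> b%:R <= eta * n%:R ->
  1 <= eta `^ (theta / 2) * z n b.
Proof.
move=> eta0 b0 bn; rewrite /z powRN mulrA ler_pdivlMr ?powR_gt0 ?ltr0n// mul1r.
rewrite -powRM// ge0_ler_powR ?nnegrE ?mulr_ge0//.
exact: ltW.
Qed.

Let z_sqr n b : z n b * z n b = n%:R `^ theta * b%:R `^ (- theta).
Proof.
have half x (a : R) : (a != 0) -> x%:R `^ (a / 2) * x%:R `^ (a / 2) = x%:R `^ a :> R.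
  move=> an; rewrite -powRD -?splitr//.
  by rewrite (negbTE an).
have tn : theta != 0 by rewrite gt_eqF.
rewrite /z mulrACA (half _ _ tn) -mulNr (half b (- theta)) ?oppr_eq0//.
Qed.

Let drop_scale (p q : nat -> R) (k : R) a n : 0 <= k ->
  (forall b, 0 <= p b) -> (forall b, 0 <= q b) ->
  (forall b, (a <= b)%N -> (b <= n)%N -> k * p b <= q b) ->
  k ^+ h * wsum h (drop_small a p) n <= wsum h q n.
Proof.
move=> k0 p0 q0 kpq; rewrite -wsumZ; apply: wsum_mono_le => b bn.
rewrite /drop_small; case: ltnP => ab; first by rewrite mulr0 lexx q0.
by rewrite mulr_ge0 ?p0//= kpq.
Qed.

(* Both [wsum h v n] and [rep_count B h n] come from the tuples with all
   coordinates at least [eta * n], where [v] is nearly constant: on the other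
   ones, [v b] and (when [rho n >= 1]) [1] are bounded by multiples of
   [v b * (n / b) `^ theta], with a gain of [eta `^ (theta / 2)].  So truncation
   is harmless when [rho n <= 1], and otherwise [wsum h (min 1 v) n] is almost
   [rep_count B h n]. *)
Theorem truncated_sum : 0 <= d -> 0 <= D ->
  (forall p, weight_family B beta (omega h kappa) p -> exists2 C, 0 <= C &
    forall N j m, (0 < j < h)%N -> (0 < m)%N ->
    (dilations_poly N p h ^+ j)`_m <= C * m%:R `^ (kappa - delta)) ->
  (\forall n \near within S \oo, wsum h v n <= d * F n%:R) ->
  (\forall n \near within S \oo,
    (n%:R `^ theta) ^+ h * wsum h (fun b => v b * b%:R `^ (- theta)) n <= D * F n%:R) ->
  (forall e, 0 < e -> \forall n \near within S \oo,
    wsum h v n <= (rep_count B h n)%:R + e * F n%:R) ->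
  forall e, 0 < e -> \forall n \near within S \oo,
  wsum h v n - wsum h (fun b => Num.min 1 (v b)) n <= e * F n%:R.
Proof.
move=> d0 D0 sparse Hd HD Hr e e0.
pose q b := Num.min 1 (v b); pose u b := v b * b%:R `^ (- theta).
have q0 b : 0 <= q b by rewrite /q le_min ler01 v_ge0.
have u0 b : 0 <= u b by rewrite /u mulr_ge0 ?v_ge0 ?powR_ge0.
have i0 b : 0 <= indicator R B b by case/andP: (indicator01 R B b).
have ind_family : weight_family B beta (omega h kappa) (indicator R B).
  by rewrite critical; exact: indicator_family.
have [Ci Ci0 HCi] := sparse _ ind_family.
have [Dr Dr0 HDr] := rep_count_le_wsum h0 HCi Ci0.
have [N1 [Cb N10 [Cb0 HCb]]] := ratio_fun_upper h0 B_potter B_pos Fpos F_potter critical theta0 M0.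
have CbD : 0 <= Cb ^+ h * D by rewrite mulr_ge0// exprn_ge0// ltW.
pose L := d + D + Cb ^+ h * D + 1.
have L0 : 0 < L by rewrite ltr_wpDl// !addr_ge0.
pose t := Num.min 1 (e / (2 * L)).
have t0 : 0 < t by rewrite lt_min ltr01 divr_gt0// mulr_gt0.
have t1 : t <= 1 by rewrite ge_min lexx.
have tL : t * L <= e / 2.
  apply: (@le_trans _ _ (e / (2 * L) * L)); first by rewrite ler_wpM2r ?(ltW L0)// ge_min lexx orbT.
  by rewrite le_eqVlt; apply/orP; left; apply/eqP; field; rewrite gt_eqF.
(* Chosen so that the gain [eta ^ (theta / 2)] for a coordinate below [eta * n] is exactly [t]. *)
pose eta := t `^ (2 / theta).
have eta0 : 0 < eta by rewrite powR_gt0.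
have etat : eta `^ (theta / 2) = t.
  rewrite /eta -powRrM; have -> : 2 / theta * (theta / 2) = 1 by field; rewrite gt_eqF.
  by rewrite powRr1 ?ltW.
have tau0 : 0 < t / h%:R by rewrite divr_gt0// ltr0n.
have [N2 N20 HN2] := ratio_fun_close h0 B_potter B_pos Fpos F_potter critical M0 eta0 tau0.
pose k := expR (- (t / h%:R)).
have k0 : 0 < k by exact: expR_gt0.
have k1 : k <= 1 by rewrite -expR0 ler_expR oppr_le0 ltW.
have kh : 1 - t <= k ^+ h.
  rewrite /k -expRM_natl mulrN mulrC divfK ?gt_eqF ?ltr0n//.
  exact: expR_ge1Dx.
have CDi := @wsum_drop_small R h N1 (indicator R B) Ci 1 (kappa - delta) h0 (indicator01 R B) Ci0
  (dilated_top_le h0 i0 Ci0 HCi).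
pose E := Dr + (h * N1)%:R * 1 * Ci * 2 `^ `|kappa - delta|.
have E0 : 0 <= E by rewrite addr_ge0// !mulr_ge0 ?powR_ge0.
have kd : kappa - delta < kappa by rewrite ltrBlDr ltrDl.
have e4 : 0 < e / 4 by rewrite divr_gt0.
have e5 : 0 < e / 4 / (E + 1) by rewrite divr_gt0// ltr_wpDl.
have Esmall := power_negligible Fpos F_potter kd e5.
near=> n.
have n0 : (0 < n)%N by near: n; apply: cvg_within; exists 1%N.
have nN1 : (N1.*2 <= n)%N by near: n; apply: cvg_within; exists N1.*2.
have nN2 : N2%:R <= eta * n%:R.
  rewrite mulrC -ler_pdivrMr//; near: n; apply: cvg_within.
  exists (Num.truncn (N2%:R / eta)).+1 => // m /= Hm.
  by apply/ltW/(lt_le_trans (truncnS_gt _)); rewrite ler_nat.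
have nR : 0 < n%:R :> R by rewrite ltr0n.
have Fn0 : 0 < F n%:R by exact: Fpos.
have Wd : wsum h v n <= d * F n%:R by near: n.
have Wu : (n%:R `^ theta) ^+ h * wsum h u n <= D * F n%:R by near: n.
have Wr : wsum h v n <= (rep_count B h n)%:R + e / 4 * F n%:R by near: n; exact: Hr.
have En : E * n%:R `^ (kappa - delta) <= e / 4 * F n%:R.
  apply: (@le_trans _ _ ((E + 1) * n%:R `^ (kappa - delta))).
    by rewrite ler_wpM2r ?powR_ge0// lerDl.
  rewrite mulrC -ler_pdivlMr ?ltr_wpDl//.
  have -> : e / 4 * F n%:R / (E + 1) = e / 4 / (E + 1) * F n%:R.
    by field; rewrite gt_eqF// ltr_wpDl.
  by near: n; apply: cvg_within.
pose a := (Num.truncn (eta * n%:R)).+1.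
have eta_n0 : 0 <= eta * n%:R by rewrite mulr_ge0// ltW.
have small b : (b < a)%N -> b%:R <= eta * n%:R.
  by rewrite ltnS => ba; rewrite -truncn_ge_nat.
have large b : (a <= b)%N -> eta * n%:R <= b%:R.
  by move=> ab; apply/ltW/(lt_le_trans (truncnS_gt _)); rewrite ler_nat.
have large2 b : (a <= b)%N -> (N2 <= b)%N.
  by move=> /large/(le_trans nN2); rewrite ler_nat.
have Wv0 : 0 <= wsum h v n by apply: nonneg_polyXn; exact: nonneg_dilated.
(* Slow variation makes [rho] on [eta n, n] comparable with [rho n] up to the factor [k]. In the
   first case [k * v] is below the truncation there; in the second, [k] times the indicator is. *)
have [rn|rn] := lerP (rho n) 1.
  have s1 : wsum h v n <= wsum h (drop_small a v) n + t * wsum h (fun b => n%:R `^ theta * u b) n.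
    apply: wsum_drop_le; first exact: ltW.
      move=> b bn; rewrite v_ge0/=; have [->|vb] := eqVneq (v b) 0.
        by rewrite mulr_ge0 ?powR_ge0.
      have [b0 _] := v_zero vb.
      rewrite /u mulrCA ler_peMr ?v_ge0// -z_sqr.
      by rewrite -[1]mulr1 ler_pM ?z_ge1.
    move=> b ba bn; have [->|vb] := eqVneq (v b) 0.
      by rewrite !mulr_ge0 ?powR_ge0// ltW.
    have [b0 _] := v_zero vb.
    rewrite /u [X in _ <= t * X]mulrCA [leRHS]mulrCA ler_peMr ?v_ge0// -z_sqr mulrA.
    by rewrite -[1]mulr1 ler_pM ?z_ge1// -etat z_small ?small// ltW.
  rewrite wsumZ in s1.
  have s2 : k ^+ h * wsum h (drop_small a v) n <= wsum h q n.
    apply: drop_scale => //; first exact: ltW.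
    move=> b ab bn; have [->|vb] := eqVneq (v b) 0; first by rewrite mulr0.
    have [b0 Bb] := v_zero vb.
    have /andP[_ c2] := HN2 n b (large2 b ab) bn (large b ab).
    rewrite /q le_min ler_piMl ?v_ge0// andbT.
    by rewrite v_ratio//; exact: le_trans rn.
  have s3 : (1 - t) * wsum h (drop_small a v) n <= wsum h q n.
    apply: le_trans s2; rewrite ler_wpM2r//.
    apply: nonneg_polyXn; apply: nonneg_dilated => b; rewrite /drop_small.
    by case: ifP.
  apply: (@truncation_loss _ t d D 0 e (F n%:R) _ _ _ _ t0 t1 D0 _ _ _ (ltW Fn0) Wd Wu _ s3) => //.
  - by apply: le_trans tL; rewrite ler_wpM2l ?(ltW t0)// /L; lra.
  - by rewrite divr_ge0// ltW.
  - by rewrite mul0r addr0.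
have s1 : wsum h (drop_small N1 (indicator R B)) n <=
   wsum h (drop_small a (drop_small N1 (indicator R B))) n +
   t * wsum h (fun b => Cb * n%:R `^ theta * u b) n.
  have P0 : 0 <= Cb * n%:R `^ theta by rewrite mulr_ge0 ?powR_ge0// ltW.
  have key b : (b <= n)%N -> drop_small N1 (indicator R B) b != 0 ->
      [/\ (0 < b)%N, drop_small N1 (indicator R B) b = 1, 1 <= Cb * (rho b * z n b) &
       Cb * n%:R `^ theta * u b = Cb * (rho b * z n b) * z n b].
    rewrite /drop_small /indicator; case: ltnP => [|N1b bn]; first by rewrite eqxx.
    have b0 : (0 < b)%N := leq_trans N10 N1b; rewrite b0 /=.
    case: (boolP (b \in B)) => [|_]; last by rewrite eqxx.
    rewrite inE => Bb _; split => //.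
      by apply: le_trans (HCb n b N1b bn); exact: ltW.
    have zz := z_sqr n b; rewrite /u v_ratio//.
    move: (rho b) (z n b) zz => r zb; rewrite -!mulrA => ->; congr (_ * _); exact: mulrCA.
  apply: wsum_drop_le; first exact: ltW.
    move=> b bn; rewrite [X in X && _](_ : _ = true); last by rewrite /drop_small; case: ifP; rewrite ?lexx ?i0.
    have [->|db] := eqVneq (drop_small N1 (indicator R B) b) 0; first by rewrite mulr_ge0.
    have [b0 -> ge1 ->] := key b bn db.
    by rewrite -[1]mulr1 ler_pM ?z_ge1.
  move=> b ba bn.
  have [->|db] := eqVneq (drop_small N1 (indicator R B) b) 0; first by rewrite !mulr_ge0// ltW.
  have [b0 -> ge1 ->] := key b bn db.
  rewrite mulrCA -[1]mulr1 ler_pM//.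
  by rewrite -etat z_small ?small// ltW.
rewrite wsumZ exprMn in s1.
have s2 : k ^+ h * wsum h (drop_small a (drop_small N1 (indicator R B))) n <= wsum h q n.
  apply: drop_scale => //; first exact: ltW.
    by move=> b; rewrite /drop_small; case: ifP.
  move=> b ab bn; rewrite /drop_small; case: ifP => _; first by rewrite mulr0.
  rewrite /indicator; case: posnP => [_|b0]; first by rewrite mulr0.
  case: (boolP (b \in B)) => [|_]; last by rewrite mulr0.
  rewrite inE => Bb; rewrite mulr1 /q le_min k1 v_ratio//.
  have /andP[c1 _] := HN2 n b (large2 b ab) bn (large b ab).
  by apply: le_trans c1; rewrite ler_peMr// ltW.
have s3 : (1 - t) * wsum h (drop_small a (drop_small N1 (indicator R B))) n <= wsum h q n.
  apply: le_trans s2; rewrite ler_wpM2r//.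
  apply: nonneg_polyXn; apply: nonneg_dilated => b; rewrite /drop_small.
  by case: ifP => // _; case: ifP.
have s4 : wsum h v n <= wsum h (drop_small N1 (indicator R B)) n + e / 2 * F n%:R.
  apply: (le_trans Wr); have := HDr n n0; have := CDi n nN1 n0.
  by move: En; rewrite /E mulrDl; lra.
apply: (@truncation_loss _ t d (Cb ^+ h * D) (e / 2) e (F n%:R) _ _ _
  (Cb ^+ h * ((n%:R `^ theta) ^+ h * wsum h u n)) t0 t1 CbD _ _ _ (ltW Fn0) Wd _ _ s3) => //.
- by apply: le_trans tL; rewrite ler_wpM2l ?(ltW t0)// /L; lra.
- by rewrite divr_ge0// ltW.
- by rewrite -mulrA ler_wpM2l// exprn_ge0// ltW.
- apply: (le_trans s4); rewrite lerD2r; apply: (le_trans s1).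
  by rewrite -[Cb ^+ h * _ * _]mulrA.
Unshelve. all: by end_near.
Qed.
End Truncated.

(** * Consequences of weighted counting *)

Section Twist.
Variables (R : realType) (F : R -> R) (kappa : R).
Hypotheses (F_rv : regularly_varying F)
  (F_lim : forall lambda, 0 < lambda -> F (lambda * x) / F x @[x --> +oo] --> lambda `^ kappa).

(** With [s = h * theta] condition (iii) evaluates the sum with the weights multiplied by
    b^(-theta). This favours small elements, and so controls the tuples in which they occur. *)
Definition twisted (s x : R) := F x * x `^ (- s).

Let Fpos x : 0 < x -> 0 < F x. Proof. by case: F_rv => -[+ _] _; apply. Qed.

Lemma twisted_lim s lambda : 0 < lambda ->
  twisted s (lambda * x) / twisted s x @[x --> +oo] --> lambda `^ (kappa - s).
Proof.
move=> l0; rewrite powRD ?(gt_eqF l0) ?implybT//.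
have : F (lambda * x) / F x * lambda `^ (- s) @[x --> +oo] --> lambda `^ kappa * lambda `^ (- s).
  by apply: cvgM; [exact: F_lim | exact: cvg_cst].
apply: cvg_trans; apply: near_eq_cvg; exists 0; split => // x x0.
have Fx := Fpos x0.
rewrite /twisted powRM ?(ltW l0) ?(ltW x0)//.
by field; rewrite !gt_eqF ?powR_gt0.
Qed.

Lemma twisted_regular s : regularly_varying (twisted s).
Proof.
have [[_ mF] _] := F_rv; split; first split.
- by move=> x x0; rewrite mulr_gt0 ?Fpos ?powR_gt0.
- apply: measurable_funM => //; apply: measurable_funTS; exact: measurable_powR.
by move=> lambda l0; exists (lambda `^ (kappa - s)); [exact: powR_gt0|exact: twisted_lim].
Qed.

Lemma ratio_weight_twisted B h theta b : (0 < h)%N ->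
  ratio_weight B h (twisted (h%:R * theta)) b = ratio_weight B h F b * b%:R `^ (- theta).
Proof.
move=> h0; rewrite /ratio_weight /indicator; case: posnP => [_|b0]; first by rewrite !mulr0 mul0r.
rewrite /root_weight /twisted mulrA powRM ?powR_ge0 ?mulr_ge0 ?(ltW (Fpos _)) ?ltr0n//.
rewrite -powRrM; have -> : - (h%:R * theta) / h%:R = - theta by field; rewrite gt_eqF ?ltr0n.
ring.
Qed.
End Twist.

Section Assembly.
Variables (R : realType) (B : set nat) (beta : R) (H h : nat)
  (frakS : nat -> nat -> R) (scrS : nat -> set nat) (F : R -> R) (kappa : R).
Local Notation gB := (ratio_weight B h F).
Local Notation G := (within (scrS h) \oo).
Hypotheses (h0 : (0 < h)%N) (Hh : (H <= h)%N)
  (B_iii : weighted_counting B beta H frakS scrS).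

Lemma weighted_sum_bounds F' kappa' : regularly_varying F' ->
  (forall lambda, 0 < lambda -> F' (lambda * x) / F' x @[x --> +oo] --> lambda `^ kappa') ->
  asymp_le \oo (fun n => F' n%:R) (fun n => (rep_count B h n)%:R) ->
  h%:R^-1 <= omega h kappa' <= beta ->
  exists c, exists2 d, 0 < c & \forall n \near G,
    c * F' n%:R <= wsum h (ratio_weight B h F') n <= d * F' n%:R.
Proof.
move=> rv lim F_le om.
have [C C0 HC] := weighted_counting_equiv B_iii Hh h0 rv lim F_le om.
have [/theta_bounds[[s t] /= /andP[s0 t0] Hst] _] := B_iii Hh.
exists (s * C / 2), (2 * (t * C)); first by rewrite divr_gt0// mulr_gt0.
have half0 : 0 < 2^-1 :> R by rewrite invr_gt0.
near=> n.
have n0 : (0 < n)%N by near: n; apply: cvg_within; exists 1%N.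
have Fn0 : 0 < F' n%:R by case: rv => -[+ _] _; apply; rewrite ltr0n.
have W0 : 0 <= wsum h (ratio_weight B h F') n.
  apply: nonneg_polyXn; apply: nonneg_dilated => b; exact: ratio_weight_ge0.
have H1 : `|wsum h (ratio_weight B h F') n - frakS h n * C * F' n%:R| <=
    2^-1 * `|frakS h n * C * F' n%:R| by near: n; exact: HC.
have /andP[H2 H3] : s * `|1 : R| <= `|frakS h n| <= t * `|1 : R| by near: n.
move: H1 H2 H3; rewrite !normrM !normr1 !mulr1 (gtr0_norm C0) (gtr0_norm Fn0) => H1 H2 H3.
have CF : 0 < C * F' n%:R by rewrite mulr_gt0.
have {}H2 := ler_wpM2r (ltW CF) H2; have {}H3 := ler_wpM2r (ltW CF) H3.
have A1 : `|frakS h n * C * F' n%:R| = `|frakS h n| * C * F' n%:R.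
  by rewrite !normrM (gtr0_norm C0) (gtr0_norm Fn0).
have H5 := lerB_dist (frakS h n * C * F' n%:R) (wsum h (ratio_weight B h F') n).
have H6 := lerB_dist (wsum h (ratio_weight B h F') n) (frakS h n * C * F' n%:R).
rewrite distrC in H5; rewrite (ger0_norm W0) in H5 H6.
rewrite A1 in H5 H6; rewrite !mulrA in H2 H3 H1.
by apply/andP; split; move: H1 H2 H3 H5 H6 A1; clear; move: (_ * F' n%:R) => *; lra.
Unshelve. all: by end_near.
Qed.

Hypotheses (F_rv : regularly_varying F)
  (F_lim : forall lambda, 0 < lambda -> F (lambda * x) / F x @[x --> +oo] --> lambda `^ kappa)
  (F_potter : potter F kappa)
  (B_potter : potter (fun x : R => (counting_fun B x)%:R : R) beta)
  (unbounded : forall N, exists b, [/\ (N <= b)%N, (0 < b)%N & B b])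
  (F_le : asymp_le \oo (fun n => F n%:R) (fun n => (rep_count B h n)%:R))
  (kappa0 : 0 <= kappa) (delta : R) (delta0 : 0 < delta) (h1 : (1 < h)%N).
Hypothesis sparse : forall p, weight_family B beta (omega h kappa) p -> exists2 C, 0 <= C &
  forall N j m, (0 < j < h)%N -> (0 < m)%N ->
  (dilations_poly N p h ^+ j)`_m <= C * m%:R `^ (kappa - delta).

Let Fpos x : 0 < x -> 0 < F x. Proof. by case: F_rv => -[+ _] _; apply. Qed.
Let hR0 : 0 < h%:R :> R. Proof. by rewrite ltr0n. Qed.

Let B_pos : exists2 b, (0 < b)%N & B b.
Proof. by have [b [_ b0 Bb]] := unbounded 0; exists b. Qed.

Let om_bounds : h%:R^-1 <= omega h kappa <= beta.
Proof.
apply/andP; split; last exact: omega_le_beta h0 B_potter B_pos Fpos F_potter F_le.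
by rewrite /omega -[leLHS]mul1r ler_pM2r ?invr_gt0// lerDr.
Qed.

(** At the critical index the indicator of [B] belongs to the weight family, so by [exponent_ge0]
    even [kappa - delta] is nonnegative. *)
Lemma critical_index : omega h kappa = beta -> 0 < kappa.
Proof.
move=> crit; have fam : weight_family B beta (omega h kappa) (indicator R B).
  by rewrite crit; exact: indicator_family.
have [C C0 HC] := sparse fam.
by have := exponent_ge0 h1 unbounded HC; rewrite subr_ge0; exact: lt_le_trans.
Qed.

Lemma subset_of_order : (fun n : nat => ln n%:R : R) =O_ \oo (fun n => F n%:R) ->
  exists2 A : set nat, A `<=` B &
    (fun n => (rep_count A h n)%:R : R) =Theta_G (fun n => F n%:R).
Proof.
move=> lnO; have [c [d c0 W]] := weighted_sum_bounds F_rv F_lim F_le om_bounds.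
have [|//|A AB [c' [d' c'0 HA]]] :=
    @order_realization R B beta h F kappa delta h0 B_potter B_pos Fpos F_potter F_le
      kappa0 delta0 sparse (scrS h) c d c0 W _ _.
  have [_] := andP om_bounds; rewrite le_eqVlt => /predU1P[|]; last by right.
  by move=> /critical_index; left.
exists A => //; apply/theta_bounds; exists (c', `|d'| + 1) => /=.
  by rewrite c'0 ltr_wpDl.
near=> n; have n0 : (0 < n)%N by near: n; apply: cvg_within; exists 1%N.
have Fn0 : 0 < F n%:R by apply: Fpos; rewrite ltr0n.
have /andP[r1 r2] : c' * F n%:R <= (rep_count A h n)%:R <= d' * F n%:R by near: n.
rewrite (gtr0_norm Fn0) ger0_norm// r1/= (le_trans r2)// ler_wpM2r ?(ltW Fn0)//.
by rewrite ler_wpDr// ler_norm.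
Unshelve. all: by end_near.
Qed.

(** As [r] has no upper bound, the relative error is moved to [T]: with [T <= (1 + t) * r] one gets
    [(1 - t) * T <= (1 - t ^+ 2) * r <= r], and [t * T] is at most [e * F]. *)
Lemma asymp_le_linear (r T : nat -> R) d : (forall n, 0 <= r n) ->
  (\forall n \near G, `|T n| <= d * F n%:R) -> asymp_le G T r ->
  forall e, 0 < e -> \forall n \near G, T n <= r n + e * F n%:R.
Proof.
move=> r0 Td [s s_lim sT] e e0.
have d1 : 0 < `|d| + 1 by rewrite ltr_wpDl.
pose t := Num.min 1 (e / (`|d| + 1)).
have t0 : 0 < t by rewrite lt_min ltr01 divr_gt0.
have t1 : t <= 1 by rewrite ge_min lexx.
have td : t * (`|d| + 1) <= e by rewrite -ler_pdivlMr// ge_min lexx orbT.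
have st : \forall n \near G, `|s n| <= t.
  have /cvgrPdist_le/(_ t t0) := s_lim.
  by apply: filterS => n; rewrite sub0r normrN.
near=> n; have n0 : (0 < n)%N by near: n; apply: cvg_within; exists 1%N.
have Fn0 : 0 < F n%:R by apply: Fpos; rewrite ltr0n.
have sn : s n <= t.
  have : `|s n| <= t by near: n.
  by apply: le_trans; exact: ler_norm.
have Tn : T n <= (1 + s n) * r n by near: n.
have {}Tn : T n <= (1 + t) * r n by apply: (le_trans Tn); rewrite ler_wpM2r// lerD2l.
have Tn2 : T n <= (`|d| + 1) * F n%:R.
  have : `|T n| <= d * F n%:R by near: n.
  move=> H1; apply: (le_trans (ler_norm _)); apply: (le_trans H1).
  by rewrite ler_wpM2r ?(ltW Fn0)// ler_wpDr// ler_norm.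
have H1 : (1 - t) * T n <= (1 - t) * ((1 + t) * r n) by rewrite ler_wpM2l// subr_ge0.
have H2 : t * T n <= t * ((`|d| + 1) * F n%:R) by rewrite ler_wpM2l// ltW.
have H3 := ler_wpM2r (ltW Fn0) td.
have H4 : 0 <= t * t * r n by rewrite !mulr_ge0// ltW.
by move: H1 H2 H3 H4; move: (r n) (T n) (F n%:R) (`|d|) => r' T' f' d'; lra.
Unshelve. all: by end_near.
Qed.

(* If [omega h kappa = beta], the weights need not tend to 0, and
   [weighted_counting] is also applied to [F x * x `^ (- kappa)]. *)
Lemma asymptotic_subset :
  (forall e, 0 < e -> \forall n \near \oo, ln n%:R <= e * F n%:R) ->
  asymp_le G (fun n => frakS h n * F n%:R) (fun n => (rep_count B h n)%:R) ->
  exists2 A : set nat, A `<=` B &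
      (fun n => (rep_count A h n)%:R : R) ~_G (fun n => frakS h n * F n%:R).
Proof.
move=> ln_small T_le.
have [C C0 HC] := weighted_counting_equiv B_iii Hh h0 F_rv F_lim F_le om_bounds.
have [c [d c0 Wcd]] := weighted_sum_bounds F_rv F_lim F_le om_bounds.
have [/theta_bounds[[s t] /= /andP[s0 t0] Hst] _] := B_iii Hh.
(* Scaling the weights by [M] divides out the constant of (iii), so that the scaled sum is
   asymptotic to [T] itself. *)
pose M := C^-1 `^ h%:R^-1.
have M0 : 0 < M by rewrite powR_gt0// invr_gt0.
have MC : M ^+ h * C = 1.
  by rewrite /M -powR_mulrn ?powR_ge0// -powRrM mulVf ?gt_eqF// powRr1 ?mulVf ?gt_eqF// invr_ge0 ltW.
have Mh0 : 0 < M ^+ h by rewrite exprn_gt0.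
pose T n := frakS h n * F n%:R.
have WT e : 0 < e -> \forall n \near G, `|M ^+ h * wsum h gB n - T n| <= e * `|T n|.
  move=> e0; apply: filterS (HC e e0) => n Hn.
  have {}Hn := ler_wpM2l (ltW Mh0) Hn.
  have -> : M ^+ h * wsum h gB n - T n = M ^+ h * (wsum h gB n - frakS h n * C * F n%:R).
    by rewrite mulrBr; congr (_ - _); rewrite /T -[LHS]mul1r -MC; ring.
  rewrite normrM gtr0_norm//; apply: (le_trans Hn).
  by rewrite !normrM (gtr0_norm C0) -[leRHS]mul1r -MC /T ?normrM le_eqVlt; apply/orP; left; apply/eqP; ring.
have T_bounds : \forall n \near G, s * F n%:R <= `|T n| <= t * F n%:R.
  near=> n; have n0 : (0 < n)%N by near: n; apply: cvg_within; exists 1%N.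
  have Fn0 : 0 < F n%:R by apply: Fpos; rewrite ltr0n.
  have : s * `|1 : R| <= `|frakS h n| <= t * `|1 : R| by near: n.
  rewrite normr1 !mulr1 /T normrM (gtr0_norm Fn0) => /andP[H1 H2].
  by rewrite !ler_wpM2r// ltW.
suff [A AB HA] : exists2 A : set nat, A `<=` B & forall e, 0 < e ->
    \forall n \near G, `|(rep_count A h n)%:R - M ^+ h * wsum h gB n| <= e * F n%:R.
  exists A => //; apply/equiv_nearP => e e0.
  have e2 : 0 < e / 2 by rewrite divr_gt0.
  have se2 : 0 < s * (e / 2) by rewrite mulr_gt0.
  near=> n.
  have H1 : `|(rep_count A h n)%:R - M ^+ h * wsum h gB n| <= s * (e / 2) * F n%:R.
    by near: n; exact: HA.
  have H2 : `|M ^+ h * wsum h gB n - T n| <= e / 2 * `|T n| by near: n; exact: WT.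
  have /andP[H3 _] : s * F n%:R <= `|T n| <= t * F n%:R by near: n.
  have {}H3 := ler_wpM2l (ltW e2) H3.
  rewrite -/(T n); have := ler_distD (M ^+ h * wsum h gB n) (rep_count A h n)%:R (T n).
  by move: H1 H2 H3; move: (F n%:R) `|T n| => f' T'; lra.
have [ob|bo] := ltP (omega h kappa) beta.
  apply: (@scaled_realization R B beta h F kappa delta h0 B_potter B_pos Fpos F_potter F_le
      kappa0 delta0 sparse (scrS h) c d c0 Wcd M M0); last by right.
  have M0' : 0 < M^-1 by rewrite invr_gt0.
  apply: filterS (ratio_weight_vanishes h0 B_potter B_pos Fpos F_potter ob M0') => b gM.
  by rewrite mulrC -ler_pdivlMr// mul1r.
have crit : omega h kappa = beta by apply/le_anti; rewrite bo andbT; case/andP: om_bounds.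
have kappa_gt0 := critical_index crit.
(* The twisted function then has index 0 and its root weight the index 1/h, the least that (iii)
   admits. *)
pose theta := kappa / h%:R.
have theta0 : 0 < theta by rewrite divr_gt0.
have htheta : h%:R * theta = kappa by rewrite /theta mulrC divfK ?gt_eqF.
pose F' := twisted F (h%:R * theta).
have F'_lim lambda : 0 < lambda -> F' (lambda * x) / F' x @[x --> +oo] --> lambda `^ (0 : R).
  by rewrite -[X in _ `^ X](subrr kappa) -{2}htheta; exact: twisted_lim.
have F'_le : asymp_le \oo (fun n => F' n%:R) (fun n => (rep_count B h n)%:R).
  have [e elim eF] := F_le; exists e => //; near=> n.
  have n0 : (0 < n)%N by near: n; exists 1%N.
  have Fn0 : 0 < F n%:R by apply: Fpos; rewrite ltr0n.
  apply: (@le_trans _ _ (F n%:R)); last by near: n.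
  rewrite /F' /twisted ler_piMr ?(ltW Fn0)// -[leRHS](powRr0 n%:R) ler_powR ?ler1n//.
  by rewrite htheta oppr_le0.
have om' : h%:R^-1 <= omega h (0 : R) <= beta.
  by rewrite /omega add0r mul1r lexx/=; case/andP: om_bounds => /le_trans; apply.
have [c' [d' c'0 W']] := weighted_sum_bounds (twisted_regular F_rv F_lim _) F'_lim F'_le om'.
have W_up : \forall n \near G, wsum h (fun b => M * gB b) n <= M ^+ h * `|d| * F n%:R.
  near=> n; have n0 : (0 < n)%N by near: n; apply: cvg_within; exists 1%N.
  have Fn0 : 0 < F n%:R by apply: Fpos; rewrite ltr0n.
  have /andP[_ H1] : c * F n%:R <= wsum h gB n <= d * F n%:R by near: n.
  rewrite wsumZ -mulrA ler_wpM2l ?(ltW Mh0)// (le_trans H1)//.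
  by rewrite ler_wpM2r ?(ltW Fn0)// ler_norm.
pose q b := Num.min 1 (M * gB b).
have trunc e : 0 < e -> \forall n \near G,
    wsum h (fun b => M * gB b) n - wsum h q n <= e * F n%:R.
  apply: (@truncated_sum R B h F kappa beta delta theta M h0 B_potter B_pos Fpos F_potter crit
    theta0 delta0 M0 (scrS h) (M ^+ h * `|d|) (M ^+ h * `|d'|)) => //.
  - by move=> b; rewrite mulr_ge0 ?(ltW M0) ?ratio_weight_ge0.
  - by move=> b; rewrite mulf_eq0 negb_or => /andP[_ /ratio_weight_support].
  - by move=> b b0 Bb; rewrite ratio_fun_weight.
  - by rewrite mulr_ge0// ltW.
  - by rewrite mulr_ge0// ltW.
  - near=> n; have n0 : (0 < n)%N by near: n; apply: cvg_within; exists 1%N.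
    have Fn0 : 0 < F n%:R by apply: Fpos; rewrite ltr0n.
    have /andP[_ H1] : c' * F' n%:R <= wsum h (ratio_weight B h F') n <= d' * F' n%:R by near: n.
    have -> : wsum h (fun b => M * gB b * b%:R `^ (- theta)) n = M ^+ h * wsum h (ratio_weight B h F') n.
      rewrite -wsumZ; congr wsum; apply/funext => b.
      by rewrite (ratio_weight_twisted F_rv)// mulrA.
    rewrite mulrCA -mulrA ler_wpM2l ?(ltW Mh0)//.
    have P0 : 0 < (n%:R `^ theta) ^+ h :> R by rewrite exprn_gt0// powR_gt0// ltr0n.
    apply: (le_trans (ler_wpM2l (ltW P0) H1)).
    have -> : (n%:R `^ theta) ^+ h * (d' * F' n%:R) = d' * F n%:R.
      rewrite /F' /twisted -powR_mulrn ?powR_ge0// -powRrM mulrC [theta * _]mulrC htheta powRN.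
      by field; rewrite gt_eqF// powR_gt0// ltr0n.
    by rewrite ler_wpM2r ?(ltW Fn0)// ler_norm.
  (* The scaled sum is asymptotic to [T], and [T_le] bounds [T] by r_B. This is what lets the full
     sum be replaced by the representations in [B] where the weights exceed 1. *)
  move=> e1 e10; have e2 : 0 < e1 / 2 by rewrite divr_gt0.
  have e3 : 0 < e1 / 2 / t by rewrite divr_gt0.
  have T_up : \forall n \near G, `|T n| <= t * F n%:R by apply: filterS T_bounds => n /andP[].
  near=> n.
  have H1 : T n <= (rep_count B h n)%:R + e1 / 2 * F n%:R.
    by near: n; exact: asymp_le_linear T_up T_le _ e2.
  have H2 : `|M ^+ h * wsum h gB n - T n| <= e1 / 2 / t * `|T n| by near: n; exact: WT.
  have H3 : `|T n| <= t * F n%:R by near: n.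
  have {}H2 : M ^+ h * wsum h gB n - T n <= e1 / 2 * F n%:R.
    apply: (le_trans (ler_norm _)); apply: (le_trans H2).
    apply: (le_trans (ler_wpM2l (ltW e3) H3)).
    by rewrite mulrA divfK ?gt_eqF.
  rewrite wsumZ; move: H1 H2; move: (M ^+ h * wsum h gB n) (T n) (F n%:R) (rep_count B h n)%:R => a1 a2 a3 a4.
  lra.
have q0 b : 0 <= q b by rewrite /q le_min ler01 mulr_ge0 ?(ltW M0) ?ratio_weight_ge0.
have qle b : q b <= M * gB b by rewrite /q ge_min lexx orbT.
have qw : weight_family B beta (omega h kappa) q.
  have [v0 vB vC] := ratio_weight_family h0 B_potter B_pos Fpos F_potter (ltW M0).
  split => // [b qb|a a0].
    apply: vB; apply: contraNneq qb => vb; apply/eqP/le_anti.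
    by rewrite q0 andbT (le_trans (qle b))// vb.
  by have [K HK] := vC a a0; exists K => b b0; exact: le_trans (qle b) (HK b b0).
have q1 b : q b <= 1 by rewrite /q ge_min lexx.
have kd : kappa - delta < kappa by rewrite ltrBlDr ltrDl.
have cM : 0 < M ^+ h * c / 2 by rewrite divr_gt0// mulr_gt0.
have wq n : wsum h q n <= wsum h (fun b => M * gB b) n.
  by apply: wsum_mono => b; rewrite q0 qle.
have [|A AB HA] := @realization R B beta (omega h kappa) kappa delta h h0 delta0 sparse F q 1
  (scrS h) (M ^+ h * c / 2) (M ^+ h * `|d|) Fpos qw q1 (nearW _ q1) cM _
  (local_power_negligible Fpos F_potter kappa0 delta0 (or_introl kappa_gt0))
  (fun e => @power_negligible R F kappa Fpos F_potter _ e kd).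
  near=> n; have n0 : (0 < n)%N by near: n; apply: cvg_within; exists 1%N.
  have Fn0 : 0 < F n%:R by apply: Fpos; rewrite ltr0n.
  have /andP[W1 _] : c * F n%:R <= wsum h gB n <= d * F n%:R by near: n.
  have W2 : wsum h (fun b => M * gB b) n <= M ^+ h * `|d| * F n%:R by near: n.
  have W3 : wsum h (fun b => M * gB b) n - wsum h q n <= M ^+ h * c / 2 * F n%:R.
    by near: n; exact: trunc.
  rewrite (le_trans (wq n) W2) andbT.
  have {}W1 := ler_wpM2l (ltW Mh0) W1.
  move: W1 W3; rewrite wsumZ mulrA; move: (M ^+ h * wsum h gB n) (wsum h q n) (M ^+ h * c) (F n%:R) => a1 a2 a3 a4.
  lra.
exists A => // e e0; have e2 : 0 < e / 2 by rewrite divr_gt0.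
near=> n.
have H1 : `|(rep_count A h n)%:R - wsum h q n| <= e / 2 * F n%:R by near: n; exact: HA.
have H2 : wsum h (fun b => M * gB b) n - wsum h q n <= e / 2 * F n%:R by near: n; exact: trunc.
have H3 := wq n; rewrite wsumZ in H2 H3.
move: H1; rewrite !ler_norml => /andP[H1 H1'].
move: H1 H1' H2 H3; move: (M ^+ h * wsum h gB n) (wsum h q n) (F n%:R) (rep_count A h n)%:R => a1 a2 a3 a4.
by move=> *; apply/andP; split; lra.
Unshelve. all: by end_near.
Qed.
End Assembly.

Lemma ln_negligible (R : realType) (F : R -> R) :
  (F n%:R / ln n%:R) @[n --> \oo] --> +oo ->
  forall e, 0 < e -> \forall n \near \oo, ln n%:R <= e * F n%:R.
Proof.
move=> Flim e e0; near=> n.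
have n1 : (1 < n)%N by near: n; exists 2%N.
have ln0 : 0 < ln n%:R :> R by rewrite ln_gt0// ltr1n.
have : e^-1 <= F n%:R / ln n%:R by near: n; move/cvgryPge: Flim; apply.
by rewrite ler_pdivlMr// ler_pdivrMl.
Unshelve. all: by end_near.
Qed.

Theorem theorem1p4 (R : realType) (B : set nat) (beta : R) (Hii Hiii : nat)
    (frakS : nat -> nat -> R) (scrS : nat -> set nat)
    (Hii_ge1 : (1 <= Hii)%N) (Hiii_ge1 : (1 <= Hiii)%N)
    (B_i : regular_set B beta)
    (B_ii : low_additive_energy R B Hii)
    (B_iii : weighted_counting B beta Hiii frakS scrS)
    (F : R -> R) (F_rv : regularly_varying F)
    (h : nat) (h_ge : (maxn (2 * Hii + 1) Hiii <= h)%N)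
    (F_le : asymp_le \oo (fun n => F n%:R) (fun n => (rep_count B h n)%:R)) :
  ((F n%:R / ln n%:R) @[n --> \oo] --> +oo ->
    asymp_le (within (scrS h) \oo)
      (fun n => frakS h n * F n%:R) (fun n => (rep_count B h n)%:R) ->
    exists2 A : set nat, A `<=` B &
      (fun n => (rep_count A h n)%:R : R) ~_(within (scrS h) \oo)
      (fun n => frakS h n * F n%:R)) /\
  ((fun n : nat => ln n%:R : R) =O_ \oo (fun n => F n%:R) ->
    exists2 A : set nat, A `<=` B &
      (fun n => (rep_count A h n)%:R : R) =Theta_(within (scrS h) \oo)
      (fun n => F n%:R)).
Proof.
move: h_ge; rewrite geq_max => /andP[Hii_h Hiii_h].
have h1 : (1 < h)%N.
  by apply: leq_trans Hii_h; rewrite addn1 ltnS muln_gt0.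
have h0 : (0 < h)%N by exact: ltnW.
have Fpos x : 0 < x -> 0 < F x by case: F_rv => -[+ _] _; apply.
have unbounded := base_unbounded Fpos F_le.
have [kappa F_potter F_lim] := regularly_varying_potter F_rv.
have [b [_ b0 Bb]] := unbounded 0%N.
have B_pos : exists2 b, (0 < b)%N & B b by exists b.
have B_potter := regular_set_potter B_i B_pos.
have B_energy k (Hk : (Hii <= k)%N) := energy_indicator B_potter B_pos B_ii Hk (leq_trans Hii_ge1 Hk).
(* Nonnegativity of [kappa], which either growth hypothesis on [F] implies, gives omega >= 1/h;
   below that [exponent_gap] yields no saving. *)
have sparse : 0 <= kappa -> exists2 delta, 0 < delta &
    forall p, weight_family B beta (omega h kappa) p -> exists2 C, 0 <= C &
    forall N j m, (0 < j < h)%N -> (0 < m)%N ->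
    (dilations_poly N p h ^+ j)`_m <= C * m%:R `^ (kappa - delta).
  move=> kappa0; have om : h%:R^-1 <= omega h kappa.
    by rewrite /omega -[leLHS]mul1r ler_pM2r ?invr_gt0 ?ltr0n// lerDr.
  have [delta delta0 Hd] := coef_bound Hii_ge1 Hii_h om (fun k Hk e => B_energy e k Hk).
  exists delta => // p /Hd[C C0 HC]; exists C => // N j m jh m0.
  have -> : kappa - delta = h%:R * omega h kappa - 1 - delta.
    by rewrite /omega; field; rewrite gt_eqF// ltr0n.
  exact: HC.
split => [F_ln S_le|lnO].
  have ln_small := ln_negligible F_ln.
  have kappa0 : 0 <= kappa.
    apply: index_ge0 Fpos F_potter _; apply/eqO_exP; exists 1 => //.
    near=> n; have n0 : (0 < n)%N by near: n; exists 1%N.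
    rewrite ger0_norm; last by rewrite ln_ge0// ler1n.
    apply: (@le_trans _ _ (1 * F n%:R)); last by rewrite ler_wpM2l// ler_norm.
    by near: n; exact: ln_small.
  have [delta delta0 Hd] := sparse kappa0.
  exact: (asymptotic_subset h0 Hiii_h B_iii F_rv F_lim F_potter B_potter unbounded F_le kappa0
    delta0 h1 Hd ln_small S_le).
have kappa0 := index_ge0 Fpos F_potter lnO.
have [delta delta0 Hd] := sparse kappa0.
exact: (subset_of_order h0 Hiii_h B_iii F_rv F_lim F_potter B_potter unbounded F_le kappa0
  delta0 h1 Hd lnO).
Unshelve. all: by end_near.
Qed.
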